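(* Suppose $0<q\le p<\infty$ and let $\{r_k\}_{k=1}^\infty$ be a fixed sequence of positive numbers. Suppose that $K\in\mathcal E(1)$ and that, for some constant $A<\infty$, the inequality $$\Big\|\Big(\sum_k|r_k^d K(r_k\cdot) *f_k|^q\Big)^{1/q}\Big\|_{L^p(\mathbb R^d)}\le A \Big\|\Big(\sum_k|f_k|^q\Big)^{1/q}\Big\|_{L^p(\mathbb R^d)}$$ holds for all choices of $f_k\in\mathcal E(2r_k)$ with $\{f_k\}\in L^p(\ell^q)$. Then $K\in L^q(\mathbb R^d)$ and there exists a constant $C(p,q,d)$, depending only on $p,q,d$ (in particular not on the choice of the sequence $\{r_k\}$), such that $$\|K\|_{L^q(\mathbb R^d)}\le C(p,q,d)\,A.$$
   Context: For $r>0$, $\mathcal E(r)$ denotes the space of all tempered distributions on $\mathbb R^d$ whose Fourier transforms are supported in $\{\xi:|\xi|\le r\}$ (such distributions are smooth functions). $L^p(\ell^q)$ is the space of sequences $\{f_k\}$ of measurable functions on $\mathbb R^d$ with $\|\{f_k\}\|_{L^p(\ell^q)}=\|(\sum_k|f_k|^q)^{1/q}\|_{L^p(\mathbb R^d)}<\infty$ (a quasi-norm if $p<1$ or $q<1$). The hypothesis that the inequality holds is understood to include that the convolutions on the left are meaningful. *)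

(* Defs.v *)
From HB Require Import structures.
From mathcomp Require Import all_boot all_order all_algebra complex.
From mathcomp Require Import all_classical all_reals all_analysis.

Set Implicit Arguments.
Unset Strict Implicit.
Unset Printing Implicit Defensive.
Import Order.TTheory GRing.Theory Num.Theory.
Import numFieldNormedType.Exports.
Import complex.ComplexField.Normc.

Local Open Scope classical_set_scope.
Local Open Scope ring_scope.
Local Open Scope complex_scope.

(* The sigma-algebra on 'rV[R]_n generated by the coordinates, as the library
   does for tuples; it is the Borel sigma-algebra. *)
Section measurable_rV.
Context {R : realType} (n : nat).

Let coord : 'I_n -> 'rV[R]_n -> measurableTypeR R := fun i v => v ord0 i.

Let rV_set0 : g_sigma_preimage coord set0.
Proof. exact: sigma_algebra0. Qed.

Let rV_setC A : g_sigma_preimage coord A -> g_sigma_preimage coord (~` A).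
Proof. exact: sigma_algebraC. Qed.

Let rV_bigcup (F : (set 'rV[R]_n)^nat) :
  (forall i, g_sigma_preimage coord (F i)) ->
  g_sigma_preimage coord (\bigcup_i (F i)).
Proof. exact: sigma_algebra_bigcup. Qed.

HB.instance Definition _ := @isMeasurable.Build default_measure_display
  'rV[R]_n (g_sigma_preimage coord) rV_set0 rV_setC rV_bigcup.

Lemma measurable_coord (i : 'I_n) :
  measurable_fun [set: 'rV[R]_n] (coord i).
Proof.
move=> _ Y mY; rewrite setTI; apply: sub_sigma_algebra => /=.
rewrite -bigcup_seq/=; exists i => /=; first by rewrite mem_index_enum.
by exists Y => //; rewrite setTI.
Qed.

Lemma measurable_fun_rV d (T : measurableType d) (f : T -> 'rV[R]_n) :
  (forall i, measurable_fun [set: T] (coord i \o f)) ->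
  measurable_fun [set: T] f.
Proof.
move=> mf _ A mA; rewrite setTI.
suff: g_sigma_preimage coord `<=` [set B | d.-measurable (f @^-1` B)].
  exact.
apply: smallest_sub; first split=> /=.
- by rewrite preimage_set0; exact: measurable0.
- by move=> B mB; rewrite setTD preimage_setC; exact: measurableC.
- by move=> F mF; rewrite preimage_bigcup; exact: bigcupT_measurable.
rewrite -bigcup_seq => B [i _ [C mC <-]] /=.
by rewrite setTI -comp_preimage -[X in measurable X]setTI; exact: mf.
Qed.

End measurable_rV.

Section lebesgue_rV.
Context {R : realType}.

Definition cons_rV n (u : measurableTypeR R * 'rV[R]_n) : 'rV[R]_n.+1 :=
  row_mx (u.1 : R)%:M u.2 : 'rV[R]_(1 + n).

Definition uncons_rV n (v : 'rV[R]_n.+1) : measurableTypeR R * 'rV[R]_n :=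
  (v ord0 ord0, rsubmx (v : 'rV[R]_(1 + n))).

Lemma cons_rVK n : cancel (@cons_rV n) (@uncons_rV n).
Proof.
case=> a v; rewrite /cons_rV /uncons_rV row_mxKr; congr pair.
have -> : (ord0 : 'I_n.+1) = lshift n (ord0 : 'I_1) by exact: val_inj.
by rewrite [LHS]row_mxEl mxE.
Qed.

Lemma measurable_cons_rV n : measurable_fun setT (@cons_rV n).
Proof.
apply: measurable_fun_rV => i.
rewrite /cons_rV /=; case: (split_ordP (i : 'I_(1 + n))) => j ->.
  rewrite (_ : _ \o _ = fst); first exact: measurable_fst.
  by apply/funext => u /=; rewrite [LHS]row_mxEl mxE (ord1 j).
rewrite (_ : _ \o _ = (fun v : 'rV[R]_n => v ord0 j) \o snd).
  by apply: measurableT_comp => //; exact: measurable_coord.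
by apply/funext => u /=; rewrite [LHS]row_mxEr.
Qed.

Lemma measurable_uncons_rV n : measurable_fun setT (@uncons_rV n).
Proof.
apply: measurable_fun_pair; first exact: measurable_coord.
apply: measurable_fun_rV => i.
rewrite (_ : _ \o _ = fun v : 'rV[R]_(1 + n) => v ord0 (rshift 1 i)).
  exact: (@measurable_coord R n.+1).
by apply/funext => v /=; rewrite mxE.
Qed.

Definition lebesgue_rV_succ n
    (mu : {sigma_finite_measure set 'rV[R]_n -> \bar R}) :
    set 'rV[R]_n.+1 -> \bar R :=
  pushforward (@lebesgue_measure R \x mu)%E (@cons_rV n).

Section lebesgue_rV_succ.
Variables (n : nat) (mu : {sigma_finite_measure set 'rV[R]_n -> \bar R}).

HB.instance Definition _ := Measure.copy (lebesgue_rV_succ mu)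
  (@measure_function_pushforward__canonical__measure_function_Measure
     _ _ _ _ _ _ _ (@measurable_cons_rV n)).

Let lebesgue_rV_succ_sigma_finite : sigma_finite setT (lebesgue_rV_succ mu).
Proof.
have /sigma_finiteP[F [FT ndF Foo]] := sigma_finiteT (@lebesgue_measure R).
have /sigma_finiteP[G [GT ndG Goo]] := sigma_finiteT mu.
exists (fun k => @uncons_rV n @^-1` (F k `*` G k)).
  apply/seteqP; split => // v _.
  have : [set: measurableTypeR R] (uncons_rV v).1 by [].
  have : [set: 'rV[R]_n] (uncons_rV v).2 by [].
  rewrite {1}FT {1}GT => -[k _ Gk] [l _ Fl]; exists (maxn k l) => //; split.
    by move: (uncons_rV v).1 Fl; exact/subsetPset/ndF/leq_maxr.
  by move: (uncons_rV v).2 Gk; exact/subsetPset/ndG/leq_maxl.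
move=> k; have [mF Fk] := Foo k; have [mG Gk] := Goo k.
have mFG : measurable (F k `*` G k) by exact: measurableX.
split; first by rewrite -[X in measurable X]setTI; exact: measurable_uncons_rV.
rewrite /lebesgue_rV_succ /pushforward -comp_preimage.
rewrite (_ : @uncons_rV n \o @cons_rV n = id) ?preimage_id; last first.
  by apply/funext => u /=; exact: cons_rVK.
by rewrite product_measure1E// lte_mul_pinfty// ge0_fin_numE.
Qed.

HB.instance Definition _ := Measure_isSigmaFinite.Build _ _ _
  (lebesgue_rV_succ mu) lebesgue_rV_succ_sigma_finite.

End lebesgue_rV_succ.

Fixpoint lebesgue_rV n : {sigma_finite_measure set 'rV[R]_n -> \bar R} :=
  match n with
  | 0%N => dirac (0 : 'rV[R]_0)
  | n'.+1 => lebesgue_rV_succ (lebesgue_rV n')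
  end.

End lebesgue_rV.

Lemma measurable_box (R : realType) n (A : 'I_n -> set (measurableTypeR R)) :
  (forall i, measurable (A i)) ->
  measurable [set v : 'rV[R]_n | forall i, A i (v ord0 i)].
Proof.
move=> mA; rewrite (_ : mkset _ = \bigcap_(i in [set: 'I_n])
    ((fun v : 'rV[R]_n => v ord0 i) @^-1` A i)).
  apply: fin_bigcap_measurable => // i _; rewrite -[X in measurable X]setTI.
  exact: (@measurable_coord R n i).
by apply/seteqP; split => [v h i _|v h i]; [exact: h|exact: (h i I)].
Qed.

Lemma lebesgue_rV_box (R : realType) n (A : 'I_n -> set (measurableTypeR R)) :
  (forall i, measurable (A i)) ->
  lebesgue_rV n [set v : 'rV[R]_n | forall i, A i (v ord0 i)] =
  (\prod_(i < n) lebesgue_measure (A i))%E.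
Proof.
elim: n A => [|n IH] A mA.
  by rewrite big_ord0 /= diracE mem_set// => -[].
rewrite big_ord_recl -IH// /= /lebesgue_rV_succ /pushforward.
rewrite (_ : _ @^-1` _ = A ord0 `*`
    [set v : 'rV[R]_n | forall i, A (lift ord0 i) (v ord0 i)]).
  have mB := @measurable_box R n _ (fun i => mA (lift ord0 i)).
  by rewrite product_measure1E//.
have h0 (u : measurableTypeR R * 'rV[R]_n) : cons_rV u ord0 ord0 = u.1.
  exact: (congr1 fst (@cons_rVK R n u)).
have hS (u : measurableTypeR R * 'rV[R]_n) i :
    cons_rV u ord0 (lift ord0 i) = u.2 ord0 i.
  rewrite /cons_rV (_ : lift ord0 i = rshift 1 i); last exact: val_inj.
  by rewrite [LHS]row_mxEr.
apply/seteqP; split => u /= h.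
  split; first by rewrite -h0.
  by move=> i; rewrite -hS.
move=> i; case: (unliftP ord0 i) => [j|] ->; first by rewrite hS; exact: h.2.
by rewrite h0; exact: h.1.
Qed.

Section euclidean.
Context {R : realType} {d : nat}.

Definition dotp (x y : 'rV[R]_d) : R := \sum_(i < d) x ord0 i * y ord0 i.

(* The library norm `|x| on 'rV[R]_d is the sup norm. *)
Definition enorm (x : 'rV[R]_d) : R := Num.sqrt (dotp x x).

End euclidean.

Section complex_integral.
Context {d : measure_display} {T : measurableType d} {R : realType}.
Implicit Types (mu : {measure set T -> \bar R}) (f : T -> R[i]).

Definition cmeasurable f :=
  measurable_fun setT (fun x => complex.Re (f x)) /\
  measurable_fun setT (fun x => complex.Im (f x)).

Definition cintegrable mu f :=
  mu.-integrable setT (fun x => (complex.Re (f x))%:E) /\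
  mu.-integrable setT (fun x => (complex.Im (f x))%:E).

Definition cintegral mu f : R[i] :=
  (\int[mu]_x complex.Re (f x)) +i* (\int[mu]_x complex.Im (f x)).

End complex_integral.

Section schwartz.
Context {R : realType} {d : nat}.
Implicit Types (f phi psi : 'rV[R]_d -> R[i]) (s : seq 'I_d).

(* [:: i1; ...; ik] is sent to the iterated partial derivative
   d_i1 (... (d_ik f)). *)
Definition partials s (f : 'rV[R]_d -> R) : 'rV[R]_d -> R :=
  foldr (fun i (g : 'rV[R]_d -> R) x => 'D_(delta_mx ord0 i) g x) f s.

Definition cpartials s f (x : 'rV[R]_d) : R[i] :=
  partials s (fun y => complex.Re (f y)) x +i*
  partials s (fun y => complex.Im (f y)) x.

Definition smooth f := forall s (x : 'rV[R]_d),
  differentiable (partials s (fun y => complex.Re (f y))) x /\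
  differentiable (partials s (fun y => complex.Im (f y))) x.

Definition schwartz_norm (N : nat) phi : \bar R := ereal_sup
  [set t | exists s x, (size s <= N)%N /\
     t = ((1 + enorm x) ^+ N * normc (cpartials s phi x))%:E].

Definition schwartz phi :=
  smooth phi /\ forall N, (schwartz_norm N phi < +oo)%E.

Definition test_function phi :=
  smooth phi /\ compact (closure [set x | phi x != 0]).

(* Normalized as int e^(- i x.xi) phi x dx; including a factor 2 pi in the
   exponent would only rescale E(r). *)
Definition fourier phi (xi : 'rV[R]_d) : R[i] :=
  cintegral (lebesgue_rV d)
    (fun x => (cos (dotp x xi) -i* sin (dotp x xi)) * phi x).

(* A distribution is a functional on all functions; only its values on
   Schwartz functions are meaningful. *)
Definition tempered_distribution (T : ('rV[R]_d -> R[i]) -> R[i]) :=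
  (forall (a : R[i]) phi psi, schwartz phi -> schwartz psi ->
     T (fun x => a * phi x + psi x) = a * T phi + T psi) /\
  exists (N : nat) (C : R), forall phi, schwartz phi ->
    ((normc (T phi))%:E <= C%:E * schwartz_norm N phi)%E.

Definition fourier_distribution (T : ('rV[R]_d -> R[i]) -> R[i]) :
    ('rV[R]_d -> R[i]) -> R[i] :=
  fun phi => T (fourier phi).

Definition supported_in (A : set 'rV[R]_d)
    (T : ('rV[R]_d -> R[i]) -> R[i]) :=
  forall phi, test_function phi ->
    closure [set x | phi x != 0] `&` A = set0 -> T phi = 0.

Definition represents f (T : ('rV[R]_d -> R[i]) -> R[i]) :=
  forall phi, schwartz phi ->
    cintegrable (lebesgue_rV d) (fun x => f x * phi x) /\
    T phi = cintegral (lebesgue_rV d) (fun x => f x * phi x).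

(* The elements of E(r) are smooth functions: T is identified with the smooth
   function f representing it. *)
Definition E_space (r : R) : set ('rV[R]_d -> R[i]) :=
  [set f | smooth f /\ exists T, [/\ tempered_distribution T,
     supported_in [set xi | enorm xi <= r] (fourier_distribution T) &
     represents f T]].

End schwartz.

Section lebesgue_spaces.
Context {R : realType} {d : nat}.
Implicit Types (f g : 'rV[R]_d -> R[i]) (fs : nat -> 'rV[R]_d -> R[i]).

Definition Lp_norm (p : R) f : \bar R :=
  Lnorm (lebesgue_rV d) p%:E (fun x => (normc (f x))%:E).

Definition in_Lp (p : R) f := cmeasurable f /\ (Lp_norm p f < +oo)%E.

Definition LpLq_norm (p q : R) fs : \bar R :=
  Lnorm (lebesgue_rV d) p%:E
    (fun x => (\sum_(k <oo) (normc (fs k x) `^ q)%:E) `^ q^-1)%E.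

Definition in_LpLq (p q : R) fs :=
  (forall k, cmeasurable (fs k)) /\ (LpLq_norm p q fs < +oo)%E.

(* The integral defining (f * g)(x) converges absolutely for almost every x;
   elsewhere the value of convolution below is irrelevant. *)
Definition convolvable f g :=
  {ae (lebesgue_rV d : {measure set 'rV[R]_d -> \bar R}),
     forall x, cintegrable (lebesgue_rV d) (fun y => f (x - y) * g y)}.

Definition convolution f g (x : 'rV[R]_d) : R[i] :=
  cintegral (lebesgue_rV d) (fun y => f (x - y) * g y).

Definition dilate (r : R) f : 'rV[R]_d -> R[i] :=
  fun x => (r ^+ d)%:C * f (r *: x).

End lebesgue_spaces.

(* Main.v *)
Require Import Defs.
From HB Require Import structures.
From mathcomp Require Import all_boot all_order all_algebra complex.
From mathcomp Require Import all_classical all_reals all_analysis measurable_realfun.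
From mathcomp Require Import ring lra.

(** The hypothesis is tested on random sums of translates of one fixed kernel.

Let [kern] be the inverse Fourier transform of a smooth bump which equals 1 on
the unit ball and vanishes off the ball of radius sqrt 2. A member K of E(1)
satisfies kern * K = K (lemma [reproducing]), and a packet
  f x = \sum_j c_j kern (r x - j)
is in E(2 r) (lemma [E_packet]). The convolution of a dilate of K with a packet
is then computed exactly (lemma [convolution_packet]): it replaces kern by K,
  r^d K(r .) * f = \sum_j c_j K (r x - j).

Fix n and colour the lattice Z^d modulo 2 n, with N = (2 n)^d colours. Only the
first N of the r_k are used. For every k < N choose, independently, a random
colour and random signs, and let f_k be the signed sum of the kern (r_k x - j)
over the j of that colour in the cube [0, r_k L)^d, where L is so large that
r_k L >= 2 n for all k < N.

- The right-hand side is small on average ([upper_point]). At a given point x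
  the rapid decay of kern bounds |f_k x|^q by a multiple of
  W(x / L)^(q / p) U_k(a), where a is the colour, W is integrable, and the
  weights satisfy \sum_a U_k(a) <= 8^d. So \sum_k U_k(a_k) is a sum of N
  independent variables, each bounded by 8^d and of mean at most 8^d / N; its
  exponential moment, and therefore the mean of its power p / q, is bounded
  independently of N. The integral over x of the mean is at most a constant
  times L^d.
- The left-hand side is large on average ([lower_point]). Averaging over the
  signs isolates one translate of K, and for two lattice points j of
  one colour the boxes j + [-n, n)^d are disjoint. Hence the mean of
  \sum_k |r_k^d K(r_k .) * f_k|^q is at least
  (2 N)^-1 \sum_k \sum_j (|K|^q 1_{[-n,n)^d}) (r_k x - j), whose integral is at
  least 2^-1 (L / 2)^d times the integral of |K|^q over [-n, n)^d. Since
  p / q >= 1 a tangent line ([powR_tangent]) passes from this mean to the mean of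
  the power p / q.

In the comparison both N and L cancel, so that the integral of |K|^q over
[-n, n)^d is at most C A^q with C independent of n and of the r_k
([box_bound]); n tends to infinity. A bound which holds on average is used for
both sides, so no single choice of colours and signs has to be good for all x.

The Fourier analysis is real: [osc a n] is the integral of a(xi) times the n-th
derivative of the cosine at x.xi, which treats cosine and sine transforms at
once and is closed under differentiation and under multiplication by
coordinates. *)

Set Implicit Arguments.
Unset Strict Implicit.
Unset Printing Implicit Defensive.
Import Order.TTheory GRing.Theory Num.Theory.
Import numFieldNormedType.Exports.
Import complex.ComplexField.Normc.
Local Open Scope classical_set_scope.
Local Open Scope ring_scope.

(** * Lebesgue measure on row vectors *)

Section lebesgue_rV_theory.
Context {R : realType}.
Implicit Types (n : nat).

Lemma measurable_entry n (i : 'I_n) :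
  measurable_fun [set: 'rV[R]_n] (fun v : 'rV[R]_n => (v ord0 i : measurableTypeR R)).
Proof. exact: measurable_coord. Qed.

Lemma cons_rV0 n (u : measurableTypeR R * 'rV[R]_n) : cons_rV u ord0 ord0 = u.1.
Proof. exact: (congr1 fst (@cons_rVK R n u)). Qed.

Lemma cons_rVS n (u : measurableTypeR R * 'rV[R]_n) i :
  cons_rV u ord0 (lift ord0 i) = u.2 ord0 i.
Proof.
rewrite /cons_rV (_ : lift ord0 i = rshift 1 i); last exact: val_inj.
by rewrite [LHS]row_mxEr.
Qed.

(** The measure on R^(n+1) is an image of a product measure, so Tonelli gives
    the one-coordinate-at-a-time formula on which the inductions over the
    dimension rest. *)
Lemma ge0_integral_rVS n (f : 'rV[R]_n.+1 -> \bar R) :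
  measurable_fun setT f -> (forall x, 0 <= f x)%E ->
  (\int[@lebesgue_rV R n.+1]_x f x =
   \int[lebesgue_measure]_a \int[@lebesgue_rV R n]_v f (cons_rV (a, v)))%E.
Proof.
move=> mf f0.
transitivity (\int[(@lebesgue_measure R \x @lebesgue_rV R n)%E]_u f (cons_rV u))%E.
  rewrite /= /lebesgue_rV_succ ge0_integral_pushforward//.
  exact: measurable_cons_rV.
rewrite (@fubini_tonelli1 _ _ _ _ _ _ _ (f \o @cons_rV R n))//.
- by apply: measurableT_comp => //; exact: measurable_cons_rV.
- by move=> u; exact: f0.
Qed.

(** Both sides are measures in A that agree on half-open intervals, and
    Lebesgue measure is the unique one with its values there. *)
Lemma lebesgue_affine (r b : R) (A : set (measurableTypeR R)) :
  r != 0 -> measurable A ->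
  lebesgue_measure A = (`|r|%:E * lebesgue_measure
    ((fun a : measurableTypeR R => r * a + b : measurableTypeR R)%R @^-1` A))%E.
Proof.
move=> r0 mA.
set h := (fun a : measurableTypeR R => r * a + b : measurableTypeR R).
have mh : measurable_fun setT h.
  by apply: measurable_funD => //; apply: measurable_funM.
pose nu : {measure set (measurableTypeR R) -> \bar R} := mscale (NngNum (normr_ge0 r))
  (measure_function_pushforward__canonical__measure_function_Measure lebesgue_measure mh).
have E : forall X, ocitv X -> lebesgue_measure X = nu X.
  move=> X /ocitvP[->|[[u v] /= uv ->]]; first by rewrite !measure0.
  rewrite /nu /mscale /= /pushforward.
  have [rp|rn|/eqP] := ltgtP r 0; last by rewrite (negbTE r0).
  - rewrite (_ : _ @^-1` _ = `[(v - b) / r, (u - b) / r[%classic); last first.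
      apply/seteqP; split => a /=; rewrite !in_itv /= /h.
        by rewrite ler_ndivrMr// ltr_ndivlMr// (mulrC a) ltrBlDr lerBrDr andbC.
      by rewrite ler_ndivrMr// ltr_ndivlMr// (mulrC a) ltrBlDr lerBrDr andbC.
    rewrite !lebesgue_measure_itv/= !lte_fin uv ltr_nM2r ?invr_lt0// ltrD2r uv.
    rewrite -!EFinB -EFinM ltr0_norm//; congr EFin.
    by rewrite -mulrBl mulNr mulrC divfK//; ring.
  - rewrite (_ : _ @^-1` _ = `](u - b) / r, (v - b) / r]%classic); last first.
      apply/seteqP; split => a /=; rewrite !in_itv /= /h.
        by rewrite ltr_pdivrMr// ler_pdivlMr// (mulrC a) ltrBlDr lerBrDr.
      by rewrite ltr_pdivrMr// ler_pdivlMr// (mulrC a) ltrBlDr lerBrDr.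
    rewrite !lebesgue_measure_itv/= !lte_fin uv ltr_pM2r ?invr_gt0// ltrD2r uv.
    rewrite -!EFinB -EFinM gtr0_norm//; congr EFin.
    by rewrite -mulrBl mulrC divfK//; ring.
exact: (lebesgue_measure_unique E).
Qed.

(** A change of variables needs to be proved for nonnegative functions only:
    the positive and the negative part carry it over to integrable functions.
    *)
Lemma Rintegral_transfer dd (T : measurableType dd) (m : {measure set T -> \bar R})
  (h : T -> T) (c : R) : measurable_fun setT h ->
  (forall f : T -> \bar R, measurable_fun setT f -> (forall x, 0 <= f x)%E ->
     \int[m]_x f (h x) = c%:E * \int[m]_x f x)%E ->
  forall f : T -> R, m.-integrable setT (EFin \o f) ->
  m.-integrable setT (EFin \o (f \o h)) /\
  \int[m]_x f (h x) = c * \int[m]_x f x.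
Proof.
move=> mh H f fi; have mf := measurable_int _ fi; split.
  apply/integrableP; split; first exact: (measurableT_comp mf mh).
  have /integrableP[_ fi'] := fi.
  rewrite (H (fun x => `|(f x)%:E|%E))//; last exact: measurableT_comp.
  have g0 : (0 <= \int[m]_x `|(f x)%:E|)%E by exact: integral_ge0.
  move: fi' g0 => /=; set I := (\int[m]_x _)%E.
  by case: I => // u _ _; rewrite -EFinM ltry.
rewrite /Rintegral integralE [in RHS]integralE.
have -> : (\int[m]_x (fun x => (f (h x))%:E)^\+ x = c%:E * \int[m]_x (EFin \o f)^\+ x)%E.
  rewrite -(H _ (measurable_funepos mf) (funepos_ge0 _)).
  by apply: eq_integral => x _; rewrite !funeposE.
have -> : (\int[m]_x (fun x => (f (h x))%:E)^\- x = c%:E * \int[m]_x (EFin \o f)^\- x)%E.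
  rewrite -(H _ (measurable_funeneg mf) (funeneg_ge0 _)).
  by apply: eq_integral => x _; rewrite !funenegE.
have pf : (\int[m]_x (EFin \o f)^\+ x \is a fin_num)%E.
  by apply: integrable_fin_num => //; exact: integrable_funepos.
have nf : (\int[m]_x (EFin \o f)^\- x \is a fin_num)%E.
  by apply: integrable_fin_num => //; exact: integrable_funeneg.
have E (u v : \bar R) : u \is a fin_num -> v \is a fin_num ->
  fine (c%:E * u - c%:E * v)%E = c * fine (u - v)%E.
  by move: u v => [u||] [v||]//= _ _; rewrite mulrBr.
exact: E.
Qed.

Lemma ge0_integral_affine (r b : R) (f : measurableTypeR R -> \bar R) :
  r != 0 -> measurable_fun setT f -> (forall x, 0 <= f x)%E ->
  (\int[lebesgue_measure]_a f (r * a + b : measurableTypeR R)%R = (`|r|^-1)%:E * \int[lebesgue_measure]_a f a)%E.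
Proof.
move=> r0 mf f0.
set h := (fun a : measurableTypeR R => r * a + b : measurableTypeR R).
have mh : measurable_fun setT h.
  by apply: measurable_funD => //; apply: measurable_funM.
pose nu : {measure set (measurableTypeR R) -> \bar R} := mscale (NngNum (normr_ge0 r))
  (measure_function_pushforward__canonical__measure_function_Measure lebesgue_measure mh).
have -> : (\int[lebesgue_measure]_a f a = \int[nu]_a f a)%E.
  by apply: eq_measure_integral => A mA _; exact: (@lebesgue_affine r b A r0 mA).
rewrite ge0_integral_mscale//= ge0_integral_pushforward//= muleA -EFinM.
by rewrite mulVf ?normr_eq0// mul1e.
Qed.

Lemma measurable_affine_rV n (r : R) (b : 'rV[R]_n) :
  measurable_fun setT (fun x : 'rV[R]_n => r *: x + b).
Proof.
apply: measurable_fun_rV => i.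
rewrite (_ : _ \o _ = fun x : 'rV[R]_n => r * x ord0 i + b ord0 i : measurableTypeR R).
  by apply: measurable_funD => //; apply: measurable_funM => //; exact: measurable_entry.
by apply/funext => x /=; rewrite !mxE.
Qed.

(** Induction on n: the affine map acts on the first coordinate and on the
    remaining ones separately. *)
Lemma ge0_integral_affine_rV n (r : R) (b : 'rV[R]_n) (f : 'rV[R]_n -> \bar R) :
  r != 0 -> measurable_fun setT f -> (forall x, 0 <= f x)%E ->
  (\int[@lebesgue_rV R n]_x f (r *: x + b)%R =
   (`|r| ^- n)%:E * \int[@lebesgue_rV R n]_x f x)%E.
Proof.
move=> r0; elim: n => [|n IH] in b f *; move=> mf f0.
  rewrite expr0 invr1 mul1e; apply: eq_integral => x _; congr f.
  by apply/rowP => -[].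
have maff := measurable_affine_rV r b.
rewrite !ge0_integral_rVS//; last exact: measurableT_comp.
have mc a : measurable_fun setT (fun v => cons_rV (a : measurableTypeR R, v : 'rV[R]_n)).
  by apply: measurableT_comp (@measurable_cons_rV R n) _; exact: measurable_fun_pair.
pose G (a : measurableTypeR R) := (\int[@lebesgue_rV R n]_v f (cons_rV (a, v)))%E.
have mG : measurable_fun setT G.
  apply: (@measurable_fun_fubini_tonelli_F _ _ _ _ _ _ (f \o @cons_rV R n)) => //.
  - by apply: measurableT_comp => //; exact: measurable_cons_rV.
  - by move=> u; exact: f0.
have G0 a : (0 <= G a)%E by exact: integral_ge0.
transitivity (\int[lebesgue_measure]_a ((`|r| ^- n)%:E * G (r * a + b ord0 ord0)%R))%E.
  apply: eq_integral => a _.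
  rewrite -(IH (rsubmx (b : 'rV[R]_(1 + n)))
     (fun v => f (cons_rV ((r * a + b ord0 ord0 : measurableTypeR R)%R, v))))//; last exact: measurableT_comp.
  apply: eq_integral => v _; congr f; apply/rowP => i.
  rewrite [LHS]mxE [X in X + _]mxE; case: (unliftP ord0 i) => [j|] ->.
    rewrite !cons_rVS/= !mxE; congr (_ + b _ _).
    exact: val_inj.
  by rewrite !cons_rV0.
have mG' : measurable_fun setT (fun a : measurableTypeR R => G (r * a + b ord0 ord0)%R).
  apply: (measurableT_comp mG).
  by apply: measurable_funD => //; apply: measurable_funM.
have r0' : (0 <= (`|r| ^- n)%:E)%E by rewrite lee_fin invr_ge0 exprn_ge0.
rewrite (ge0_integralZl _ measurableT mG' (fun x _ => G0 _) r0').
rewrite (ge0_integral_affine (b ord0 ord0) r0 mG G0).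
by rewrite muleA -EFinM exprS invfM mulrC.
Qed.

Lemma integrable_affine_rV n (r : R) (b : 'rV[R]_n) (f : 'rV[R]_n -> R) :
  r != 0 -> (@lebesgue_rV R n).-integrable setT (EFin \o f) ->
  (@lebesgue_rV R n).-integrable setT (EFin \o (fun x => f (r *: x + b))).
Proof.
move=> r0 fi; apply: (Rintegral_transfer (measurable_affine_rV r b) _ fi).1.
by move=> g; exact: ge0_integral_affine_rV.
Qed.

Lemma Rintegral_affine_rV n (r : R) (b : 'rV[R]_n) (f : 'rV[R]_n -> R) :
  r != 0 -> (@lebesgue_rV R n).-integrable setT (EFin \o f) ->
  \int[@lebesgue_rV R n]_x f (r *: x + b) =
  `|r| ^- n * \int[@lebesgue_rV R n]_x f x.
Proof.
move=> r0 fi; apply: (Rintegral_transfer (measurable_affine_rV r b) _ fi).2.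
by move=> g; exact: ge0_integral_affine_rV.
Qed.

Lemma Rintegral_opp (f : measurableTypeR R -> R) :
  lebesgue_measure.-integrable setT (EFin \o f) ->
  \int[lebesgue_measure]_x f (- x) = \int[lebesgue_measure]_x f x.
Proof.
move=> fi; rewrite -[RHS]mul1r.
apply: (Rintegral_transfer (h := fun x : measurableTypeR R => - x : measurableTypeR R) _ _ fi).2.
  exact: oppr_measurable.
move=> g mg g0; have n1 : (-1 : R) != 0 by rewrite oppr_eq0.
have := @ge0_integral_affine (-1) 0 g n1 mg g0.
rewrite normrN1 invr1 => <-; apply: eq_integral => x _.
by rewrite mulN1r addr0.
Qed.

Lemma ge0_integral_prod_rV n (f : 'I_n -> R -> R) :
  (forall i, measurable_fun [set: measurableTypeR R] (f i)) -> (forall i x, 0 <= f i x) ->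
  (\int[@lebesgue_rV R n]_x (\prod_i f i (x ord0 i))%:E =
   \prod_i \int[lebesgue_measure]_a (f i a)%:E)%E.
Proof.
elim: n f => [|n IH] f mf f0.
  rewrite big_ord0 /=.
  under eq_integral do rewrite big_ord0.
  by rewrite integral_cst//= diracT mul1e.
have mprod m (g : 'I_m -> R -> R) : (forall i, measurable_fun [set: measurableTypeR R] (g i)) ->
   measurable_fun [set: 'rV[R]_m] (fun x : 'rV[R]_m => (\prod_i g i (x ord0 i))%:E).
  move=> mg; apply/measurable_EFinP; apply: measurable_prod => i _.
  by apply: (measurableT_comp (mg i)); exact: measurable_entry.
rewrite ge0_integral_rVS//; [|exact: mprod|by move=> x; rewrite lee_fin prodr_ge0].
transitivity (\int[lebesgue_measure]_a ((f ord0 a)%:E *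
    \prod_i \int[lebesgue_measure]_b (f (lift ord0 i) b)%:E))%E.
  apply: eq_integral => a _; rewrite -IH//.
  rewrite -ge0_integralZl//; last 3 first.
  - exact: (mprod _ (fun i => f (lift ord0 i))).
  - by move=> x _; rewrite lee_fin prodr_ge0.
  - by rewrite lee_fin.
  apply: eq_integral => v _; rewrite big_ord_recl cons_rV0 -EFinM/=; congr (_ * _)%:E.
  by apply: eq_bigr => i _; rewrite cons_rVS.
rewrite ge0_integralZr//; last 3 first.
  exact/measurable_EFinP.
  by move=> x _; rewrite lee_fin.
  by apply: prode_ge0 => i _; apply: integral_ge0 => x _; rewrite lee_fin.
by rewrite big_ord_recl.
Qed.

(** An open set is the union of the boxes with rational centre and
    inverse-integer radius that it contains, and there are countably many of
    them. *)
Lemma open_measurable_rV n (U : set 'rV[R]_n) : open U -> measurable U.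
Proof.
move=> oU.
pose B (c : 'rV[rat]_n * nat) : set 'rV[R]_n :=
  [set v | forall i, `](ratr (c.1 ord0 i) - c.2.+1%:R^-1), (ratr (c.1 ord0 i) + c.2.+1%:R^-1)[%classic (v ord0 i)].
have mB c : measurable (B c).
  by apply: (@measurable_box R n (fun i => `](ratr (c.1 ord0 i) - c.2.+1%:R^-1), (ratr (c.1 ord0 i) + c.2.+1%:R^-1)[%classic)) => i; exact: measurable_itv.
have -> : U = \bigcup_(c in [set c | B c `<=` U]) B c.
  apply/seteqP; split => [x Ux|x [c cU Bx]]; last exact: cU.
  have /nbhs_ballP[e /= e0 eU] := open_nbhs_nbhs (conj oU Ux).
  have [k ke] : exists k : nat, k.+1%:R^-1 < e / 2.
    have [k _ /(_ k (leqnn k))] := near_infty_natSinv_lt (PosNum (divr_gt0 e0 (ltr0Sn R 1))).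
    by exists k.
  have k0 : 0 < k.+1%:R^-1 :> R by rewrite invr_gt0.
  have [c cP] : exists c : 'rV[rat]_n, forall i, ratr (c ord0 i) \in `](x ord0 i - k.+1%:R^-1), (x ord0 i + k.+1%:R^-1)[.
    have /choice[g gP] : forall i, exists q : rat, ratr q \in `](x ord0 i - k.+1%:R^-1), (x ord0 i + k.+1%:R^-1)[.
      by move=> i; apply: rat_in_itvoo; rewrite ltrD2l gtrN.
    by exists (\row_i g i) => i; rewrite mxE.
  exists (c, k).
    move=> y By; apply: eU; rewrite -ball_normE /ball_ /= [ltLHS](_ : _ = mx_norm (x - y))// mx_normrE.
    apply/bigmax_ltP; split=> // -[i j] _ /=; rewrite !mxE (_ : i = ord0); last by rewrite ord1.
    have := By j; have := cP j; rewrite /= !in_itv /= => /andP[a1 a2] /andP[b1 b2].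
    move: (x ord0 j) (y ord0 j) (ratr _) (k.+1%:R^-1) ke a1 a2 b1 b2 => X Y Q t *.
    by rewrite ltr_norml; apply/andP; split; lra.
  move=> i; have := cP i; rewrite /= !in_itv /= => /andP[].
  by rewrite ltrBlDr ltrBlDr => ? ?; apply/andP.
rewrite bigcup_mkcond; apply: countable_bigcupT_measurable => // c.
by case: ifP.
Qed.

Lemma continuous_measurable_rV n (f : 'rV[R]_n -> R) :
  continuous f -> measurable_fun [set: 'rV[R]_n] (f : 'rV[R]_n -> measurableTypeR R).
Proof.
move=> cf; apply: (measurability _ (RGenOpens.measurableE R)).
move=> _ [_ [a [b ->] <-]].
rewrite setTI; apply: open_measurable_rV; move/continuousP: cf; apply.
exact: interval_open.
Qed.

Lemma measurable_dotp d (T : measurableType d) n (f g : T -> 'rV[R]_n) :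
  measurable_fun setT f -> measurable_fun setT g ->
  measurable_fun setT (fun x => dotp (f x) (g x) : measurableTypeR R).
Proof.
move=> mf mg; apply: measurable_sum => i; apply: measurable_funM.
  exact: (measurableT_comp (measurable_entry i)).
exact: (measurableT_comp (measurable_entry i)).
Qed.

Lemma measurable_cosR d (T : measurableType d) (f : T -> R) : measurable_fun setT f ->
  measurable_fun setT (fun x => cos (f x)).
Proof.
move=> mf; apply: (measurableT_comp (f := @cos R)) => //.
by apply: continuous_measurable_fun; exact: (@continuous_cos R).
Qed.

Lemma integrable_mulb d (T : measurableType d) (m : {measure set T -> \bar R})
    (f g : T -> R) (C : R) : m.-integrable setT (EFin \o f) ->
  measurable_fun setT g -> (forall x, `|g x| <= C) ->
  m.-integrable setT (EFin \o (fun x => f x * g x)).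
Proof.
move=> fi mg gC; have mf : measurable_fun setT f by exact/measurable_EFinP/(measurable_int _ fi).
apply: (@le_integrable _ _ _ _ _ measurableT _ (fun a : T => C%:E * (EFin \o f) a)%E).
- by apply/measurable_EFinP; exact: measurable_funM.
- move=> a _ /=; rewrite lee_fin !normrM mulrC ler_wpM2r//.
  by apply: (le_trans (gC a)); exact: ler_norm.
- exact: (integrableZl measurableT C fi).
Qed.

End lebesgue_rV_theory.

(** * Calculus of iterated partial derivatives *)

Section iterated_partials.
Context {R : realType} {d : nat}.
Implicit Types (f g : 'rV[R]_d -> R) (s : seq 'I_d) (i : 'I_d).

Definition pd i f : 'rV[R]_d -> R := fun x => 'D_(delta_mx ord0 i) f x.

(** [partials] applies the last index of the list first; inductions on lists
    of indices therefore go through [rcons]. *)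
Lemma partials_rcons s i f : partials (rcons s i) f = partials s (pd i f).
Proof. by rewrite /partials foldr_rcons. Qed.

Definition rsmooth f := forall s (x : 'rV[R]_d), differentiable (partials s f) x.

Lemma rsmooth_diff f x : rsmooth f -> differentiable f x.
Proof. by move=> /(_ [::]). Qed.

Lemma rsmooth_cont f : rsmooth f -> continuous f.
Proof. by move=> sf x; exact/differentiable_continuous/rsmooth_diff. Qed.

Lemma rsmooth_pd i f : rsmooth f -> rsmooth (pd i f).
Proof. by move=> sf s x; rewrite -partials_rcons; exact: sf. Qed.

(** A class of differentiable functions that is closed under partial
    derivatives consists of smooth functions. All smoothness proofs below
    exhibit such a class. *)
Lemma rsmooth_ind (P : ('rV[R]_d -> R) -> Prop) :
  (forall f, P f -> forall x, differentiable f x) ->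
  (forall f i, P f -> P (pd i f)) -> forall f, P f -> rsmooth f.
Proof.
move=> Pd Pi f Pf s; elim/last_ind: s => [|s i IH] in f Pf *.
  by move=> x; exact: Pd.
by move=> x; rewrite partials_rcons; apply: IH; exact: Pi.
Qed.

Lemma pdE i f x : differentiable f x -> pd i f x = 'd f x (delta_mx ord0 i).
Proof. by move=> ?; rewrite /pd deriveE. Qed.

Lemma pd_cst i (c : R) : pd i (cst c) = cst 0.
Proof. by apply/funext => x; rewrite /pd derive_cst. Qed.

Lemma pdD i f g : (forall x, differentiable f x) -> (forall x, differentiable g x) ->
  pd i (f \+ g) = pd i f \+ pd i g.
Proof.
move=> df dg; apply/funext => x; rewrite pdE; last exact: differentiableD.
by rewrite [X in X _ = _](diffD (df x) (dg x)) /= !pdE.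
Qed.

Lemma pdM i f g : (forall x, differentiable f x) -> (forall x, differentiable g x) ->
  pd i (f \* g) = (pd i f \* g) \+ (f \* pd i g).
Proof.
move=> df dg; apply/funext => x; rewrite pdE; last exact: differentiableM.
rewrite -pdE /pd; last exact: differentiableM.
rewrite [LHS](deriveM (@diff_derivable _ _ _ f x _ (df x)) (@diff_derivable _ _ _ g x _ (dg x))) /=.
by rewrite addrC; congr (_ + _); rewrite [LHS]mulrC.
Qed.

Lemma pdV i f : (forall x, differentiable f x) -> (forall x, f x != 0) ->
  pd i (fun x => (f x)^-1) =
  (cst (-1) \* pd i f) \* ((fun x => (f x)^-1) \* (fun x => (f x)^-1)).
Proof.
move=> df f0; apply/funext => x; rewrite pdE; last exact: differentiableV.
rewrite [X in X _ = _](diffV (df x) (f0 x)) /= !pdE//=.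
by rewrite /GRing.scale/= expr2 invfM; ring.
Qed.

Lemma pd_comp i (h h' : R -> R) f : (forall t, is_derive t (1 : R) h (h' t)) ->
  (forall x, differentiable f x) ->
  pd i (h \o f) = (h' \o f) \* pd i f.
Proof.
move=> dh df; have dh' t : differentiable h t.
  by apply/derivable1_diffP; apply: ex_derive; exact: dh.
apply/funext => x; rewrite pdE; last exact: differentiable_comp.
rewrite diff_comp//= pdE//.
rewrite (diff1E (dh' _)) derive1E (derive_val (is_derive := dh _)).
by rewrite /GRing.scale/= mulrC.
Qed.

(** The partial derivatives of a sum, product, inverse or composition are
    again built by these operations, so this class is closed under [pd]. In
    the last constructor the outer functions h n form a family in which every
    member has the next one as its derivative. *)
Inductive smooth_closure : ('rV[R]_d -> R) -> Prop :=
| sc_base f : rsmooth f -> smooth_closure f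
| sc_cst c : smooth_closure (cst c)
| sc_add f g : smooth_closure f -> smooth_closure g -> smooth_closure (f \+ g)
| sc_mul f g : smooth_closure f -> smooth_closure g -> smooth_closure (f \* g)
| sc_inv f : smooth_closure f -> (forall x, f x != 0) -> smooth_closure (fun x => (f x)^-1)
| sc_comp (h : nat -> R -> R) n f : (forall n (t : R), is_derive t (1 : R) (h n) (h n.+1 t)) ->
    smooth_closure f -> smooth_closure (h n \o f).

Lemma smooth_closure_diff f : smooth_closure f -> forall x, differentiable f x.
Proof.
elim=> {f} [f sf x|c x|f g _ df _ dg x|f g _ df _ dg x|f _ df f0 x|h n f dh _ df x].
- exact: rsmooth_diff.
- exact: differentiable_cst.
- exact: differentiableD.
- exact: differentiableM.
- exact: differentiableV.
- apply: differentiable_comp => //; apply/derivable1_diffP; apply: ex_derive; exact: dh.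
Qed.

Lemma smooth_closure_smooth f : smooth_closure f -> rsmooth f.
Proof.
apply: rsmooth_ind f => [|f i]; first exact: smooth_closure_diff.
elim=> {f} [f sf|c|f g sf IHf sg IHg|f g sf IHf sg IHg|f sf IHf f0|h n f dh sf IHf].
- by apply: sc_base; exact: rsmooth_pd.
- by rewrite pd_cst; exact: sc_cst.
- by rewrite pdD; [exact: sc_add|exact: smooth_closure_diff..].
- rewrite pdM; [|exact: smooth_closure_diff..].
  by apply: sc_add; apply: sc_mul.
- rewrite pdV//; last exact: smooth_closure_diff.
  by repeat apply: sc_mul => //; [exact: sc_cst|exact: sc_inv|exact: sc_inv].
- rewrite (pd_comp _ (dh n)); last exact: smooth_closure_diff.
  by apply: sc_mul => //; exact: sc_comp.
Qed.

Lemma rsmooth_cst (c : R) : rsmooth (cst c).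
Proof. exact/smooth_closure_smooth/sc_cst. Qed.

Lemma rsmoothD f g : rsmooth f -> rsmooth g -> rsmooth (f \+ g).
Proof. by move=> *; apply/smooth_closure_smooth/sc_add; exact: sc_base. Qed.

Lemma rsmoothM f g : rsmooth f -> rsmooth g -> rsmooth (f \* g).
Proof. by move=> *; apply/smooth_closure_smooth/sc_mul; exact: sc_base. Qed.

Lemma rsmoothV f : rsmooth f -> (forall x, f x != 0) -> rsmooth (fun x => (f x)^-1).
Proof. by move=> *; apply/smooth_closure_smooth/sc_inv => //; exact: sc_base. Qed.

Lemma rsmooth_comp (h : nat -> R -> R) n f :
  (forall n (t : R), is_derive t (1 : R) (h n) (h n.+1 t)) -> rsmooth f -> rsmooth (h n \o f).
Proof. by move=> *; apply/smooth_closure_smooth/sc_comp => //; exact: sc_base. Qed.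

Lemma rsmooth_sum (I : Type) (r : seq I) (P : pred I) (F : I -> 'rV[R]_d -> R) :
  (forall j, rsmooth (F j)) -> rsmooth (fun x => \sum_(i <- r | P i) F i x).
Proof.
move=> sF; elim: r => [|i r IH].
  by rewrite (_ : (fun x => _) = cst 0)//; [exact: rsmooth_cst|apply/funext => x; rewrite big_nil].
rewrite (_ : (fun x => _) = if P i then F i \+ (fun x => \sum_(i <- r | P i) F i x) else
  (fun x => \sum_(i <- r | P i) F i x)); first by case: ifP => // _; exact: rsmoothD.
by apply/funext => x; rewrite big_cons; case: ifP.
Qed.

Lemma partialsD s f g : rsmooth f -> rsmooth g ->
  partials s (f \+ g) = partials s f \+ partials s g.
Proof.
elim/last_ind: s f g => // s i IH f g sf sg.
rewrite !partials_rcons pdD; try by move=> x; exact: rsmooth_diff.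
by rewrite IH//; exact: rsmooth_pd.
Qed.

Lemma partials_cst s (c : R) : partials s (cst c) = cst (c *+ nilp s).
Proof.
elim/last_ind: s c => [|s i IH] c; first by rewrite mulr1n.
by rewrite partials_rcons pd_cst IH mul0rn /nilp size_rcons.
Qed.

Lemma partialsZ s (c : R) f : rsmooth f ->
  partials s (fun x => c * f x) = (fun x => c * partials s f x).
Proof.
elim/last_ind: s f => // s i IH f sf.
rewrite !partials_rcons [pd _ _](_ : _ = (fun x => c * pd i f x)); first exact/IH/rsmooth_pd.
rewrite (_ : (fun x => _) = cst c \* f)// pdM.
- by apply/funext => x /=; rewrite pd_cst mul0r add0r.
- by move=> x; exact: differentiable_cst.
- by move=> x; exact: rsmooth_diff.
Qed.

Lemma pd_coord i j : pd i (fun x : 'rV[R]_d => x ord0 j) = cst (i == j)%:R.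
Proof.
apply/funext => x; rewrite pdE; last exact: differentiable_coord.
have @f : {linear 'rV[R]_d -> R}.
  by exists (fun N : 'rV[R]_d => N ord0 j); do 2![eexists]; do ?[constructor];
    rewrite ?mxE// => ? *; rewrite ?mxE//; move=> ?; rewrite !mxE.
rewrite (_ : (fun _ => _) = f) // diff_lin; last exact: coord_continuous.
by rewrite /f /= mxE eqxx/= eq_sym.
Qed.

Lemma rsmooth_coord i : rsmooth (fun x : 'rV[R]_d => x ord0 i).
Proof.
apply: (rsmooth_ind (P := fun f => (exists c, f = cst c) \/ exists i, f = fun x : 'rV[R]_d => x ord0 i)); last by right; exists i.
- by move=> f [[c ->] x|[j ->] x]; [exact: differentiable_cst|exact: differentiable_coord].
- move=> f j [[c ->]|[k ->]]; left; first by exists 0; rewrite pd_cst.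
  by rewrite pd_coord; eexists.
Qed.

Lemma pd_affine i (c : R) b f : (forall x, differentiable f x) ->
  pd i (fun x => f (c *: x + b)) = (fun x => c * pd i f (c *: x + b)).
Proof.
move=> df; apply/funext => x.
have dh : differentiable (fun x : 'rV[R]_d => c *: x + b) x.
  by apply: differentiableD => //; exact: differentiableZ.
rewrite pdE; last exact: differentiable_comp.
rewrite (_ : (fun x => _) = f \o (fun x => c *: x + b))// diff_comp//=.
rewrite [X in 'd f _ (X _)](_ : _ = (fun v => c *: v)).
  by rewrite linearZ pdE.
rewrite (diff_val (is_diff_def := is_diffD (is_diff_scaler c x) (is_diff_cst b x))).
by apply/funext => v /=; rewrite fctE addr0.
Qed.

Lemma differentiable_affine (c : R) b f x : differentiable f (c *: x + b) ->
  differentiable (fun x => f (c *: x + b)) x.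
Proof.
move=> df; apply: (@differentiable_comp _ _ _ _ (fun x : 'rV[R]_d => c *: x + b)) => //.
Qed.

Lemma rsmoothZ (c : R) f : rsmooth f -> rsmooth (fun x => c * f x).
Proof. by move=> sf; apply: (rsmoothM (rsmooth_cst c) sf). Qed.

Lemma rsmooth_affine (c : R) b f : rsmooth f -> rsmooth (fun x => f (c *: x + b)).
Proof.
move=> sf; apply: (rsmooth_ind (P := fun g => exists a f, rsmooth f /\ g = fun x => a * f (c *: x + b))).
- move=> _ [a [g [sg ->]]] x; apply: differentiableM => //.
  exact/differentiable_affine/rsmooth_diff.
- move=> _ i [a [g [sg ->]]]; exists (a * c), (pd i g); split; first exact: rsmooth_pd.
  rewrite (_ : (fun x => _) = cst a \* (fun x => g (c *: x + b)))// pdM.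
  + rewrite pd_cst pd_affine; last by move=> x; exact: rsmooth_diff.
    by apply/funext => x /=; rewrite mul0r add0r mulrA.
  + by move=> x; exact: differentiable_cst.
  + by move=> x; exact/differentiable_affine/rsmooth_diff.
- by exists 1, f; split => //; apply/funext => x; rewrite mul1r.
Qed.

Lemma partials_affine s (c : R) b f : rsmooth f ->
  partials s (fun x => f (c *: x + b)) = (fun x => c ^+ size s * partials s f (c *: x + b)).
Proof.
elim/last_ind: s f => [|s i IH] f sf; first by apply/funext => x; rewrite mul1r.
rewrite !partials_rcons pd_affine; last by move=> x; exact: rsmooth_diff.
rewrite partialsZ; last exact/rsmooth_affine/rsmooth_pd.
by apply/funext => x; rewrite IH ?size_rcons ?exprS ?mulrA//; exact: rsmooth_pd.
Qed.

Lemma rsmooth_dotp (a : 'rV[R]_d) : rsmooth (fun x : 'rV[R]_d => dotp x a).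
Proof.
apply: rsmooth_sum => i.
by rewrite (_ : (fun x => _) = fun x : 'rV[R]_d => a ord0 i * x ord0 i);
  [exact/rsmoothZ/rsmooth_coord|apply/funext => x; rewrite mulrC].
Qed.

Lemma rsmooth_dotpp : rsmooth (fun x : 'rV[R]_d => dotp x x).
Proof.
apply: (@rsmooth_sum _ _ _ (fun i x => x ord0 i * x ord0 i)) => i.
exact: (rsmoothM (rsmooth_coord i) (rsmooth_coord i)).
Qed.

(** Since cos(t + pi/2) = - sin t, the shifts by multiples of pi/2 run through
    the successive derivatives of the cosine. *)
Lemma is_derive_cosn n (t : R) :
  is_derive t (1 : R) (fun t => cos (t + n%:R * (pi / 2))) (cos (t + n.+1%:R * (pi / 2))).
Proof.
have -> : cos (t + n.+1%:R * (pi / 2)) = - sin (t + n%:R * (pi / 2)).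
  by rewrite -addn1 natrD mulrDl mul1r addrA cosDpihalf.
rewrite -[X in is_derive _ _ _ X]mulr1.
apply: (is_derive1_comp (f := cos) (g := fun t => t + n%:R * (pi / 2))).
exact: (is_derive_shift t 1 (n%:R * (pi / 2))).
Qed.

Lemma rsmooth_cos n f : rsmooth f -> rsmooth (fun x => cos (f x + n%:R * (pi / 2))).
Proof. exact: (rsmooth_comp (h := fun n t => cos (t + n%:R * (pi / 2))) n is_derive_cosn). Qed.

End iterated_partials.

(** * A smooth bump function *)

Section flat_function.
Context {R : realType}.

(** With p = 1 this is exp(-1/t) extended by 0 to t <= 0. Polynomials in 1/t
    are allowed as factors because the family is then closed under derivation.
    *)
Definition flatf (p : {poly R}) (t : R) : R :=
  if 0 < t then p.[t^-1] * expR (- t^-1) else 0.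

(** By the chain rule: (p(1/t) exp(-1/t))' = (p(1/t) - p'(1/t)) t^-2
    exp(-1/t). *)
Definition flat_der (p : {poly R}) : {poly R} := ('X^2 * (p - p^`()))%R.

(** With x = 1/t this says x^(n+2) / (n+2)! <= exp x, a term of the
    exponential series. *)
Lemma expRN_le (n : nat) (t : R) : 0 < t -> t^-1 ^+ n * expR (- t^-1) <= n.+2`!%:R * t ^+ 2.
Proof.
move=> t0; have tV0 : 0 < t^-1 by rewrite invr_gt0.
have -> : t ^+ 2 = (t^-1 ^+ 2)^-1 by rewrite exprVn invrK.
move: tV0; move: t^-1 => x x0; rewrite expRN.
rewrite ler_pdivrMr ?expR_gt0// mulrAC ler_pdivlMr ?exprn_gt0// -exprD addn2.
rewrite mulrC -ler_pdivrMr ?ltr0n ?fact_gt0//.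
by apply: le_trans (expR_ge1Dxn n.+1 (ltW x0)); rewrite lerDr.
Qed.

(** The quadratic bound at 0 is what makes all these functions differentiable
    there, with derivative 0. *)
Lemma flatf_bound p : exists2 C, 0 <= C & forall t, `|flatf p t| <= C * t ^+ 2.
Proof.
exists (\sum_(i < size p) `|p`_i| * i.+2`!%:R).
  by apply: sumr_ge0 => i _; rewrite mulr_ge0.
move=> t; rewrite /flatf; case: ifPn => [t0|_]; last first.
  rewrite normr0 mulr_ge0 ?sqr_ge0//.
  by apply: sumr_ge0 => i _; rewrite mulr_ge0.
rewrite horner_coef mulr_suml mulr_suml; apply: le_trans (ler_norm_sum _ _ _) _.
apply: ler_sum => i _; rewrite -mulrA normrM -mulrA ler_wpM2l//.
rewrite ger0_norm; first exact: expRN_le.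
by rewrite mulr_ge0 ?expR_ge0// exprn_ge0// invr_ge0 ltW.
Qed.

Lemma is_derive_flat (f : R -> R) (C t : R) : (forall h, `|f (t + h) - f t| <= C * h ^+ 2) ->
  is_derive t (1 : R) f 0.
Proof.
move=> fC.
have : h^-1 *: ((f \o shift t) (h *: 1) - f t) @[h --> 0^'] --> (0 : R).
  apply/cvgr0Pnorm_le => e e0.
  have C1 : 0 < `|C| + 1 by rewrite ltr_wpDl.
  near=> h.
  have h0 : h != 0 by near: h; exact: nbhs_dnbhs_neq.
  have hC : `|h| <= e / (`|C| + 1).
    by near: h; apply: dnbhs0_le; rewrite divr_gt0.
  have hh : 0 < `|h| by rewrite normr_gt0.
  rewrite /= normrZ [h *: 1]mulr1 (addrC h) normfV mulrC ler_pdivrMr//.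
  apply: le_trans (fC h) _; apply: (@le_trans _ _ ((`|C| + 1) * `|h| ^+ 2)).
    rewrite real_normK ?num_real// ler_wpM2r ?sqr_ge0//.
    by rewrite (le_trans (ler_norm C))// lerDl.
  by rewrite expr2 mulrA ler_wpM2r// mulrC -ler_pdivlMr.
move=> H; apply: DeriveDef; first by apply/cvg_ex; exists 0.
exact: cvg_lim H.
Unshelve. all: by end_near.
Qed.

Lemma is_derive_flatf p (t : R) : is_derive t (1 : R) (flatf p) (flatf (flat_der p) t).
Proof.
have [t0|t0|<-] := ltgtP 0 t.
- rewrite {2}/flatf t0.
  apply: (@near_eq_is_derive R R R (fun t => p.[t^-1] * expR (- t^-1)) _ t 1).
    by near=> s; rewrite /flatf ifT//; near: s; exact: lt_nbhsr.
  have dV : is_derive t (1 : R) (fun t : R => t^-1) (- t ^- 2).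
    rewrite -[X in is_derive _ _ _ X]mulr1.
    by apply: is_deriveV; rewrite gt_eqF.
  have dE : is_derive t (1 : R) (fun t : R => expR (- t^-1)) (expR (- t^-1) * (t ^- 2)).
    apply: (is_derive1_comp (f := expR) (g := fun t => - t^-1)).
    rewrite -[X in is_derive _ _ _ X]opprK; exact: is_deriveN.
  have dp : is_derive t (1 : R) (fun t => p.[t^-1]) (p^`().[t^-1] * - t ^- 2).
    apply: (is_derive1_comp (f := horner p) (g := fun t : R => t^-1)).
  have := is_deriveM dp dE.
  rewrite (_ : _ *: _ + _ = (flat_der p).[t^-1] * expR (- t^-1))//.
  rewrite /flat_der !hornerE /GRing.scale/= exprVn; ring.
- rewrite {2}/flatf ltNge (ltW t0)/=.
  apply: (@near_eq_is_derive R R R (cst 0) _ t 1) => //.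
  by near=> s; rewrite /flatf ifF//; apply/negbTE; rewrite -leNgt ltW//; near: s; exact: lt_nbhsl.
- rewrite {2}/flatf ltxx; have [C C0 fC] := flatf_bound p.
  apply: (@is_derive_flat _ C) => h; rewrite add0r {2}/flatf ltxx subr0; exact: fC.
Unshelve. all: by end_near.
Qed.

End flat_function.

Section bump.
Context {R : realType} {d : nat}.

(** The denominator is positive because 2 - |x|^2 and |x|^2 - 3/2 cannot both
    be nonpositive. The room between 1 and 3/2 lets bump be constant near the
    closed unit ball. *)
Definition bump (x : 'rV[R]_d) : R :=
  flatf 1 (2 - dotp x x) / (flatf 1 (2 - dotp x x) + flatf 1 (dotp x x - 3 / 2)).

Lemma rsmooth_flatf p f : rsmooth f -> rsmooth (fun x : 'rV[R]_d => flatf p (f x)).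
Proof.
move=> sf; apply: (rsmooth_comp (h := fun n => flatf (iter n flat_der p)) 0 _ sf).
by move=> n t; exact: is_derive_flatf.
Qed.

Lemma flatf1_ge0 (t : R) : 0 <= flatf 1 t.
Proof. by rewrite /flatf; case: ifP => // _; rewrite hornerC mul1r expR_ge0. Qed.

Lemma flatf1_gt0 (t : R) : 0 < t -> 0 < flatf 1 t.
Proof. by rewrite /flatf => ->; rewrite hornerC mul1r expR_gt0. Qed.

Lemma flatf_le0 p (t : R) : t <= 0 -> flatf p t = 0.
Proof. by move=> t0; rewrite /flatf ltNge t0. Qed.

Lemma bump_den_gt0 (x : 'rV[R]_d) : 0 < flatf 1 (2 - dotp x x) + flatf 1 (dotp x x - 3 / 2).
Proof.
have [h|h] := ltP (dotp x x) 2.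
  by rewrite ltr_pwDl ?flatf1_ge0// flatf1_gt0// subr_gt0.
by rewrite ltr_wpDl ?flatf1_ge0// flatf1_gt0//; lra.
Qed.

Lemma rsmooth_bump : rsmooth bump.
Proof.
have s1 : rsmooth (fun x : 'rV[R]_d => flatf 1 (2 - dotp x x)).
  apply: rsmooth_flatf; apply: (rsmoothD (rsmooth_cst 2)).
  rewrite (_ : (fun x => _) = fun x : 'rV[R]_d => -1 * dotp x x); first exact/rsmoothZ/rsmooth_dotpp.
  by apply/funext => x; rewrite mulN1r.
have s2 : rsmooth (fun x : 'rV[R]_d => flatf 1 (dotp x x - 3 / 2)).
  by apply: rsmooth_flatf; exact: (rsmoothD rsmooth_dotpp (rsmooth_cst (- (3 / 2)))).
apply: (rsmoothM s1); apply: rsmoothV; first exact: (rsmoothD s1 s2).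
by move=> x; rewrite gt_eqF// bump_den_gt0.
Qed.

Lemma bump1 x : dotp x x <= 3 / 2 -> bump x = 1.
Proof.
move=> h; have := bump_den_gt0 x; rewrite /bump [flatf 1 (dotp x x - 3 / 2)]flatf_le0 ?addr0; last lra.
by move=> /gt_eqF/negbT h0; rewrite divff.
Qed.

Lemma bump0 x : 2 <= dotp x x -> bump x = 0.
Proof. by move=> h; rewrite /bump [flatf 1 (2 - _)]flatf_le0 ?mul0r//; lra. Qed.

Lemma bumpN x : bump (- x) = bump x.
Proof.
have E : dotp (- x) (- x) = dotp x x by apply: eq_bigr => i _; rewrite !mxE mulrNN.
by rewrite /bump E.
Qed.

End bump.

(** * The product weight and Poisson integrals *)

Section weight.
Context {R : realType}.

Lemma integral_oneDsqrV :
  (\int[@lebesgue_measure R]_x ((1 + x ^+ 2)^-1)%:E = (pi : R)%:E)%E.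
Proof.
rewrite (@ge0_symfun_integralT R (fun x => (1 + x ^+ 2)^-1))//.
- rewrite -[pi in RHS](@divfK _ 2)// mulrC EFinM; congr (_ * _)%E.
  rewrite -integral0y_oneDsqr; congr (integral _ _ _).
  by apply/seteqP; split => x /=; rewrite in_itv/= andbT.
- by move=> x; rewrite invr_ge0 addr_ge0// sqr_ge0.
- exact: continuous_oneDsqrV.
- by move=> x /=; rewrite sqrrN.
Qed.

(** A product of one-dimensional weights rather than a power of 1 + |x|^2: its
    integral and the sums over lattice points factor over the coordinates. *)
Definition W d (x : 'rV[R]_d) : R := \prod_i (1 + x ord0 i ^+ 2)^-1.

Lemma oneDsq_gt0 (t : R) : 0 < 1 + t ^+ 2.
Proof. by rewrite ltr_pwDl// sqr_ge0. Qed.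

Lemma W_gt0 d (x : 'rV[R]_d) : 0 < W x.
Proof. by apply: prodr_gt0 => i _; rewrite invr_gt0 oneDsq_gt0. Qed.

Lemma W_ge0 d (x : 'rV[R]_d) : 0 <= W x. Proof. exact/ltW/W_gt0. Qed.

Lemma W_le1 d (x : 'rV[R]_d) : W x <= 1.
Proof.
apply: prodr_ile1 => i; rewrite invr_ge0 ltW ?oneDsq_gt0//=.
by rewrite invf_le1 ?oneDsq_gt0// lerDl sqr_ge0.
Qed.

Lemma measurable_W d : measurable_fun [set: 'rV[R]_d] (@W d).
Proof.
apply: measurable_prod => i _.
apply: (measurableT_comp (f := fun t : measurableTypeR R => (1 + t ^+ 2)^-1 : measurableTypeR R)).
  by apply: continuous_measurable_fun; exact: continuous_oneDsqrV.
exact: measurable_entry.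
Qed.

Lemma integral_W d : (\int[@lebesgue_rV R d]_x (W x)%:E = ((pi : R) ^+ d)%:E)%E.
Proof.
rewrite (@ge0_integral_prod_rV R d (fun _ t => (1 + t ^+ 2)^-1)).
- under eq_bigr do rewrite integral_oneDsqrV.
  rewrite -[X in _ ^+ X](card_ord d) -prodr_const.
  by rewrite (big_morph EFin (fun x y => EFinM x y) erefl).
- by move=> _; apply: continuous_measurable_fun; exact: continuous_oneDsqrV.
- by move=> _ x; rewrite invr_ge0 ltW ?oneDsq_gt0.
Qed.

Lemma integrable_W d : (@lebesgue_rV R d).-integrable setT (EFin \o @W d).
Proof.
apply/integrableP; split; first by apply/measurable_EFinP; exact: measurable_W.
rewrite (eq_integral (fun x => (W x)%:E)) ?integral_W ?ltry// => x _.
by rewrite /= ger0_norm ?W_ge0.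
Qed.

Lemma Rintegral_W d : \int[@lebesgue_rV R d]_x W x = pi ^+ d.
Proof. by rewrite /Rintegral integral_W. Qed.

Lemma integrable_leW d (C : R) (f : 'rV[R]_d -> R) : measurable_fun setT f ->
  (forall x, `|f x| <= C * W x) -> (@lebesgue_rV R d).-integrable setT (EFin \o f).
Proof.
move=> mf fC; apply: (@le_integrable _ _ _ _ _ measurableT _ (fun x => C%:E * (EFin \o @W d) x)%E).
- exact/measurable_EFinP.
- by move=> x _ /=; rewrite lee_fin (le_trans (fC x))// ler_norm.
- exact: (integrableZl measurableT C (@integrable_W d)).
Qed.

(** On a ball the weight is bounded below, so that a bounded function of
    compact support is dominated by a multiple of W. *)
Lemma W_ge_ball d (x : 'rV[R]_d) (rho : R) : dotp x x <= rho -> (1 + rho) ^- d <= W x.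
Proof.
move=> xr; rewrite -[X in _ ^- X](card_ord d) -prodr_const -prodfV.
apply: ler_prod => i _; have hi : x ord0 i ^+ 2 <= rho.
  apply: le_trans xr; rewrite /dotp (bigD1 i)//= -expr2 lerDl.
  by apply: sumr_ge0 => j _; rewrite -expr2 sqr_ge0.
have rho0 : 0 <= rho by apply: le_trans hi; exact: sqr_ge0.
rewrite invr_ge0 addr_ge0//= lef_pV2 ?posrE ?oneDsq_gt0 ?lerD2l//.
by rewrite ltr_pwDl.
Qed.

Lemma integrable_cpt d (C rho : R) (f : 'rV[R]_d -> R) : measurable_fun setT f ->
  (forall x, `|f x| <= C) -> (forall x, rho <= dotp x x -> f x = 0) ->
  (@lebesgue_rV R d).-integrable setT (EFin \o f).
Proof.
move=> mf fC f0; apply: (@integrable_leW _ (C * (1 + `|rho|) ^+ d)) => // x.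
have C0 : 0 <= C by rewrite (le_trans _ (fC x)).
have [h|h] := leP rho (dotp x x).
  by rewrite f0// normr0 mulr_ge0 ?W_ge0// mulr_ge0// exprn_ge0// addr_ge0.
apply: le_trans (fC x) _; rewrite -mulrA ler_peMr//.
rewrite -ler_pdivrMl ?exprn_gt0// ?ltr_pwDl// mulr1; apply: W_ge_ball.
by rewrite (le_trans (ltW h))// ler_norm.
Qed.

End weight.

Section poisson.
Context {R : realType}.
Variables (e : R) (e0 : 0 < e).

Let F (w : R) (a : R) := - (expR (- (e * a)) / e) +
  expR (- (e * a)) * (w * sin (a * w) - e * cos (a * w)) / (e ^+ 2 + w ^+ 2).

Let ew w : 0 < e ^+ 2 + w ^+ 2.
Proof. by rewrite ltr_pwDl ?sqr_ge0 ?exprn_gt0. Qed.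

Let is_derive_F w (a : R) : is_derive a (1:R) (F w) (expR (- (e * a)) * (1 + cos (a * w))).
Proof.
have dm (c : R) : is_derive a (1 : R) (fun a : R => c * a) c.
  by rewrite -[c in X in is_derive _ _ _ X]mulr1; exact: (is_deriveZ c (is_derive_id a 1)).
have dl (c : R) : is_derive a (1 : R) (fun a : R => a * c) c.
  by rewrite (_ : (fun a => _) = (fun a => c * a))//; apply/funext => ?; rewrite mulrC.
have dE : is_derive a (1 : R) (fun a : R => expR (- (e * a))) (expR (- (e * a)) * - e).
  apply: (is_derive1_comp (f := expR) (g := fun a => - (e * a))).
have dS : is_derive a (1 : R) (fun a : R => sin (a * w)) (cos (a * w) * w).
  exact: (@is_derive1_comp R sin (fun a => a * w) a _ _ (is_derive_sin (a * w)) (dl w)).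
have dC : is_derive a (1 : R) (fun a : R => cos (a * w)) (- sin (a * w) * w).
  exact: (@is_derive1_comp R cos (fun a => a * w) a _ _ (is_derive_cos (a * w)) (dl w)).
have dwS := is_deriveB (is_deriveZ w dS) (is_deriveZ e dC).
have dT := is_deriveM dE dwS.
have := is_deriveD (is_deriveZ (- e^-1) dE) (is_deriveZ (e ^+ 2 + w ^+ 2)^-1 dT).
rewrite (_ : _ + _ = F w); last first.
  apply/funext => x; rewrite -[LHS]/(- e^-1 * expR (- (e * x)) +
    (e ^+ 2 + w ^+ 2)^-1 * (expR (- (e * x)) * (w * sin (x * w) - e * cos (x * w)))).
  by rewrite /F; ring.
rewrite [X in is_derive _ _ _ X](_ : _ = expR (- (e * a)) * (1 + cos (a * w)))//.
rewrite -[LHS]/(- e^-1 * (expR (- (e * a)) * - e) +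
    (e ^+ 2 + w ^+ 2)^-1 * (expR (- (e * a)) * (w * (cos (a * w) * w) - e * (- sin (a * w) * w))
    + (w * sin (a * w) - e * cos (a * w)) * (expR (- (e * a)) * - e))).
field.
by rewrite !gt_eqF ?ew.
Qed.

Let continuous_cosM w : continuous (fun a : R => cos (a * w)).
Proof.
move=> a; apply: (@continuous_comp _ _ _ (fun a : R => a * w) (@cos R)); last exact: continuous_cos.
by apply: cvgM; [exact: cvg_id|exact: cvg_cst].
Qed.

Let cvg_F w : F w a @[a --> +oo] --> (0 : R).
Proof.
have cE : expR (- (e * a)) @[a --> +oo] --> (0 : R).
  apply: (cvg_comp _ _ _ (@cvgr_expR R)) => /=.
  exact: gt0_cvgMry.
pose C := e^-1 + (`|w| + e) / (e ^+ 2 + w ^+ 2).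
have bF a : `|F w a| <= C * expR (- (e * a)).
  rewrite /F /C mulrDl (le_trans (ler_normD _ _))// lerD//.
    by rewrite normrN normrM normfV (gtr0_norm e0) ger0_norm ?expR_ge0// mulrC.
  rewrite !normrM (ger0_norm (expR_ge0 _)) -mulrA mulrC ler_wpM2r ?expR_ge0//.
  rewrite normfV (gtr0_norm (ew w)) ler_wpM2r ?invr_ge0 ?(ltW (ew w))//.
  apply: le_trans (ler_normB _ _) _; rewrite !normrM (gtr0_norm e0) lerD//.
    by rewrite ler_piMr// ler_norml sin_geN1 sin_le1.
  by rewrite ler_piMr// ?ler_norml ?cos_geN1 ?cos_le1// ltW.
have cCE : C * expR (- (e * a)) @[a --> +oo] --> (0 : R).
  by rewrite -[X in _ --> X](mulr0 C); apply: cvgM => //; exact: cvg_cst.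
apply/cvgr0Pnorm_le => n n0; near=> a.
apply: le_trans (bF a) _; apply: le_trans (ler_norm _) _.
by near: a; move/cvgr0Pnorm_le : cCE; exact.
Unshelve. all: by end_near. Qed.

(** The one-dimensional Poisson integral. The constant 1 added to the cosine
    makes the integrand nonnegative, so that it can be evaluated on a
    half-line from a primitive without integrability arguments. *)
Lemma integral_poisson0 w :
  (\int[@lebesgue_measure R]_a (expR (- (e * `|a|)) * (1 + cos (a * w)))%:E =
   (2 / e + 2 * e / (e ^+ 2 + w ^+ 2))%:E)%E.
Proof.
rewrite (@ge0_symfun_integralT R (fun a => expR (- (e * `|a|)) * (1 + cos (a * w)))).
- rewrite [X in (_ * X)%E](_ : _ = (e^-1 + e / (e ^+ 2 + w ^+ 2))%:E).
    by rewrite -EFinM; congr EFin; ring.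
  transitivity (\int[lebesgue_measure]_(a in `[0%R, +oo[) (expR (- (e * a)) * (1 + cos (a * w)))%:E)%E.
    rewrite (_ : [set x | _] = `[0%R, +oo[%classic); last first.
      by apply/seteqP; split => x /=; rewrite in_itv/= andbT.
    by apply: eq_integral => a; rewrite inE /= in_itv /= andbT => a0; rewrite ger0_norm.
  have dF a : derivable (F w) a 1 by apply: ex_derive; exact: is_derive_F.
  have cF : continuous (F w).
    by move=> a; apply: differentiable_continuous; exact/derivable1_diffP.
  rewrite (@ge0_continuous_FTC2y R _ (F w) 0 0).
  + rewrite /F mulr0 oppr0 expR0 mul0r sin0 cos0 -EFinB; congr EFin; field.
    by rewrite !gt_eqF ?ew.
  + by move=> x _; rewrite mulr_ge0 ?expR_ge0// -lerBlDl sub0r cos_geN1.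
  + apply: continuous_subspaceT => a.
    apply: cvgM.
      apply: (@continuous_comp _ _ _ (fun a => - (e * a)) expR); last exact: continuous_expR.
      by apply: cvgN; apply: cvgM; [exact: cvg_cst|exact: cvg_id].
    apply: cvgD; first exact: cvg_cst.
    exact: continuous_cosM.
  + exact: cvg_F.
  + by move=> x _.
  + by apply: cvg_at_right_filter; exact: cF.
  + by move=> x _; rewrite derive1E; apply: derive_val; exact: is_derive_F.
- by move=> x; rewrite mulr_ge0 ?expR_ge0// -lerBlDl sub0r cos_geN1.
- move=> a.
  apply: cvgM.
    apply: (@continuous_comp _ _ _ (fun a => - (e * `|a|)) expR); last exact: continuous_expR.
    by apply: cvgN; apply: cvgM; [exact: cvg_cst|exact: norm_continuous].
  apply: cvgD; first exact: cvg_cst.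
  exact: continuous_cosM.
- by move=> x /=; rewrite normrN mulNr cosN.
Qed.

Local Notation leb := (@lebesgue_measure R).

Lemma measurable_expN_abs : measurable_fun [set: measurableTypeR R] (fun a : R => expR (- (e * `|a|))).
Proof.
apply: continuous_measurable_fun => a.
apply: (@continuous_comp _ _ _ (fun a => - (e * `|a|)) expR); last exact: continuous_expR.
by apply: cvgN; apply: cvgM; [exact: cvg_cst|exact: norm_continuous].
Qed.

Lemma integral_expN_abs :
  (\int[leb]_a (expR (- (e * `|a|)))%:E = (2 / e)%:E)%E.
Proof.
have := integral_poisson0 0.
have -> : (\int[leb]_a (expR (- (e * `|a|)) * (1 + cos (a * 0)))%:E =
    \int[leb]_a (2%:E * (expR (- (e * `|a|)))%:E))%E.
  by apply: eq_integral => a _; rewrite mulr0 cos0 -EFinM mulrC.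
rewrite ge0_integralZl//; last first.
  by apply/measurable_EFinP; exact: measurable_expN_abs.
move=> /=; case: (\int[_]_(_ in _) _)%E => [r []||]; last 2 first.
- by rewrite gt0_muley.
- by rewrite gt0_muleNy.
move=> E; congr EFin; apply: (mulfI (x := 2)) => //; rewrite E; field.
by rewrite gt_eqF.
Qed.

Lemma integrable_expN_abs (g : measurableTypeR R -> R) (C : R) : measurable_fun setT g -> (forall a, `|g a| <= C) ->
  leb.-integrable setT (EFin \o (fun a : R => expR (- (e * `|a|)) * g a)).
Proof.
move=> mg gC.
have i0 : leb.-integrable setT (EFin \o (fun a : R => expR (- (e * `|a|)))).
  apply/integrableP; split; first by apply/measurable_EFinP; exact: measurable_expN_abs.
  have -> : (\int[leb]_a `|(EFin \o (fun a : R => expR (- (e * `|a|)))) a| =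
      \int[leb]_a (expR (- (e * `|a|)))%:E)%E.
    by apply: eq_integral => a _; rewrite /= ger0_norm ?expR_ge0.
  by rewrite integral_expN_abs ltry.
exact: (integrable_mulb i0 mg gC).
Qed.

Lemma Rintegral_expN_abs : \int[leb]_a expR (- (e * `|a|)) = 2 / e.
Proof. by rewrite /Rintegral integral_expN_abs. Qed.

(** The Fourier transform of exp(- e |a|), an approximate identity up to the
    factor 2 pi. *)
Definition poissonk (w : R) := 2 * e / (e ^+ 2 + w ^+ 2).

Let mcos w t : measurable_fun [set: measurableTypeR R] (fun a : R => cos (a * w + t)).
Proof.
apply: continuous_measurable_fun => a.
apply: (@continuous_comp _ _ _ (fun a : R => a * w + t) (@cos R)); last exact: continuous_cos.
by apply: cvgD; [apply: cvgM; [exact: cvg_id|exact: cvg_cst]|exact: cvg_cst].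
Qed.

Let cos_norm (t : R) : `|cos t| <= 1.
Proof. by rewrite ler_norml cos_geN1 cos_le1. Qed.

Lemma Rintegral_poisson w (t : R) :
  \int[leb]_a (expR (- (e * `|a|)) * cos (a * w + t)) = cos t * poissonk w.
Proof.
have m0 : measurable_fun [set: measurableTypeR R] (fun a : R => cos (a * w)).
  exact: continuous_measurable_fun.
have ms : measurable_fun [set: measurableTypeR R] (fun a : R => sin (a * w)).
  rewrite (_ : (fun a => _) = fun a => cos (a * w + - (pi / 2)))//.
  by apply/funext => a; rewrite cosBpihalf.
have ic := integrable_expN_abs m0 (fun a => cos_norm _).
have i1 : leb.-integrable setT (EFin \o (fun a : R => expR (- (e * `|a|)) * 1)).
  by apply: (integrable_expN_abs (g := cst 1) (C := 1)) => // a; rewrite normr1.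
have is_ : leb.-integrable setT (EFin \o (fun a : R => expR (- (e * `|a|)) * sin (a * w))).
  by apply: (integrable_expN_abs ms (C := 1)) => a; rewrite ler_norml sin_geN1 sin_le1.
have Ec : \int[leb]_a (expR (- (e * `|a|)) * cos (a * w)) = poissonk w.
  have := congr1 fine (integral_poisson0 w); rewrite /= -/(Rintegral _ _ _).
  under eq_Rintegral do rewrite mulrDr.
  rewrite RintegralD//.
  have -> : \int[leb]_a (expR (- (e * `|a|)) * 1) = \int[leb]_a expR (- (e * `|a|)).
    by apply: eq_Rintegral => a _; rewrite mulr1.
  by rewrite Rintegral_expN_abs => /addrI.
have Es : \int[leb]_a (expR (- (e * `|a|)) * sin (a * w)) = 0.
  have := Rintegral_opp is_.
  under eq_Rintegral do rewrite normrN mulNr sinN mulrN -mulN1r.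
  rewrite RintegralZl// => E; lra.
transitivity (\int[leb]_a (cos t * (expR (- (e * `|a|)) * cos (a * w)) -
    sin t * (expR (- (e * `|a|)) * sin (a * w)))).
  by apply: eq_Rintegral => a _; rewrite cosD; ring.
rewrite RintegralB//; last 2 first.
- exact: (integrableZl measurableT (cos t) ic).
- exact: (integrableZl measurableT (sin t) is_).
by rewrite !RintegralZl// Ec Es mulr0 subr0.
Qed.

Lemma dotp_cons d (u : measurableTypeR R * 'rV[R]_d) (w : 'rV[R]_d.+1) :
  dotp (cons_rV u) w = u.1 * w ord0 ord0 + dotp u.2 (\row_i w ord0 (lift ord0 i)).
Proof.
rewrite /dotp big_ord_recl cons_rV0; congr (_ + _).
by apply: eq_bigr => i _; rewrite cons_rVS mxE.
Qed.

Lemma measurable_dotpl d (w : 'rV[R]_d) :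
  measurable_fun setT (fun x : 'rV[R]_d => dotp x w : measurableTypeR R).
Proof. by apply: (measurable_dotp (g := cst w)). Qed.

(** The factor exp(- e |x|_1), whose Fourier transform is explicit and
    positive in every dimension because it is a product. *)
Definition expN1 d (x : 'rV[R]_d) : R := \prod_i expR (- (e * `|x ord0 i|)).

Lemma measurable_expN1 d : measurable_fun [set: 'rV[R]_d] (@expN1 d).
Proof.
apply: measurable_prod => i _.
apply: (measurableT_comp measurable_expN_abs); exact: measurable_entry.
Qed.

Lemma expN1_ge0 d (x : 'rV[R]_d) : 0 <= expN1 x.
Proof. by apply: prodr_ge0 => i _; exact: expR_ge0. Qed.

(** Again 1 is added to the cosine to stay with nonnegative functions, so that
    the first coordinate can be split off by Tonelli. The phase t is needed by
    the induction, where it absorbs the contribution of the first coordinate.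
    *)
Lemma integral_poisson_rV d (w : 'rV[R]_d) (t : R) :
  (\int[@lebesgue_rV R d]_x (expN1 x * (1 + cos (dotp x w + t)))%:E =
   ((2 / e) ^+ d + cos t * \prod_i poissonk (w ord0 i))%:E)%E.
Proof.
have cp (s : R) : 0 <= 1 + cos s by rewrite -lerBlDl sub0r cos_geN1.
elim: d w t => [|d IH] w t.
  rewrite /= integral_dirac//=; last first.
    apply/measurable_EFinP; apply: measurable_funM; first exact: measurable_expN1.
    apply: measurable_funD => //; apply: measurable_cosR.
    by apply: measurable_funD => //; exact: measurable_dotpl.
  by rewrite diracT mul1e /expN1 /dotp !big_ord0 add0r mulr1 mul1r.
rewrite ge0_integral_rVS; last 2 first.
- apply/measurable_EFinP; apply: measurable_funM; first exact: measurable_expN1.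
  apply: measurable_funD => //; apply: measurable_cosR.
  by apply: measurable_funD => //; exact: measurable_dotpl.
- by move=> x; rewrite lee_fin mulr_ge0 ?expN1_ge0.
pose w' := \row_i w ord0 (lift ord0 i).
pose P' := \prod_i poissonk (w' ord0 i).
transitivity (\int[leb]_a ((2 / e) ^+ d * (expR (- (e * `|a|)) * 1) +
    P' * (expR (- (e * `|a|)) * cos (a * w ord0 ord0 + t)))%:E)%E.
  apply: eq_integral => a _.
  transitivity ((expR (- (e * `|a|)))%:E * \int[@lebesgue_rV R d]_x
      (expN1 x * (1 + cos (dotp x w' + (a * w ord0 ord0 + t))))%:E)%E.
    rewrite -ge0_integralZl ?lee_fin ?expR_ge0//; last 2 first.
    + apply/measurable_EFinP; apply: measurable_funM; first exact: measurable_expN1.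
      apply: measurable_funD => //; apply: measurable_cosR.
      by apply: measurable_funD => //; exact: measurable_dotpl.
    + by move=> x _; rewrite lee_fin mulr_ge0 ?expN1_ge0.
    apply: eq_integral => v _; rewrite -EFinM dotp_cons /=; congr EFin.
    rewrite mulrA; congr (_ * (1 + cos _)); last by rewrite addrA (addrC (dotp _ _)).
    rewrite /expN1 big_ord_recl cons_rV0; congr (_ * _).
    by apply: eq_bigr => i _; rewrite cons_rVS.
  by rewrite IH -EFinM; congr EFin; rewrite -/P'; ring.
have i1 : leb.-integrable setT (EFin \o (fun a : R => expR (- (e * `|a|)) * 1)).
  by apply: (integrable_expN_abs (g := cst 1) (C := 1)) => // a; rewrite normr1.
have ic : leb.-integrable setT (EFin \o (fun a : R => expR (- (e * `|a|)) * cos (a * w ord0 ord0 + t))).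
  by apply: (integrable_expN_abs (C := 1)) => // a.
have i1' := integrableZl measurableT ((2 / e) ^+ d) i1.
have ic' := integrableZl measurableT P' ic.
rewrite -[LHS]fineK; last first.
  by apply: (integrable_fin_num measurableT); exact: (integrableD measurableT i1' ic').
congr EFin; rewrite -/(Rintegral _ _ _) RintegralD//.
rewrite !RintegralZl// Rintegral_poisson.
have -> : \int[leb]_a (expR (- (e * `|a|)) * 1) = \int[leb]_a expR (- (e * `|a|)).
  by apply: eq_Rintegral => a _; rewrite mulr1.
rewrite Rintegral_expN_abs -exprSr big_ord_recl.
have -> : \prod_(i < d) poissonk (w ord0 (lift ord0 i)) = P'.
  by apply: eq_bigr => i _; rewrite mxE.
by congr (_ + _); rewrite mulrCA (mulrC P').
Qed.

Lemma integral_expN1 d : (\int[@lebesgue_rV R d]_x (expN1 x)%:E = ((2 / e) ^+ d)%:E)%E.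
Proof.
rewrite (@ge0_integral_prod_rV R d (fun _ t => expR (- (e * `|t|)))).
- under eq_bigr do rewrite integral_expN_abs.
  rewrite -[X in _ ^+ X](card_ord d) -prodr_const.
  by rewrite (big_morph EFin (fun x y => EFinM x y) erefl).
- by move=> _; exact: measurable_expN_abs.
- by move=> _ x; exact: expR_ge0.
Qed.

Lemma integrable_expN1 d (g : 'rV[R]_d -> R) (C : R) : measurable_fun setT g ->
  (forall a, `|g a| <= C) ->
  (@lebesgue_rV R d).-integrable setT (EFin \o (fun a => expN1 a * g a)).
Proof.
move=> mg gC.
have i0 : (@lebesgue_rV R d).-integrable setT (EFin \o (@expN1 d)).
  apply/integrableP; split; first by apply/measurable_EFinP; exact: measurable_expN1.
  have -> : (\int[@lebesgue_rV R d]_a `|(EFin \o (@expN1 d)) a| =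
      \int[@lebesgue_rV R d]_a (expN1 a)%:E)%E.
    by apply: eq_integral => a _; rewrite /= ger0_norm ?expN1_ge0.
  by rewrite integral_expN1 ltry.
exact: (integrable_mulb i0 mg gC).
Qed.

Lemma Rintegral_poisson_rV d (w : 'rV[R]_d) :
  \int[@lebesgue_rV R d]_x (expN1 x * cos (dotp x w)) = \prod_i poissonk (w ord0 i).
Proof.
have := congr1 fine (integral_poisson_rV w 0); rewrite /= -/(Rintegral _ _ _) cos0 mul1r.
under eq_Rintegral do rewrite mulrDr addr0.
rewrite RintegralD//; last 2 first.
- by apply: (integrable_expN1 (g := cst 1) (C := 1)) => // a; rewrite normr1.
- apply: (integrable_expN1 (C := 1)) => //.
  by apply: measurable_cosR; exact: measurable_dotpl.
have -> : \int[@lebesgue_rV R d]_a (expN1 a * 1) = (2 / e) ^+ d.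
  rewrite /Rintegral -[RHS]/(fine ((2 / e) ^+ d)%:E) -integral_expN1; congr fine.
  by apply: eq_integral => a _; rewrite mulr1.
exact: addrI.
Qed.

End poisson.

(** * Integration tools *)

Section integration_tools.
Context {R : realType}.

Lemma Rintegral_sum d (T : measurableType d) (m : {measure set T -> \bar R})
    (I : Type) (r : seq I) (f : I -> T -> R) :
  (forall i, m.-integrable setT (EFin \o f i)) ->
  m.-integrable setT (EFin \o (fun x => \sum_(i <- r) f i x)) /\
  \int[m]_x (\sum_(i <- r) f i x) = \sum_(i <- r) \int[m]_x f i x.
Proof.
move=> fi; elim: r => [|i r [IH1 IH2]].
  rewrite big_nil; split.
    rewrite (_ : _ \o _ = cst 0%E); first exact: integrable0.
    by apply/funext => x; rewrite /= big_nil.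
  under eq_Rintegral do rewrite big_nil.
  by rewrite /Rintegral integral0.
split.
  rewrite (_ : _ \o _ = (fun x => (EFin \o f i) x + (\sum_(i <- r) f i x)%R%:E)%E).
    exact: (integrableD measurableT (fi i) IH1).
  by apply/funext => x; rewrite /= big_cons EFinD.
under eq_Rintegral do rewrite big_cons.
by rewrite RintegralD// IH2 big_cons.
Qed.

Lemma EFin_Rintegral d (T : measurableType d) (m : {measure set T -> \bar R}) (f : T -> R) :
  m.-integrable setT (EFin \o f) -> (\int[m]_x (f x)%:E = (\int[m]_x f x)%:E)%E.
Proof. by move=> fi; rewrite /Rintegral fineK//; exact: integrable_fin_num. Qed.

Lemma integrable_norm d (T : measurableType d) (m : {measure set T -> \bar R}) (f : T -> R) :
  m.-integrable setT (EFin \o f) -> m.-integrable setT (EFin \o (fun x => `|f x|)).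
Proof. by move=> /integrable_abse. Qed.

Section fubini_mulb.
Context d1 d2 (T1 : measurableType d1) (T2 : measurableType d2).
Variables (m1 : {sigma_finite_measure set T1 -> \bar R})
          (m2 : {sigma_finite_measure set T2 -> \bar R}).

(** The double integral converges absolutely since the factor k is bounded. *)
Lemma Fubini_mulb (f : T1 -> R) (g : T2 -> R) (k : T1 * T2 -> R) (C : R) :
  m1.-integrable setT (EFin \o f) -> m2.-integrable setT (EFin \o g) ->
  measurable_fun setT k -> (forall u, `|k u| <= C) ->
  \int[m1]_x (f x * \int[m2]_y (g y * k (x, y))) =
  \int[m2]_y (g y * \int[m1]_x (f x * k (x, y))).
Proof.
move=> fi gi mk kC.
have mf : measurable_fun setT f by exact/measurable_EFinP/(measurable_int _ fi).
have mg : measurable_fun setT g by exact/measurable_EFinP/(measurable_int _ gi).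
have mk1 x : measurable_fun setT (fun y => k (x, y)).
  by apply: measurableT_comp => //.
have mk2 y : measurable_fun setT (fun x => k (x, y)).
  by apply: measurableT_comp => //.
pose F (u : T1 * T2) := f u.1 * (g u.2 * k u).
have mF : measurable_fun setT F.
  apply: measurable_funM; first exact: (measurableT_comp mf measurable_fst).
  by apply: measurable_funM => //; exact: (measurableT_comp mg measurable_snd).
have gki x : m2.-integrable setT (EFin \o (fun y => g y * k (x, y))).
  exact: (integrable_mulb gi (mk1 x)).
have fki y : m1.-integrable setT (EFin \o (fun x => f x * k (x, y))).
  exact: (integrable_mulb fi (mk2 y)).
have Gi : (m1 \x m2)%E.-integrable setT (EFin \o (fun u => f u.1 * g u.2)).
  apply/(integrable12ltyP _ _).
    apply/measurable_EFinP; apply: measurable_funM.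
      exact: (measurableT_comp mf measurable_fst).
    exact: (measurableT_comp mg measurable_snd).
  have gn := integrable_norm gi; have fn := integrable_norm fi.
  rewrite (eq_integral (fun x => (\int[m2]_y `|g y| * `|f x|)%:E)); last first.
    move=> x _; rewrite mulrC -RintegralZl// -EFin_Rintegral.
      by apply: eq_integral => y _; rewrite /= normrM.
    exact: (integrableZl measurableT _ gn).
  rewrite EFin_Rintegral ?ltry//.
  exact: (integrableZl measurableT _ fn).
have Fi : (m1 \x m2)%E.-integrable setT (EFin \o F).
  rewrite (_ : F = fun u => (f u.1 * g u.2) * k u); first exact: integrable_mulb Gi mk kC.
  by apply/funext => u; rewrite /F mulrA.
have E1 x : (\int[m2]_y (F (x, y))%:E = (f x * \int[m2]_y (g y * k (x, y)))%:E)%E.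
  rewrite EFin_Rintegral; first by rewrite /F /= RintegralZl.
  exact: (integrableZl measurableT (f x) (gki x)).
have E2 y : (\int[m1]_x (F (x, y))%:E = (g y * \int[m1]_x (f x * k (x, y)))%:E)%E.
  rewrite (eq_integral (fun x => (g y * (f x * k (x, y)))%:E)); last first.
    by move=> x _; rewrite /F /= mulrCA.
  rewrite EFin_Rintegral; first by rewrite RintegralZl.
  exact: (integrableZl measurableT (g y) (fki y)).
rewrite /Rintegral; congr fine.
under eq_integral do rewrite -E1.
under [RHS]eq_integral do rewrite -E2.
exact: (Fubini Fi).
Qed.

End fubini_mulb.

Lemma Rintegral_dct d (T : measurableType d) (m : {measure set T -> \bar R})
    (f_ : nat -> T -> R) (f g : T -> R) :
  (forall n, measurable_fun setT (f_ n)) -> m.-integrable setT (EFin \o g) ->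
  (forall n x, `|f_ n x| <= g x) -> (forall x, f_ n x @[n --> \oo] --> f x) ->
  \int[m]_x f_ n x @[n --> \oo] --> \int[m]_x f x.
Proof.
move=> mf gi fg ff.
have mlim : measurable_fun setT f.
  by apply: (measurable_fun_cvg mf) => x _; exact: ff.
have fi n : m.-integrable setT (EFin \o f_ n).
  apply: (le_integrable measurableT _ _ gi); first exact/measurable_EFinP.
  by move=> x _ /=; rewrite lee_fin (le_trans (fg n x))// ler_norm.
have [] // := @dominated_convergence _ _ _ m setT measurableT (fun n => EFin \o f_ n) (EFin \o f) (EFin \o g).
- by move=> n; exact/measurable_EFinP.
- exact/measurable_EFinP.
- by apply: aeW => x _; apply/fine_cvgP; split; [exact: nearW|exact: ff].
- by apply: aeW => x n _; rewrite lee_fin.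
move=> Fi _ H.
rewrite /Rintegral; apply: fine_cvg; rewrite fineK//; exact: integrable_fin_num.
Qed.

Lemma lip_of_derive (f f1 : R -> R) (C a b : R) : a <= b ->
  (forall s, is_derive s (1 : R) f (f1 s)) ->
  (forall s, s \in `[a, b] -> `|f1 s| <= C) -> `|f b - f a| <= C * (b - a).
Proof.
move=> ab df fC.
have cf : {within `[a, b], continuous f}.
  apply: continuous_subspaceT => x; apply: differentiable_continuous.
  by apply/derivable1_diffP; apply: ex_derive; exact: df.
have [c cab ->] := @MVT_segment R f f1 a b ab (fun x _ => df x) cf.
by rewrite normrM (ger0_norm (x := b - a)) ?subr_ge0// ler_wpM2r ?subr_ge0//; exact: fC.
Qed.

(** Only the size of the remainder matters, so the constant is C and not C /
    2; two applications of the mean value inequality suffice. *)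
Lemma taylor2 (f f1 f2 : R -> R) (C t v : R) :
  (forall s, is_derive s (1 : R) f (f1 s)) -> (forall s, is_derive s (1 : R) f1 (f2 s)) ->
  (forall s, `|f2 s| <= C) -> `|f (t + v) - f t - v * f1 t| <= C * v ^+ 2.
Proof.
move=> df df1 fC.
have C0 : 0 <= C by apply: le_trans (fC 0).
have lip1 s : `|f1 (t + s) - f1 t| <= C * `|s|.
  have [s0|s0] := leP 0 s.
    have := @lip_of_derive f1 f2 C t (t + s) _ df1 (fun s _ => fC s).
    by rewrite lerDl (addrC t s) addrK (ger0_norm s0); exact.
  have := @lip_of_derive f1 f2 C (t + s) t _ df1 (fun s _ => fC s).
  rewrite distrC gerDl (ltW s0) (ltr0_norm s0) opprD addNKr; exact.
pose g s := f (t + s) - s * f1 t.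
have dg s : is_derive s (1 : R) g (f1 (t + s) - f1 t).
  have ds : is_derive s (1 : R) (fun s => t + s) 1.
    by have := is_derive_shift s 1 t; rewrite (_ : shift t = (fun s => t + s))//; apply/funext => x; rewrite /= addrC.
  have dft : is_derive s (1 : R) (fun s => f (t + s)) (f1 (t + s)).
    rewrite -[X in is_derive _ _ _ X]mulr1.
    exact: (@is_derive1_comp R f (fun s => t + s) s _ _ (df _) ds).
  have dm : is_derive s (1 : R) (fun s => s * f1 t) (f1 t).
    have := is_deriveZ (f1 t) (is_derive_id s (1 : R)).
    rewrite (_ : _ \*: _ = (fun s => s * f1 t)); last by apply/funext => x; rewrite mulrC.
    by rewrite [_ *: _]mulr1.
  exact: (is_deriveB dft dm).
have H a b : a <= b -> (forall s, s \in `[a, b] -> `|s| <= `|v|) -> `|g b - g a| <= C * `|v| * (b - a).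
  move=> ab hs; apply: (lip_of_derive ab dg) => s sab.
  by apply: le_trans (lip1 s) _; rewrite ler_wpM2l// hs.
have -> : f (t + v) - f t - v * f1 t = g v - g 0 by rewrite /g addr0 mul0r subr0; ring.
have [v0|v0] := leP 0 v.
  have := H 0 v v0; rewrite subr0 ger0_norm// -mulrA -expr2; apply => s.
  by rewrite in_itv/= => /andP[s0 sv]; rewrite ger0_norm.
have := H v 0 (ltW v0); rewrite distrC sub0r ltr0_norm// -mulrA mulrNN -expr2; apply => s.
by rewrite in_itv/= => /andP[s0 sv]; rewrite ler0_norm// lerN2.
Qed.

End integration_tools.

(** * Smooth functions of compact support *)

Section cpt_functions.
Context {R : realType} {d : nat}.
Implicit Types (a u f : 'rV[R]_d -> R).
Local Notation mu := (@lebesgue_rV R d).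

(** The support is confined by a bound on dotp x x; this form survives
    products and derivatives without a discussion of topological supports. *)
Definition cpt a := rsmooth a /\ exists rho, forall x, rho <= dotp x x -> a x = 0.

Lemma cptM f a : rsmooth f -> cpt a -> cpt (f \* a).
Proof.
move=> sf [sa [rho a0]]; split; first exact: rsmoothM.
by exists rho => x xr /=; rewrite a0// mulr0.
Qed.

Lemma cptD a u : cpt a -> cpt u -> cpt (a \+ u).
Proof.
move=> [sa [rho a0]] [su [rho' u0]]; split; first exact: rsmoothD.
exists (Num.max rho rho') => x; rewrite ge_max => /andP[r1 r2] /=.
by rewrite a0// u0// addr0.
Qed.

Lemma cpt_pd i a : cpt a -> cpt (pd i a).
Proof.
move=> [sa [rho a0]]; split; first exact: rsmooth_pd.
exists (rho + 1) => x xr; rewrite /pd (near_eq_derive (g := cst 0)) ?derive_cst//.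
have : \near x, rho < dotp x x.
  have cx : dotp y y @[y --> x] --> dotp x x by exact: (rsmooth_cont rsmooth_dotpp).
  apply: (cvgr_gt _ cx).
  by rewrite (lt_le_trans _ xr)// ltrDl.
by apply: filterS => y yr; rewrite a0// ltW.
Qed.

Lemma cpt_coord i a : cpt a -> cpt (fun x => x ord0 i * a x).
Proof. exact/cptM/rsmooth_coord. Qed.

Lemma dotpC (x y : 'rV[R]_d) : dotp x y = dotp y x.
Proof. by apply: eq_bigr => i _; rewrite mulrC. Qed.

Lemma dotpDl (x y z : 'rV[R]_d) : dotp (x + y) z = dotp x z + dotp y z.
Proof. by rewrite /dotp -big_split/=; apply: eq_bigr => i _; rewrite mxE mulrDl. Qed.

Lemma dotpZl (c : R) (x z : 'rV[R]_d) : dotp (c *: x) z = c * dotp x z.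
Proof. by rewrite /dotp mulr_sumr; apply: eq_bigr => i _; rewrite mxE mulrA. Qed.

Lemma dotp_coord_le (x : 'rV[R]_d) i : x ord0 i ^+ 2 <= dotp x x.
Proof.
rewrite /dotp (bigD1 i)//= -expr2 lerDl.
by apply: sumr_ge0 => j _; rewrite -expr2 sqr_ge0.
Qed.

Lemma dotpp_ge0 (x : 'rV[R]_d) : 0 <= dotp x x.
Proof. by apply: sumr_ge0 => j _; rewrite -expr2 sqr_ge0. Qed.

Lemma dotp_add_delta (x : 'rV[R]_d) (t : R) i :
  dotp (x + t *: delta_mx ord0 i) (x + t *: delta_mx ord0 i) =
  dotp x x + 2 * t * x ord0 i + t ^+ 2.
Proof.
rewrite /dotp (bigD1 i)//= [in RHS](bigD1 i)//= (eq_bigr (fun j => x ord0 j * x ord0 j)).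
  by rewrite !mxE !eqxx /= mulr1; ring.
by move=> j ji; rewrite !mxE (negbTE ji) andbF mulr0 addr0.
Qed.

Lemma compact_dotp (rho : R) : compact [set x : 'rV[R]_d | dotp x x <= rho].
Proof.
apply: bounded_closed_compact.
  exists (1 + `|rho|); split; first exact: num_real.
  move=> M M1 x /= xr; rewrite /Num.norm /= mx_normrE.
  apply/bigmax_leP; split=> [|[i j] _ /=].
    by apply: ltW; apply: lt_trans M1; rewrite ltr_pwDl.
  rewrite (_ : i = ord0); last by rewrite ord1.
  have h := le_trans (dotp_coord_le x j) xr.
  have M0 : 1 < M by apply: le_lt_trans M1; rewrite lerDl.
  rewrite -(@ler_pXn2r _ 2) ?nnegrE// ?real_normK ?num_real//; last by rewrite ltW// (lt_trans _ M0).
  apply: (le_trans h); apply: (@le_trans _ _ M).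
    by apply: (le_trans (ler_norm rho)); apply: ltW; apply: le_lt_trans M1; rewrite lerDr.
  by rewrite expr2 ler_peMr// ltW// (lt_trans _ M0).
apply: (@preimage_closed _ _ (fun x : 'rV[R]_d => dotp x x) [set t | t <= rho]).
  by move=> x _; exact: (rsmooth_cont rsmooth_dotpp).
exact: closed_le.
Qed.

Lemma cpt_bounded a : cpt a -> exists2 C : R, 0 <= C & forall x, `|a x| <= C.
Proof.
move=> [sa [rho a0]].
have cf : {within [set x : 'rV[R]_d | dotp x x <= `|rho|], continuous (fun x => `|a x|)}.
  apply: continuous_subspaceT => x.
  by apply: (@continuous_comp _ _ _ a Num.norm); [exact: rsmooth_cont|exact: norm_continuous].
have ne : [set x : 'rV[R]_d | dotp x x <= `|rho|] !=set0.
  by exists 0 => /=; rewrite (_ : dotp _ _ = 0)// /dotp big1// => i _; rewrite mxE mul0r.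
have [c _ cP] := EVT_max_rV ne (@compact_dotp `|rho|) cf.
exists `|a c| => // x; have [h|h] := leP rho (dotp x x).
  by rewrite a0// normr0.
by apply: cP; rewrite inE /= ltW// (lt_le_trans h)// ler_norm.
Qed.

Lemma cpt_measurable a : cpt a -> measurable_fun setT a.
Proof. by move=> [sa _]; apply: continuous_measurable_rV; exact: rsmooth_cont. Qed.

Lemma cpt_integrable a : cpt a -> mu.-integrable setT (EFin \o a).
Proof.
move=> ca; have [C _ aC] := cpt_bounded ca; have [_ [rho a0]] := ca.
by apply: (integrable_cpt _ aC a0); exact: cpt_measurable.
Qed.

Lemma is_derive_line i u (x : 'rV[R]_d) (s : R) : rsmooth u ->
  is_derive s (1 : R) (fun s => u (x + s *: delta_mx ord0 i)) (pd i u (x + s *: delta_mx ord0 i)).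
Proof.
move=> su.
pose h (s : R) : 'rV[R]_d := x + s *: delta_mx ord0 i.
have dh : is_diff s h (0 + ( *:%R^~ (delta_mx ord0 i))).
  exact: (is_diffD (is_diff_cst x s) (is_diff_scalel s (delta_mx ord0 i))).
have du := rsmooth_diff (h s) su.
have dhs : differentiable h s by apply: ex_diff.
apply: DeriveDef.
  by apply/derivable1_diffP; exact: (differentiable_comp dhs du).
rewrite deriveE; last exact: (differentiable_comp dhs du).
rewrite (_ : (fun s => _) = u \o h)// diff_comp//= diff_val fctE add0r scale1r.
by rewrite pdE.
Qed.

(** Translation invariance gives integral (u(x + t e_i) - u(x)) dx = 0. The
    integrand is t times the partial derivative up to O(t^2) on a fixed
    bounded set, so t times the integral is O(t^2), which forces it to vanish.
    *)
Lemma integral_pd i u : cpt u -> \int[mu]_x pd i u x = 0.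
Proof.
move=> cu; have [su [rho u0]] := cu.
have cpu := cpt_pd i cu; have [C C0 uC] := cpt_bounded (cpt_pd i cpu).
set e : 'rV[R]_d := delta_mx ord0 i.
have ui := cpt_integrable cu; have pi_ := cpt_integrable cpu.
have [_ [rho1 pu0]] := cpu.
pose rho' : R := 2 * (`|rho| + 1) + `|rho1|.
pose D : R := C * (1 + `|rho'|) ^+ d * pi ^+ d.
(* the constant comes from dominating the indicator of a ball by a multiple of W *)
have key (t : R) : 0 < t -> t <= 1 -> `|t * \int[mu]_x pd i u x| <= D * t ^+ 2.
  move=> t0 t1.
  have uti : mu.-integrable setT (EFin \o (fun x => u (x + t *: e))).
    rewrite (_ : (fun x => _) = (fun x => u (1 *: x + t *: e))).
      by apply: integrable_affine_rV => //; exact: oner_neq0.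
    by apply/funext => x; rewrite scale1r.
  have E0 : \int[mu]_x u (x + t *: e) = \int[mu]_x u x.
    have := Rintegral_affine_rV (t *: e) (oner_neq0 R) ui.
    rewrite normr1 expr1n invr1 mul1r => <-.
    by apply: eq_Rintegral => x _; rewrite scale1r.
  have tpi := integrableZl measurableT t pi_.
  have <- : - (\int[mu]_x (u (x + t *: e) - u x - t * pd i u x)) = t * \int[mu]_x pd i u x.
    rewrite RintegralB//; last exact: (integrableB measurableT uti ui).
    by rewrite RintegralB// E0 subrr sub0r opprK RintegralZl.
  rewrite normrN.
  have di := integrableB measurableT (integrableB measurableT uti ui) tpi.
  apply: le_trans (le_normr_Rintegral measurableT di) _.
  have Wi := @integrable_W R d.
  apply: (@le_trans _ _ (\int[mu]_x (C * t ^+ 2 * (1 + `|rho'|) ^+ d * W x))); last first.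
    rewrite RintegralZl// Rintegral_W /D le_eqVlt; apply/orP; left; apply/eqP; ring.
  apply: le_Rintegral => //.
  - exact: (integrable_norm di).
  - exact: (integrableZl measurableT _ Wi).
  move=> x _.
  have [xr|xr] := leP rho' (dotp x x).
    have xr1 : 2 * (`|rho| + 1) <= dotp x x by rewrite (le_trans _ xr)// lerDl.
    have h1 : rho <= dotp (x + t *: e) (x + t *: e).
      rewrite dotp_add_delta.
      have := dotp_coord_le x i; have := ler_norm rho.
      have : t ^+ 2 <= 1 by rewrite expr_le1// ltW.
      have := sqr_ge0 (x ord0 i + 2 * t); rewrite sqrrD.
      move: xr1; move: (x ord0 i) (dotp x x) `|rho| => a b c *; lra.
    have h2 : rho <= dotp x x by have := ler_norm rho; have := normr_ge0 rho; lra.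
    have h3 : rho1 <= dotp x x.
      by have := ler_norm rho1; have := normr_ge0 rho; move: xr; rewrite /rho'; lra.
    rewrite (u0 _ h1) (u0 _ h2) pu0// mulr0 !subr0 normr0.
    rewrite mulr_ge0 ?W_ge0// mulr_ge0// ?exprn_ge0 ?addr_ge0//.
    by rewrite mulr_ge0 ?sqr_ge0.
  have b1 : `|u (x + t *: e) - u x - t * pd i u x| <= C * t ^+ 2.
    have := @taylor2 R (fun s => u (x + s *: e)) (fun s => pd i u (x + s *: e)) (fun s => pd i (pd i u) (x + s *: e)) C 0 t.
    rewrite scale0r add0r addr0; apply.
    - by move=> s; exact: is_derive_line.
    - by move=> s; apply: is_derive_line; exact: rsmooth_pd.
    - by move=> s; exact: uC.
  apply: (le_trans b1); rewrite -[leRHS]mulrA ler_peMr ?mulr_ge0 ?sqr_ge0 ?(ltW t0)//.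
  have r1 : 0 < (1 + `|rho'|) ^+ d by rewrite exprn_gt0// ltr_pwDl.
  rewrite -ler_pdivrMl// mulr1; apply: W_ge_ball.
  by rewrite (le_trans (ltW xr))// ler_norm.
apply/eqP; rewrite -normr_le0; apply/ler_addgt0Pl => n n0.
have D0 : 0 <= D.
  rewrite /D mulr_ge0 ?exprn_ge0 ?pi_ge0// mulr_ge0// exprn_ge0// addr_ge0//.
pose t := Num.min 1 (n / (D + 1)).
have D1 : 0 < D + 1 by rewrite ltr_wpDl.
have t0 : 0 < t by rewrite lt_min ltr01 divr_gt0.
have t1 : t <= 1 by rewrite ge_min lexx.
have tn : t * (D + 1) <= n by rewrite -ler_pdivlMr// ge_min lexx orbT.
have h1 : `|\int[mu]_x pd i u x| <= D * t.
  by rewrite -(ler_pM2l t0) -{1}(gtr0_norm t0) -normrM (le_trans (key t t0 t1))// expr2 mulrCA.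
have h2 : D * t <= t * (D + 1) by rewrite mulrDr mulr1 mulrC lerDl ltW.
by rewrite addr0 (le_trans h1)// (le_trans h2).
Qed.

End cpt_functions.

(** * Oscillatory integrals *)

Section quadratic_remainder.
Context {R : realType} {d : nat}.
Implicit Types (f : 'rV[R]_d -> R).

(** A quadratic remainder determines the differential. *)
Lemma diff_quadratic f (c x : 'rV[R]_d) (C : R) :
  (forall h, `|f (x + h) - f x - dotp h c| <= C * `|h| ^+ 2) ->
  differentiable f x /\ forall i, pd i f x = c ord0 i.
Proof.
move=> fC.
have lin : linear (fun h : 'rV[R]_d => dotp h c) by move=> a u v; rewrite dotpDl dotpZl.
pose L : {linear 'rV[R]_d -> R} :=
  HB.pack (fun h : 'rV[R]_d => dotp h c) (GRing.isLinear.Build _ _ _ _ _ lin).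
have cL : continuous L by exact: (rsmooth_cont (rsmooth_dotp c)).
lazymatch type of (@diff_unique _ _ _ f L x cL) with (?P -> _) => have fL : P end.
  apply/eqaddoP => e e0; near=> h.
  have -> : (f \o shift x - (cst (f x) + L)) h = f (x + h) - f x - dotp h c.
    by rewrite !fctE /= opprD addrA (addrC h).
  apply: le_trans (fC h) _.
  have C1 : 0 < `|C| + 1 by rewrite ltr_wpDl.
  have hC : `|h| <= e / (`|C| + 1).
    by near: h; apply: (@nbhs0_le R 'rV[R]_d); rewrite divr_gt0.
  rewrite expr2 mulrA ler_wpM2r//.
  apply: (@le_trans _ _ ((`|C| + 1) * `|h|)); last by rewrite mulrC -ler_pdivlMr.
  by rewrite ler_wpM2r// (le_trans (ler_norm C))// lerDl.
have dL := diff_unique cL fL.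
have df : differentiable f x by apply/diff_locallyP; rewrite dL.
split=> // i; rewrite pdE// dL /= /L /= /dotp (bigD1 i)//= big1 ?addr0.
  by rewrite mxE !eqxx mul1r.
by move=> j ji; rewrite mxE (negbTE ji) andbF mul0r.
Unshelve. all: by end_near.
Qed.

End quadratic_remainder.

Section oscillatory.
Context {R : realType} {d : nat}.
Implicit Types (a u f : 'rV[R]_d -> R) (i : 'I_d).
Local Notation mu := (@lebesgue_rV R d).
Local Notation cosn n t := (cos (t + n%:R * (pi / 2))).

(** For n = 0 and n = 1 this is the cosine transform of a and minus its sine
    transform. One family with a phase is closed under all the operations
    below, where the two transforms would be interchanged. *)
Definition osc a n (x : 'rV[R]_d) : R := \int[mu]_xi (a xi * cosn n (dotp x xi)).

Lemma cosn2 n (t : R) : cosn n.+2 t = - cosn n t.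
Proof.
rewrite -[n.+2]addn2 natrD mulrDl addrA (mulrC 2) divfK//.
by rewrite cosDpi.
Qed.

Lemma cos_le1_norm (t : R) : `|cos t| <= 1.
Proof. by rewrite ler_norml cos_geN1 cos_le1. Qed.

Lemma measurable_phase (x : 'rV[R]_d) (t : R) :
  measurable_fun setT (fun xi : 'rV[R]_d => cos (dotp x xi + t)).
Proof.
apply: measurable_cosR; apply: measurable_funD => //.
by apply: (measurable_dotp (f := cst x)).
Qed.

Lemma integrable_osc a n x : cpt a ->
  mu.-integrable setT (EFin \o (fun xi => a xi * cosn n (dotp x xi))).
Proof.
move=> ca; apply: (integrable_mulb (cpt_integrable ca) (measurable_phase _ _) (C := 1)).
by move=> xi; exact: cos_le1_norm.
Qed.

Lemma osc_bounded a n : cpt a -> exists2 C : R, 0 <= C & forall x, `|osc a n x| <= C.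
Proof.
move=> ca; have ai := cpt_integrable ca; exists (\int[mu]_xi `|a xi|).
  by apply: Rintegral_ge0.
move=> x; apply: le_trans (le_normr_Rintegral measurableT (integrable_osc n x ca)) _.
apply: le_Rintegral => //.
- exact: (integrable_norm (integrable_osc n x ca)).
- exact: integrable_norm.
by move=> xi _; rewrite normrM ler_piMr// cos_le1_norm.
Qed.

(** Differentiation under the integral sign, with the remainder made explicit
    by Taylor's formula for the cosine; on the support of a the frequency xi
    is bounded. *)
Lemma osc_quadratic a n x : cpt a -> exists C : R, forall h,
  `|osc a n (x + h) - osc a n x - dotp h (\row_i osc (fun xi => xi ord0 i * a xi) n.+1 x)|
   <= C * `|h| ^+ 2.
Proof.
move=> ca; have [C C0 aC] := cpt_bounded ca; have [_ [rho a0]] := ca.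
pose B : R := d%:R * (1 + `|rho|).
exists (B ^+ 2 * \int[mu]_xi `|a xi|) => h.
have ai := cpt_integrable ca.
have i1 := integrable_osc n (x + h) ca; have i2 := integrable_osc n x ca.
have i3 i := integrable_osc n.+1 x (cpt_coord i ca).
have i4 i := integrableZl measurableT (h ord0 i) (i3 i).
have [s1 s2] := Rintegral_sum (index_enum 'I_d) i4.
have -> : dotp h (\row_i osc (fun xi => xi ord0 i * a xi) n.+1 x) =
    \int[mu]_xi (\sum_i h ord0 i * (xi ord0 i * a xi * cosn n.+1 (dotp x xi))).
  rewrite s2; apply: eq_bigr => i _; rewrite mxE RintegralZl//.
rewrite /osc -RintegralB// -RintegralB//; last exact: (integrableB measurableT i1 i2).
have di := integrableB measurableT (integrableB measurableT i1 i2) s1.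
apply: le_trans (le_normr_Rintegral measurableT di) _.
have an := integrable_norm ai.
rewrite [leRHS](_ : _ = \int[mu]_xi (B ^+ 2 * `|h| ^+ 2 * `|a xi|)); last first.
  by rewrite RintegralZl//; ring.
apply: le_Rintegral => //.
- exact: (integrable_norm di).
- exact: (integrableZl measurableT _ an).
move=> xi _ /=.
have [xr|xr] := leP rho (dotp xi xi).
  rewrite a0// !mul0r subr0 sub0r big1 ?oppr0 ?normr0 ?mulr0// => i _.
  by rewrite mulr0 mul0r mulr0.
rewrite (_ : _ - _ = a xi * (cos (dotp x xi + n%:R * (pi / 2) + dotp h xi) -
   cosn n (dotp x xi) - dotp h xi * cosn n.+1 (dotp x xi))); last first.
  rewrite mulrBr mulrBr; congr (_ - _ - _).
    congr (_ * cos _); rewrite addrAC; congr (_ + _).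
    by rewrite /dotp -big_split/=; apply: eq_bigr => i _; rewrite mxE mulrDl.
  by rewrite /dotp mulr_suml mulr_sumr; apply: eq_bigr => i _; ring.
rewrite normrM mulrC ler_wpM2r//.
have hB : `|dotp h xi| <= `|h| * B.
  apply: le_trans (ler_norm_sum _ _ _) _.
  rewrite /B mulrA mulrAC mulr_natr -[X in _ *+ X](card_ord d) -sumr_const.
  apply: ler_sum => i _; rewrite normrM ler_pM//.
    by rewrite /Num.norm /= mx_normrE; exact: (le_bigmax _ (fun ij => `|h ij.1 ij.2|) (ord0, i)).
  have hx : xi ord0 i ^+ 2 <= `|rho|.
    apply: le_trans (dotp_coord_le _ _) _.
    by apply: ltW; apply: lt_le_trans xr _; exact: ler_norm.
  rewrite -(@ler_pXn2r _ 2) ?nnegrE ?addr_ge0// real_normK ?num_real//.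
  by apply: (le_trans hx); have := normr_ge0 rho; move: `|rho| => r; nra.
have := @taylor2 R cos (fun t => cos (t + pi / 2)) (fun t => - cos t) 1
  (dotp x xi + n%:R * (pi / 2)) (dotp h xi).
rewrite (_ : _ + pi / 2 = dotp x xi + n.+1%:R * (pi / 2)); last first.
  by rewrite -[n.+1%:R]natr1; ring.
rewrite mul1r => T2; apply: le_trans (T2 _ _ _) _.
- by move=> s; rewrite cosDpihalf; exact: is_derive_cos.
- move=> s; rewrite (_ : (fun t => _) = - @sin R); first exact: is_deriveN.
  by apply/funext => t; rewrite cosDpihalf.
- by move=> s; rewrite normrN cos_le1_norm.
rewrite -real_normK ?num_real// -exprMn_comm; last by rewrite /GRing.comm mulrC.
by rewrite lerXn2r ?nnegrE ?mulr_ge0 ?addr_ge0// mulrC.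
Qed.

Lemma pd_osc a n i : cpt a -> pd i (osc a n) = osc (fun xi => xi ord0 i * a xi) n.+1.
Proof.
move=> ca; apply/funext => x; have [C hC] := osc_quadratic n x ca.
by rewrite (diff_quadratic hC).2 mxE.
Qed.

Lemma diff_osc a n x : cpt a -> differentiable (osc a n) x.
Proof. by move=> ca; have [C hC] := osc_quadratic n x ca; exact: (diff_quadratic hC).1. Qed.

Lemma partials_osc s a n : cpt a -> exists a' n', cpt a' /\ partials s (osc a n) = osc a' n'.
Proof.
elim/last_ind: s a n => [|s i IH] a n ca; first by exists a, n.
by rewrite partials_rcons pd_osc//; apply: IH; exact: cpt_coord.
Qed.

Lemma rsmooth_osc a n : cpt a -> rsmooth (osc a n).
Proof.
move=> ca s x; have [a' [n' [ca' ->]]] := partials_osc s n ca.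
exact: diff_osc.
Qed.

Lemma rsmooth_phase (x : 'rV[R]_d) n : rsmooth (fun xi : 'rV[R]_d => cosn n (dotp x xi)).
Proof.
apply: rsmooth_cos; rewrite (_ : dotp x = fun xi => dotp xi x); first exact: rsmooth_dotp.
by apply/funext => xi; rewrite dotpC.
Qed.

Lemma pd_phase (x : 'rV[R]_d) n i : pd i (fun xi : 'rV[R]_d => cosn n (dotp x xi)) =
  (fun xi => x ord0 i * cosn n.+1 (dotp x xi)).
Proof.
rewrite (_ : (fun xi => _) = (fun t => cosn n t) \o (fun xi => dotp xi x)); last first.
  by apply/funext => xi /=; rewrite dotpC.
rewrite (pd_comp _ (is_derive_cosn n)); last by move=> y; exact/rsmooth_diff/rsmooth_dotp.
apply/funext => xi /=; rewrite mulrC dotpC; congr (_ * _).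
apply: (@diff_quadratic _ _ (fun xi => dotp xi x) x xi 0 _).2 => h.
by rewrite dotpDl (addrC (dotp xi x)) addrK subrr normr0 mul0r.
Qed.

(** Integration by parts: multiplication by a coordinate of x is the
    derivative of the phase in xi, and moves to a. *)
Lemma osc_coord a n i (x : 'rV[R]_d) : cpt a -> x ord0 i * osc a n x = osc (pd i a) n.+1 x.
Proof.
move=> ca; have ci := cpt_pd i ca.
have cu := cptM (rsmooth_phase x n.+1) ca.
have := integral_pd i cu; rewrite pdM; last 2 first.
- by move=> y; exact/rsmooth_diff/rsmooth_phase.
- by move=> y; apply: rsmooth_diff; case: ca.
rewrite pd_phase => E.
have i1 := integrableZl measurableT (x ord0 i) (integrable_osc n x ca).
have i2 := integrable_osc n.+1 x ci.
rewrite -RintegralZl; last 2 first.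
- by [].
- exact: integrable_osc.
apply/eqP; rewrite eq_sym -subr_eq0 -RintegralB//; apply/eqP; rewrite -[RHS]E.
by apply: eq_Rintegral => xi _ /=; rewrite cosn2; ring.
Qed.

End oscillatory.

(** * Rapid decay and Fourier inversion *)

Section decay.
Context {R : realType} {d : nat}.
Implicit Types (a u f g : 'rV[R]_d -> R) (i : 'I_d).
Local Notation mu := (@lebesgue_rV R d).
Local Notation cosn n t := (cos (t + n%:R * (pi / 2))).

Lemma cptN a : cpt a -> cpt (fun x => - a x).
Proof.
move=> ca; rewrite (_ : (fun x => _) = cst (-1) \* a); first exact: (cptM (rsmooth_cst _) ca).
by apply/funext => x /=; rewrite mulN1r.
Qed.

Lemma oscD a u n x : cpt a -> cpt u -> osc (a \+ u) n x = osc a n x + osc u n x.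
Proof.
move=> ca cu; rewrite /osc -RintegralD//; [|exact: integrable_osc..].
by apply: eq_Rintegral => xi _; rewrite mulrDl.
Qed.

Lemma oscZ a n x (c : R) : cpt a -> osc (fun xi => c * a xi) n x = c * osc a n x.
Proof.
move=> ca; rewrite /osc -RintegralZl//; last exact: integrable_osc.
by apply: eq_Rintegral => xi _; rewrite -mulrA.
Qed.

Lemma oscN a n x : cpt a -> osc (fun xi => - a xi) n x = - osc a n x.
Proof.
move=> ca; rewrite -mulN1r -oscZ//; congr osc.
by apply/funext => xi; rewrite mulN1r.
Qed.

Lemma osc2 a n x : cpt a -> osc a n.+2 x = - osc a n x.
Proof.
move=> ca; rewrite -oscN//; apply: eq_Rintegral => xi _.
by rewrite cosn2 mulrN mulNr.
Qed.

(** Each factor 1 + x_i^2 acts on a as 1 - (d/dxi_i)^2. *)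
Lemma osc_weight a n (s : seq 'I_d) : cpt a -> exists2 a', cpt a' &
  forall x : 'rV[R]_d, \prod_(i <- s) (1 + x ord0 i ^+ 2) * osc a n x = osc a' n x.
Proof.
elim: s a => [|i s IH] a ca; first by exists a => // x; rewrite big_nil mul1r.
have cpp := cptN (cpt_pd i (cpt_pd i ca)).
have [a' ca' aE] := IH _ (cptD ca cpp).
exists a' => // x; rewrite big_cons -aE.
have -> : osc (a \+ (fun xi => - pd i (pd i a) xi)) n x = (1 + x ord0 i ^+ 2) * osc a n x.
  have cp := cpt_pd i ca; have cpp0 := cpt_pd i cp.
  rewrite (oscD n x ca cpp) (oscN n x cpp0) -(osc2 n x cpp0).
  rewrite -(osc_coord n.+1 i x cp) -(osc_coord n i x ca).
  by rewrite mulrDl mul1r expr2 mulrA.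
by rewrite mulrA (mulrC (1 + _)).
Qed.

(** Multiplied by any power of 1 / W the function is again an oscillatory
    integral, and those are bounded. *)
Lemma osc_decay a n m : cpt a -> exists2 C : R, 0 <= C & forall x, `|osc a n x| <= C * W x ^+ m.
Proof.
move=> ca; have [a' ca' aE] := osc_weight n (flatten (nseq m (index_enum 'I_d))) ca.
have [C C0 aC] := osc_bounded n ca'; exists C => // x.
have E : \prod_(i <- flatten (nseq m (index_enum 'I_d))) (1 + x ord0 i ^+ 2) = W x ^- m.
  rewrite big_flatten big_nseq /= -exprVn /W prodfV invrK.
  by elim: m {a' ca' aE C C0 aC} => //= m ->; rewrite exprS.
have := aC x; rewrite -aE E normrM ger0_norm ?invr_ge0 ?exprn_ge0 ?W_ge0//.
by rewrite mulrC ler_pdivrMr ?exprn_gt0 ?W_gt0.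
Qed.

(** Schwartz functions, described by powers of the product weight W. *)
Definition rdecay f := rsmooth f /\
  forall s m, exists2 C : R, 0 <= C & forall x, `|partials s f x| <= C * W x ^+ m.

Lemma rdecay_osc a n : cpt a -> rdecay (osc a n).
Proof.
move=> ca; split; first exact: rsmooth_osc.
move=> s m; have [a' [n' [ca' ->]]] := partials_osc s n ca.
exact: osc_decay.
Qed.

Lemma rdecayD f g : rdecay f -> rdecay g -> rdecay (f \+ g).
Proof.
move=> [sf df] [sg dg]; split; first exact: rsmoothD.
move=> s m; have [C C0 fC] := df s m; have [D D0 gD] := dg s m.
exists (C + D) => [|x]; first exact: addr_ge0.
by rewrite partialsD// mulrDl (le_trans (ler_normD _ _))// lerD.
Qed.

Lemma rdecayZ (c : R) f : rdecay f -> rdecay (fun x => c * f x).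
Proof.
move=> [sf df]; split; first exact: rsmoothZ.
move=> s m; have [C C0 fC] := df s m.
exists (`|c| * C) => [|x]; first exact: mulr_ge0.
by rewrite partialsZ// normrM -mulrA ler_wpM2l.
Qed.

Lemma rdecay_cst0 : rdecay (cst 0).
Proof.
split; first exact: rsmooth_cst.
by move=> s m; exists 0 => // x; rewrite partials_cst mul0rn normr0 mul0r.
Qed.

Lemma W_translate (c : R) (b x : 'rV[R]_d) : c != 0 ->
  W (c *: x + b) <= (\prod_i (2 * (1 + c ^- 2) * (1 + b ord0 i ^+ 2))) * W x.
Proof.
move=> c0; rewrite /W -big_split/=; apply: ler_prod => i _.
rewrite invr_ge0 ltW ?oneDsq_gt0//= ler_pdivlMr ?oneDsq_gt0//.
rewrite mulrC ler_pdivrMr ?oneDsq_gt0// !mxE.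
move: (x ord0 i) (b ord0 i) => t v.
have c2 : 0 < c ^+ 2 by rewrite exprn_even_gt0.
have cV : 0 < c ^- 2 by rewrite invr_gt0.
have E : t ^+ 2 = c ^- 2 * ((c * t + v) - v) ^+ 2 by rewrite addrK exprMn mulKf// gt_eqF.
rewrite E; move: (c * t + v) (c ^- 2) cV => w k k0.
have := sqr_ge0 (w + v); have := sqr_ge0 w; have := sqr_ge0 v; move=> v2 w2 wv.
have h1 : (w - v) ^+ 2 <= 2 * (w ^+ 2 + v ^+ 2) by move: wv; rewrite sqrrB sqrrD; lra.
have h2 : k * (w - v) ^+ 2 <= k * (2 * (w ^+ 2 + v ^+ 2)) by rewrite ler_wpM2l// ltW.
have h3 : 0 <= w ^+ 2 * v ^+ 2 by rewrite mulr_ge0.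
have h4 : 0 <= k * (w ^+ 2 * v ^+ 2) by rewrite mulr_ge0// ltW.
move: h1 h2 h3 h4; move: (w ^+ 2) (v ^+ 2) v2 w2 => w' v' v2 w2 h1 h2 h3 h4.
have h5 : 0 <= k * v' by rewrite mulr_ge0// ltW.
have h6 : 0 <= k * w' by rewrite mulr_ge0// ltW.
nra.
Qed.

Lemma rdecay_affine (c : R) b f : c != 0 -> rdecay f -> rdecay (fun x => f (c *: x + b)).
Proof.
move=> c0 [sf df]; split; first exact: rsmooth_affine.
move=> s m; have [C C0 fC] := df s m.
set P := \prod_i (2 * (1 + c ^- 2) * (1 + b ord0 i ^+ 2)).
have P0 : 0 <= P.
  apply: prodr_ge0 => i _; rewrite !mulr_ge0// addr_ge0// ?sqr_ge0//.
  by rewrite invr_ge0 sqr_ge0.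
exists (`|c ^+ size s| * C * P ^+ m) => [|x]; first by rewrite !mulr_ge0 ?exprn_ge0.
rewrite partials_affine// normrM -!mulrA ler_wpM2l//.
apply: (le_trans (fC _)); rewrite ler_wpM2l// -exprMn.
by rewrite lerXn2r ?nnegrE ?W_ge0 ?mulr_ge0 ?W_ge0//; exact: W_translate.
Qed.

Lemma rdecay_bound f m : rdecay f -> exists2 C : R, 0 <= C & forall x, `|f x| <= C * W x ^+ m.
Proof. by move=> [_ /(_ [::] m)]. Qed.

Lemma rdecay_measurable f : rdecay f -> measurable_fun setT f.
Proof. by move=> [sf _]; apply: continuous_measurable_rV; exact: rsmooth_cont. Qed.

Lemma rdecay_integrable f : rdecay f -> mu.-integrable setT (EFin \o f).
Proof.
move=> df; have [C C0 fC] := rdecay_bound 1 df.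
exact: (integrable_leW (rdecay_measurable df) fC).
Qed.

(** There are finitely many index lists of length at most N. *)
Lemma seq_bound (F : seq 'I_d -> R) N : (forall s, 0 <= F s) ->
  exists2 C : R, 0 <= C & forall s, (size s <= N)%N -> F s <= C.
Proof.
move=> F0; elim: N => [|N [C C0 IH]].
  by exists (F [::]) => // s; rewrite leqn0 => /nilP ->.
exists (C + \sum_(t : N.+1.-tuple 'I_d) F t).
  by rewrite addr_ge0// sumr_ge0.
move=> s; rewrite leq_eqVlt => /orP[|]; last first.
  by rewrite ltnS => /IH h; rewrite (le_trans h)// lerDl sumr_ge0.
move=> sN; pose t := Tuple sN.
rewrite -[F s]/(F t) (bigD1 t)//= addrCA lerDl.
by rewrite addr_ge0// sumr_ge0.
Qed.

Lemma weight_ge (x : 'rV[R]_d) : 1 + dotp x x <= (W x)^-1.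
Proof.
rewrite /W prodfV invrK /dotp.
elim: (index_enum _) => [|i s IH]; first by rewrite !big_nil addr0.
rewrite !big_cons -expr2.
have h : 0 <= \sum_(j <- s) x ord0 j * x ord0 j by apply: sumr_ge0 => j _; rewrite -expr2 sqr_ge0.
apply: (@le_trans _ _ ((1 + x ord0 i ^+ 2) * (1 + \sum_(j <- s) x ord0 j * x ord0 j))).
  have := sqr_ge0 (x ord0 i); move: (_ ^+ 2) (\sum_(_ <- _) _) h => a b h a0; nra.
by rewrite ler_wpM2l// ltW// oneDsq_gt0.
Qed.

Lemma enorm_weight (x : 'rV[R]_d) : 1 + enorm x <= 2 * (W x)^-1.
Proof.
have h := weight_ge x; have d0 := dotpp_ge0 x.
have : enorm x <= 1 + dotp x x.
  rewrite /enorm -(@ler_pXn2r _ 2) ?nnegrE ?sqrtr_ge0 ?addr_ge0// sqr_sqrtr//.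
  by move: (dotp x x) d0 => t; nra.
lra.
Qed.

Lemma normc_le (a b : R) : normc (a +i* b)%C <= `|a| + `|b|.
Proof.
rewrite /normc -(@ler_pXn2r _ 2) ?nnegrE ?sqrtr_ge0 ?addr_ge0//.
rewrite sqr_sqrtr ?addr_ge0 ?sqr_ge0// sqrrD !real_normK ?num_real//.
by rewrite lerD2r lerDl mulrn_wge0// mulr_ge0.
Qed.

Lemma normc_ge_Re (z : R[i]) : `|complex.Re z| <= normc z.
Proof.
case: z => a b /=; rewrite -(@ler_pXn2r _ 2) ?nnegrE ?sqrtr_ge0//.
by rewrite sqr_sqrtr ?addr_ge0 ?sqr_ge0// real_normK ?num_real// lerDl sqr_ge0.
Qed.

Lemma normc_ge_Im (z : R[i]) : `|complex.Im z| <= normc z.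
Proof.
case: z => a b /=; rewrite -(@ler_pXn2r _ 2) ?nnegrE ?sqrtr_ge0//.
by rewrite sqr_sqrtr ?addr_ge0 ?sqr_ge0// real_normK ?num_real// lerDr sqr_ge0.
Qed.

(** The weight of the Schwartz norms satisfies 1 + |x| <= 2 / W(x), see
    [enorm_weight]. *)
Lemma schwartz_norm_le (phi : 'rV[R]_d -> R[i]) N (D : R) :
  (forall s x, (size s <= N)%N -> `|partials s (fun y => complex.Re (phi y)) x| +
     `|partials s (fun y => complex.Im (phi y)) x| <= D * W x ^+ N) ->
  (schwartz_norm N phi <= (2 ^+ N * D)%:E)%E.
Proof.
move=> H; apply: ge_ereal_sup => _ [s [x [sN ->]]]; rewrite lee_fin.
have h1 := le_trans (normc_le _ _) (H s x sN).
have w0 := W_gt0 x.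
have -> : 2 ^+ N * D = (2 * (W x)^-1) ^+ N * (D * W x ^+ N).
  by rewrite exprMn exprVn -mulrA (mulrC D) mulKf ?expf_neq0 ?gt_eqF.
apply: ler_pM => //; rewrite ?exprn_ge0 ?addr_ge0 ?sqrtr_ge0//.
by rewrite lerXn2r ?nnegrE ?addr_ge0 ?sqrtr_ge0 ?enorm_weight// mulr_ge0// invr_ge0 ltW.
Qed.

Lemma rdecay_schwartz (phi : 'rV[R]_d -> R[i]) :
  rdecay (fun y => complex.Re (phi y)) -> rdecay (fun y => complex.Im (phi y)) -> schwartz phi.
Proof.
move=> [su du] [sv dv]; split; first by move=> s x; split; [exact: su|exact: sv].
move=> N.
have /choice[F FP] : forall s, exists C : R, 0 <= C /\
    forall x, `|partials s (fun y => complex.Re (phi y)) x| +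
     `|partials s (fun y => complex.Im (phi y)) x| <= C * W x ^+ N.
  move=> s; have [C C0 CP] := du s N; have [E E0 EP] := dv s N.
  by exists (C + E); split=> [|x]; rewrite ?addr_ge0// mulrDl lerD.
have [C C0 CP] := seq_bound N (fun s => (FP s).1).
apply: (@le_lt_trans _ _ (2 ^+ N * C)%:E); last exact: ltry.
apply: schwartz_norm_le => s x sN; apply: (le_trans ((FP s).2 x)).
by rewrite ler_wpM2r ?exprn_ge0 ?W_ge0// CP.
Qed.

End decay.

Section inversion.
Context {R : realType} {d : nat}.
Implicit Types (a u f g : 'rV[R]_d -> R) (i : 'I_d).
Local Notation mu := (@lebesgue_rV R d).
Local Notation cosn n t := (cos (t + n%:R * (pi / 2))).

Lemma expN1E (e : R) (x : 'rV[R]_d) : expN1 e x = expR (- (e * \sum_i `|x ord0 i|)).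
Proof. by rewrite /expN1 mulr_sumr -sumrN expR_sum. Qed.

Lemma expN1_le1 (e : R) (x : 'rV[R]_d) : 0 <= e -> expN1 e x <= 1.
Proof.
move=> e0; rewrite expN1E -expR0 ler_expR oppr_le0 mulr_ge0//.
exact: sumr_ge0.
Qed.

(** All limits of small parameters are taken along this sequence, which the
    dominated convergence theorem requires. *)
Definition epsn (n : nat) : R := n.+1%:R^-1.

Lemma epsn_gt0 n : 0 < epsn n. Proof. by rewrite invr_gt0. Qed.

Lemma epsn_cvg0 : epsn n @[n --> \oo] --> (0 : R). Proof. exact: cvg_harmonic. Qed.

Lemma cvg_expN1 (x : 'rV[R]_d) : expN1 (epsn n) x @[n --> \oo] --> (1 : R).
Proof.
have H : expR (- (epsn n * \sum_i `|x ord0 i|)) @[n --> \oo] --> expR (- (0 * \sum_i `|x ord0 i|)).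
  have h0 : - (epsn n * \sum_i `|x ord0 i|) @[n --> \oo] --> - (0 * \sum_i `|x ord0 i|).
    by apply: cvgN; apply: cvgMr_tmp; exact: epsn_cvg0.
  exact: (cvg_comp _ _ h0 (@continuous_expR R _)).
rewrite mul0r oppr0 expR0 in H.
by under eq_fun do rewrite expN1E.
Qed.

Lemma poissonk_prod (e : R) (w : 'rV[R]_d) : 0 < e ->
  \prod_i poissonk e (w ord0 i) = e ^- d * 2 ^+ d * W (e^-1 *: w).
Proof.
move=> e0; rewrite -exprVn -exprMn -[X in _ ^+ X](card_ord d) -prodr_const /W -big_split/=.
apply: eq_bigr => i _; rewrite mxE /poissonk; field.
by rewrite gt_eqF//= gt_eqF// ltr_pwDl ?sqr_ge0 ?exprn_gt0.
Qed.

Lemma measurable_affine_cpt a (e : R) (b : 'rV[R]_d) : cpt a ->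
  measurable_fun setT (fun x : 'rV[R]_d => a (e *: x + b)).
Proof.
by move=> ca; apply: (measurableT_comp (cpt_measurable ca)); exact: measurable_affine_rV.
Qed.

(** Rescaling turns the product Poisson kernel into 2^d W. *)
Lemma integral_poisson_scale a (xi : 'rV[R]_d) (e : R) : cpt a -> 0 < e ->
  \int[mu]_t (a t * \prod_i poissonk e ((t - xi) ord0 i)) =
  2 ^+ d * \int[mu]_z (a (e *: z + xi) * W z).
Proof.
move=> ca e0; have e0' : e != 0 by rewrite gt_eqF.
pose f t := a t * W (e^-1 *: (t - xi)).
have fi : mu.-integrable setT (EFin \o f).
  apply: (integrable_mulb (cpt_integrable ca) (C := 1)).
    apply: (measurableT_comp (@measurable_W R d)).
    rewrite (_ : (fun t => _) = fun t : 'rV[R]_d => e^-1 *: t + (- (e^-1 *: xi))); first exact: measurable_affine_rV.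
    by apply/funext => t; rewrite scalerBr.
  by move=> t; rewrite ger0_norm ?W_ge0 ?W_le1.
have := Rintegral_affine_rV xi e0' fi.
rewrite (gtr0_norm e0) /f.
under eq_Rintegral do rewrite addrK scalerA mulVf// scale1r.
move=> ->; rewrite mulrA -RintegralZl//; apply: eq_Rintegral => t _.
by rewrite poissonk_prod//; ring.
Qed.

Lemma cvg_cpt_affine a (b z : 'rV[R]_d) : continuous a ->
  a (epsn n *: z + b) @[n --> \oo] --> a b.
Proof.
move=> ca; have h0 : epsn n *: z + b @[n --> \oo] --> 0 *: z + b.
  apply: cvgD; last exact: cvg_cst.
  by apply: cvgZr_tmp; exact: epsn_cvg0.
rewrite scale0r add0r in h0.
exact: (cvg_comp _ _ h0 (ca b)).
Qed.

(** After rescaling, a(e z + xi) W(z) converges to a(xi) W(z) dominatedly, and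
    the integral of W is pi^d. *)
Lemma integral_poisson_cvg a (xi : 'rV[R]_d) : cpt a ->
  \int[mu]_t (a t * \prod_i poissonk (epsn n) ((t - xi) ord0 i)) @[n --> \oo] -->
  (2 * pi) ^+ d * a xi.
Proof.
move=> ca; have [C C0 aC] := cpt_bounded ca.
have -> : (2 * pi) ^+ d * a xi = 2 ^+ d * \int[mu]_z (a xi * W z).
  by rewrite RintegralZl ?Rintegral_W ?exprMn//; [ring|exact: integrable_W].
under eq_fun do rewrite integral_poisson_scale ?epsn_gt0//.
apply: cvgMl_tmp; apply: (Rintegral_dct (g := fun z => C * W z)).
- move=> n; apply: measurable_funM; last exact: measurable_W.
  exact: measurable_affine_cpt.
- exact: (integrableZl measurableT C (@integrable_W R d)).
- by move=> n z; rewrite normrM (ger0_norm (W_ge0 _)) ler_wpM2r ?W_ge0.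
- move=> z; apply: cvgMr_tmp; apply: cvg_cpt_affine.
  by case: ca => sa _; exact: rsmooth_cont.
Qed.

(** Fourier inversion, symmetrized in xi because only the cosine transform
    occurs. The integral is approximated by inserting exp(- e |x|_1); for
    fixed e > 0 Fubini applies, and the inner integral is a Poisson kernel
    centred at xi and at - xi. *)
Lemma osc_inversion a (xi : 'rV[R]_d) : cpt a ->
  \int[mu]_x (osc a 0 x * cos (dotp x xi)) = (2 * pi) ^+ d * ((a xi + a (- xi)) / 2).
Proof.
move=> ca.
have da := rdecay_osc 0 ca; have ai := rdecay_integrable da.
pose I n := \int[mu]_x (expN1 (epsn n) x * (osc a 0 x * cos (dotp x xi))).
have mc := measurable_phase xi 0.
have mcos : measurable_fun setT (fun x : 'rV[R]_d => cos (dotp x xi)).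
  apply: measurable_cosR; exact: measurable_dotpl.
have c1 : I n @[n --> \oo] --> \int[mu]_x (osc a 0 x * cos (dotp x xi)).
  apply: (Rintegral_dct (g := fun x => `|osc a 0 x|)).
  - move=> n; apply: measurable_funM; first exact: measurable_expN1.
    by apply: measurable_funM => //; exact: rdecay_measurable.
  - exact: integrable_norm.
  - move=> n x; rewrite !normrM (ger0_norm (expN1_ge0 _ _)).
    rewrite -[leRHS]mul1r ler_pM ?expN1_ge0 ?mulr_ge0 ?expN1_le1 ?(ltW (epsn_gt0 _))//.
    by rewrite ler_piMr// cos_le1_norm.
  - move=> x; rewrite -[X in _ --> X]mul1r; apply: cvgMr_tmp; exact: cvg_expN1.
have c2 : I n @[n --> \oo] --> (2 * pi) ^+ d * ((a xi + a (- xi)) / 2).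
  have E n : I n = 2^-1 * (\int[mu]_t (a t * \prod_i poissonk (epsn n) ((t - xi) ord0 i)) +
      \int[mu]_t (a t * \prod_i poissonk (epsn n) ((t - - xi) ord0 i))).
    have e0 := epsn_gt0 n.
    have fi : mu.-integrable setT (EFin \o (fun x => expN1 (epsn n) x * cos (dotp x xi))).
      by apply: (integrable_expN1 e0 mcos (C := 1)) => x; exact: cos_le1_norm.
    have qi w : mu.-integrable setT (EFin \o (fun x => expN1 (epsn n) x * cos (dotp x w))).
      apply: (integrable_expN1 e0 (C := 1)) => [|x]; last exact: cos_le1_norm.
      by apply: measurable_cosR; exact: measurable_dotpl.
    have mk : measurable_fun setT (fun u : 'rV[R]_d * 'rV[R]_d => cosn 0 (dotp u.1 u.2)).
      apply: measurable_cosR; apply: measurable_funD => //.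
      by apply: measurable_dotp; [exact: measurable_fst|exact: measurable_snd].
    pose k0 (u : 'rV[R]_d * 'rV[R]_d) : R := cosn 0 (dotp u.1 u.2).
    have k1 w : `|k0 w| <= 1 by exact: cos_le1_norm.
    have F := Fubini_mulb fi (cpt_integrable ca) (mk : measurable_fun setT k0) k1.
    have -> : I n = \int[mu]_x (expN1 (epsn n) x * cos (dotp x xi) *
       \int[mu]_y (a y * cosn 0 (dotp x y))).
      by apply: eq_Rintegral => x _; rewrite /osc; ring.
    rewrite {}F /k0 /=.
    have pi1 (v : 'rV[R]_d) : mu.-integrable setT (EFin \o (fun t => a t * \prod_i poissonk (epsn n) ((t - v) ord0 i))).
      apply: (integrable_mulb (cpt_integrable ca) (C := epsn n ^- d * 2 ^+ d)).
        rewrite (_ : (fun _ => _) = fun t => epsn n ^- d * 2 ^+ d * W ((epsn n)^-1 *: t + (epsn n)^-1 *: - v)); last first.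
          by apply/funext => t; rewrite poissonk_prod// scalerDr.
        apply: measurable_funM => //; apply: (measurableT_comp (@measurable_W R d)).
        exact: measurable_affine_rV.
      move=> t; rewrite poissonk_prod// normrM (ger0_norm (W_ge0 _)).
      rewrite ger0_norm ?mulr_ge0 ?invr_ge0 ?exprn_ge0 ?(ltW e0)//.
      by rewrite ler_piMr ?W_le1// mulr_ge0 ?invr_ge0 ?exprn_ge0 ?(ltW e0).
    rewrite -RintegralD// -RintegralZl//; last exact: (integrableD measurableT (pi1 xi) (pi1 (- xi))).
    apply: eq_Rintegral => t _; rewrite -!(Rintegral_poisson_rV e0).
    rewrite -mulrDr [RHS]mulrCA; congr (_ * _).
    rewrite -RintegralD// -RintegralZl//; last exact: (integrableD measurableT (qi _) (qi _)).
    apply: eq_Rintegral => x _; rewrite mul0r addr0 opprK.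
    rewrite (dotpC x t) (dotpC x xi) (dotpC x (t - xi)) (dotpC x (t + xi)) !dotpDl.
    rewrite (_ : dotp (- xi) x = - dotp xi x); last by rewrite -scaleN1r dotpZl mulN1r.
    by rewrite cosB cosD; field.
  rewrite (_ : (2 * pi) ^+ d * _ = 2^-1 * ((2 * pi) ^+ d * a xi + (2 * pi) ^+ d * a (- xi))); last first.
    by field.
  under eq_fun do rewrite E.
  by apply: cvgMl_tmp; apply: cvgD; exact: integral_poisson_cvg.
exact: (cvg_unique _ c1 c2).
Qed.

End inversion.

(** * Functions with compact spectrum *)

Section membership.
Context {R : realType} {d : nat}.
Implicit Types (a u v f g : 'rV[R]_d -> R) (i : 'I_d).
Local Notation mu := (@lebesgue_rV R d).
Local Notation cosn n t := (cos (t + n%:R * (pi / 2))).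

Lemma dotp_le_norm (x : 'rV[R]_d) : dotp x x <= d%:R * `|x| ^+ 2.
Proof.
rewrite /dotp; apply: (@le_trans _ _ (\sum_(i < d) `|x| ^+ 2)); last first.
  by rewrite sumr_const card_ord mulr_natl.
apply: ler_sum => i _; rewrite -expr2 -[x ord0 i ^+ 2]real_normK ?num_real//.
rewrite lerXn2r ?nnegrE// /Num.norm /= mx_normrE.
exact: (le_bigmax _ (fun ij => `|x ij.1 ij.2|) (ord0, i)).
Qed.

Lemma test_cpt phi : test_function phi ->
  cpt (fun x : 'rV[R]_d => complex.Re (phi x)) /\ cpt (fun x => complex.Im (phi x)).
Proof.
move=> [sphi /compact_bounded[M [_ MP]]].
have z0 x : d%:R * (`|M| + 1) ^+ 2 + 1 <= dotp x x -> phi x = 0.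
  move=> h; apply/eqP/negPn/negP => p0.
  have : `|x| <= `|M| + 1.
    apply: MP; first by rewrite (le_lt_trans (ler_norm M))// ltrDl.
    by apply: subset_closure.
  move=> xM; have := dotp_le_norm x; apply/negP; rewrite -ltNge.
  apply: lt_le_trans h; apply: (@le_lt_trans _ _ (d%:R * (`|M| + 1) ^+ 2)); last by rewrite ltrDl.
  by rewrite ler_wpM2l// lerXn2r ?nnegrE// addr_ge0.
split; (split; first by move=> s x; have [? ?] := sphi s x).
  by exists (d%:R * (`|M| + 1) ^+ 2 + 1) => x /z0 ->.
by exists (d%:R * (`|M| + 1) ^+ 2 + 1) => x /z0 ->.
Qed.

Lemma cpt_test u v : cpt u -> cpt v -> test_function (fun x => (u x +i* v x)%C).
Proof.
move=> [su [r ur]] [sv [s vs]]; split; first by move=> t x; split; [exact: su|exact: sv].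
apply: (subclosed_compact (@closed_closure _ _) (@compact_dotp R d (Num.max r s))).
have cl : closed [set x : 'rV[R]_d | dotp x x <= Num.max r s].
  apply: (@closed_comp _ _ (fun x : 'rV[R]_d => dotp x x) [set t | t <= Num.max r s]).
    by move=> x _; exact: (rsmooth_cont rsmooth_dotpp).
  exact: closed_le.
apply: (subset_trans (B := closure [set x : 'rV[R]_d | dotp x x <= Num.max r s])).
  apply: closureS => x /=; apply: contraNT; rewrite -ltNge gt_max => /andP[/ltW r1 /ltW r2].
  by rewrite ur// vs// eq_complex /= eqxx.
by rewrite -(closure_id _).1.
Qed.

Lemma fourierE phi (xi : 'rV[R]_d) : fourier phi xi =
  (\int[mu]_x (complex.Re (phi x) * cos (dotp x xi) + complex.Im (phi x) * sin (dotp x xi))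
   +i* \int[mu]_x (complex.Im (phi x) * cos (dotp x xi) - complex.Re (phi x) * sin (dotp x xi)))%C.
Proof.
rewrite /fourier /cintegral; congr (_ +i* _)%C; apply: eq_Rintegral => x _;
  by case: (phi x) => a b /=; ring.
Qed.

(** Combined with [osc_decay], this shows that test functions have Schwartz
    Fourier transforms. *)
Lemma fourier_osc phi (xi : 'rV[R]_d) : test_function phi ->
  let u x := complex.Re (phi x) in let v x := complex.Im (phi x) in
  fourier phi xi = ((osc u 0 xi - osc v 1 xi) +i* (osc v 0 xi + osc u 1 xi))%C.
Proof.
move=> /test_cpt[cu cv] u v; rewrite fourierE /osc; congr (_ +i* _)%C.
  rewrite -RintegralB//; try exact: integrable_osc.
  apply: eq_Rintegral => x _; rewrite mul0r addr0 mul1r cosDpihalf dotpC /u /v; ring.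
rewrite -RintegralD//; try exact: integrable_osc.
apply: eq_Rintegral => x _; rewrite mul0r addr0 mul1r cosDpihalf dotpC /u /v; ring.
Qed.

Lemma cintegral_real f (psi : 'rV[R]_d -> R[i]) : cintegral mu (fun x => (f x)%:C%C * psi x) =
  (\int[mu]_x (f x * complex.Re (psi x)) +i* \int[mu]_x (f x * complex.Im (psi x)))%C.
Proof.
by rewrite /cintegral; congr (_ +i* _)%C; apply: eq_Rintegral => x _;
  case: (psi x) => a b /=; ring.
Qed.

Lemma schwartz_bounded (psi : 'rV[R]_d -> R[i]) : schwartz psi ->
  exists2 C : R, schwartz_norm 0 psi = C%:E & forall x, normc (psi x) <= C.
Proof.
move=> [_ /(_ 0%N) h].
have g0 x : ((normc (psi x))%:E <= schwartz_norm 0 psi)%E.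
  apply: ereal_sup_ubound => /=; exists [::], x; split => //.
  by rewrite expr0 mul1r /cpartials /=; case: (psi x).
have fn : schwartz_norm 0 psi \is a fin_num.
  by rewrite ge0_fin_numE//; apply: le_trans (g0 0); rewrite lee_fin; case: (psi 0) => a b; rewrite sqrtr_ge0.
exists (fine (schwartz_norm 0 psi)); first by rewrite fineK.
by move=> x; rewrite -lee_fin fineK.
Qed.

(** The distribution defined by an integrable f is tempered. On the Fourier
    transform of a test function u its value is, by Fubini, the integral of u
    against the Fourier transform of f, which vanishes on the support of u
    when that support is disjoint from the ball containing the spectrum of f.
    *)
Lemma E_space_real (rho : R) f : rsmooth f -> mu.-integrable setT (EFin \o f) ->
  (forall n (xi : 'rV[R]_d), rho < enorm xi -> \int[mu]_x (f x * cosn n (dotp x xi)) = 0) ->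
  E_space rho (fun x => (f x)%:C%C).
Proof.
move=> sf fi f0.
have fm (psi : 'rV[R]_d -> R[i]) : schwartz psi ->
    mu.-integrable setT (EFin \o (fun x => f x * complex.Re (psi x))) /\
    mu.-integrable setT (EFin \o (fun x => f x * complex.Im (psi x))).
  move=> spsi; have [C _ CP] := schwartz_bounded spsi; case: spsi => spsi _.
  split; apply: (integrable_mulb fi (C := C)).
  - by apply: continuous_measurable_rV; apply: rsmooth_cont => s x; have [] := spsi s x.
  - by move=> x; rewrite (le_trans _ (CP x))// normc_ge_Re.
  - by apply: continuous_measurable_rV; apply: rsmooth_cont => s x; have [] := spsi s x.
  - by move=> x; rewrite (le_trans _ (CP x))// normc_ge_Im.
split.
  move=> s x; split; first exact: sf.
  rewrite (_ : (fun _ => _) = cst 0)//; exact: (rsmooth_cst 0).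
exists (fun psi => cintegral mu (fun x => (f x)%:C%C * psi x)); split.
- split.
    move=> [a1 a2] phi psi sphi spsi; rewrite !cintegral_real.
    have [p1 p2] := fm _ sphi; have [q1 q2] := fm _ spsi.
    apply/eqP; rewrite eq_complex /=; apply/andP; split; apply/eqP.
      rewrite -!RintegralZl// -RintegralB//; last first.
      + by apply: (integrableZl measurableT a2 p2).
      + by apply: (integrableZl measurableT a1 p1).
      rewrite -RintegralD//.
        by apply: eq_Rintegral => x _; case: (phi x) (psi x) => ? ? [? ?] /=; ring.
      exact: (integrableB measurableT (integrableZl measurableT a1 p1) (integrableZl measurableT a2 p2)).
    rewrite -!RintegralZl// -RintegralD//; last first.
    + by apply: (integrableZl measurableT a2 p1).
    + by apply: (integrableZl measurableT a1 p2).
    rewrite -RintegralD//.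
      by apply: eq_Rintegral => x _; case: (phi x) (psi x) => ? ? [? ?] /=; ring.
    exact: (integrableD measurableT (integrableZl measurableT a1 p2) (integrableZl measurableT a2 p1)).
  exists 0%N, (2 * \int[mu]_x `|f x|) => psi spsi; rewrite cintegral_real.
  have [C -> CP] := schwartz_bounded spsi; rewrite -EFinM lee_fin.
  have [p1 p2] := fm _ spsi; apply: (le_trans (normc_le _ _)).
  have nf := integrable_norm fi.
  rewrite -mulrA mulr_natl mulr2n -RintegralZr//; apply: lerD.
    apply: (le_trans (le_normr_Rintegral measurableT p1)); apply: le_Rintegral => //.
    + exact: (integrable_norm p1).
    + by apply: (integrable_mulb nf (g := cst C) (C := `|C|)).
    by move=> x _; rewrite normrM ler_wpM2l// (le_trans (normc_ge_Re _)).
  apply: (le_trans (le_normr_Rintegral measurableT p2)); apply: le_Rintegral => //.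
  + exact: (integrable_norm p2).
  + by apply: (integrable_mulb nf (g := cst C) (C := `|C|)).
  by move=> x _; rewrite normrM ler_wpM2l// (le_trans (normc_ge_Im _)).
- move=> phi tphi sup; rewrite /fourier_distribution.
  rewrite (_ : fourier phi = fun xi => fourier phi xi)// (funext (fun xi => fourier_osc xi tphi)).
  rewrite cintegral_real /=; have [cu cv] := test_cpt tphi.
  have out xi : enorm xi <= rho -> phi xi = 0.
    move=> h; apply/eqP/negPn/negP => p0.
    suff : (closure [set x | phi x != 0] `&` [set xi | enorm xi <= rho]) xi by rewrite sup.
    by split => //; exact: subset_closure.
  have Z w n : cpt w -> (forall xi, enorm xi <= rho -> w xi = 0) ->
      \int[mu]_x (f x * osc w n x) = 0.
    move=> cw w0; rewrite /osc.
    pose k0 (z : 'rV[R]_d * 'rV[R]_d) : R := cosn n (dotp z.1 z.2).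
    have mk : measurable_fun setT k0.
      apply: measurable_cosR; apply: measurable_funD => //.
      by apply: measurable_dotp; [exact: measurable_fst|exact: measurable_snd].
    have k1 z : `|k0 z| <= 1 by exact: cos_le1_norm.
    rewrite (Fubini_mulb fi (cpt_integrable cw) mk k1) /k0 /=.
    transitivity (\int[mu]_x (cst (0 : R) x)); last by rewrite Rintegral_cst// mul0r.
    apply: eq_Rintegral => xi _ /=.
    by have [/w0 ->|/f0 ->] := leP (enorm xi) rho; rewrite ?mul0r ?mulr0.
  have ou xi : enorm xi <= rho -> complex.Re (phi xi) = 0 by move=> /out ->.
  have ov xi : enorm xi <= rho -> complex.Im (phi xi) = 0 by move=> /out ->.
  have oi w n : cpt w -> mu.-integrable setT (EFin \o (fun x => f x * osc w n x)).
    move=> cw; have [C _ CP] := osc_bounded n cw.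
    by apply: (integrable_mulb fi (C := C)) => //; exact: (rdecay_measurable (rdecay_osc n cw)).
  apply/eqP; rewrite eq_complex /=; apply/andP; split; apply/eqP.
    under eq_Rintegral do rewrite mulrBr.
    by rewrite RintegralB ?Z ?subrr//; exact: oi.
  under eq_Rintegral do rewrite mulrDr.
  by rewrite RintegralD ?Z ?addr0//; exact: oi.
- move=> phi sphi; split => //; have [p1 p2] := fm _ sphi.
  rewrite /cintegrable; split.
    rewrite (_ : (fun x => _) = EFin \o (fun x => f x * complex.Re (phi x)))//.
    by apply/funext => x /=; case: (phi x) => ? ? /=; rewrite mul0r subr0.
  rewrite (_ : (fun x => _) = EFin \o (fun x => f x * complex.Im (phi x)))//.
  by apply/funext => x /=; case: (phi x) => ? ? /=; rewrite mul0r addr0.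
Qed.

End membership.

(** * The reproducing kernel and its packets *)

Section kernel.
Context {R : realType} {d : nat}.
Implicit Types (a f g : 'rV[R]_d -> R) (i : 'I_d).
Local Notation mu := (@lebesgue_rV R d).
Local Notation cosn n t := (cos (t + n%:R * (pi / 2))).

(** By [integral_kern_phase] the Fourier transform of kern is bump, so
    convolution with kern reproduces the functions with spectrum in the unit
    ball. *)
Definition kern (x : 'rV[R]_d) : R := (2 * pi) ^- d * osc bump 0 x.

Lemma cpt_bump : cpt (@bump R d).
Proof. by split; [exact: rsmooth_bump|exists 2; exact: bump0]. Qed.

Lemma rdecay_kern : rdecay kern.
Proof. exact/rdecayZ/rdecay_osc/cpt_bump. Qed.

Lemma osc0N a (x : 'rV[R]_d) : osc a 0 (- x) = osc a 0 x.
Proof.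
apply: eq_Rintegral => t _; rewrite !mul0r !addr0.
by rewrite (_ : dotp (- x) t = - dotp x t) ?cosN// -scaleN1r dotpZl mulN1r.
Qed.

Lemma Rintegral_odd f : mu.-integrable setT (EFin \o f) -> (forall x, f (- x) = - f x) ->
  \int[mu]_x f x = 0.
Proof.
move=> fi fN; have := @Rintegral_affine_rV R d (-1) 0 f.
rewrite normrN1 expr1n invr1 mul1r => h.
have := h ltac:(by rewrite oppr_eq0 oner_eq0) fi.
under eq_Rintegral do rewrite scaleN1r addr0 fN -mulN1r.
by rewrite RintegralZl// mulN1r => h'; lra.
Qed.

Lemma integrable_kern_cos (xi : 'rV[R]_d) (t : R) :
  mu.-integrable setT (EFin \o (fun y => kern y * cos (dotp y xi + t))).
Proof.
apply: (integrable_mulb (rdecay_integrable rdecay_kern) (C := 1)).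
  apply: measurable_cosR; apply: measurable_funD => //; exact: measurable_dotpl.
by move=> x; exact: cos_le1_norm.
Qed.

(** The value of the Fourier transform of kern at xi, with an arbitrary phase
    t: the sine part vanishes because kern is even. *)
Lemma integral_kern_phase (xi : 'rV[R]_d) (t : R) :
  \int[mu]_y (kern y * cos (dotp y xi + t)) = bump xi * cos t.
Proof.
have ps : (2 * pi) ^+ d != 0 :> R by rewrite expf_neq0// mulf_neq0// gt_eqF// pi_gt0.
have ci : \int[mu]_y (kern y * cos (dotp y xi)) = bump xi.
  under eq_Rintegral do rewrite /kern -mulrA.
  rewrite RintegralZl//; last first.
    have oi := rdecay_integrable (rdecay_osc 0 cpt_bump).
    apply: (integrable_mulb oi (C := 1)) => [|x]; last exact: cos_le1_norm.
    by apply: measurable_cosR; exact: measurable_dotpl.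
  by rewrite osc_inversion; [rewrite bumpN; field|exact: cpt_bump].
have si : mu.-integrable setT (EFin \o (fun y => kern y * sin (dotp y xi))).
  rewrite (_ : (fun y => _) = fun y => kern y * cos (dotp y xi + - (pi / 2))); first exact: integrable_kern_cos.
  by apply/funext => y; rewrite cosB cos_pihalf sin_pihalf mulr0 mulr1 add0r.
have s0 : \int[mu]_y (kern y * sin (dotp y xi)) = 0.
  apply: Rintegral_odd => // y; rewrite /kern osc0N.
  by rewrite (_ : dotp (- y) xi = - dotp y xi) ?sinN ?mulrN// -scaleN1r dotpZl mulN1r.
have cii : mu.-integrable setT (EFin \o (fun y => kern y * cos (dotp y xi))).
  rewrite (_ : (fun y => _) = fun y => kern y * cos (dotp y xi + 0)); first exact: integrable_kern_cos.
  by apply/funext => y; rewrite addr0.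
transitivity (\int[mu]_y (cos t * (kern y * cos (dotp y xi)) - sin t * (kern y * sin (dotp y xi)))).
  by apply: eq_Rintegral => y _; rewrite cosD; ring.
rewrite RintegralB//; last 2 first.
- by apply: (integrableZl measurableT (cos t) cii).
- by apply: (integrableZl measurableT (sin t) si).
by rewrite !RintegralZl// s0 mulr0 subr0 ci mulrC.
Qed.

Lemma integral_kern : \int[mu]_y kern y = 1.
Proof.
have := integral_kern_phase 0 0.
have d0 : forall y : 'rV[R]_d, dotp y 0 = 0 by move=> y; rewrite /dotp big1// => i _; rewrite mxE mulr0.
rewrite cos0 mulr1 bump1 ?d0; last by lra.
by under eq_Rintegral do rewrite d0 addr0 cos0 mulr1.
Qed.

Lemma dotpBl (x y z : 'rV[R]_d) : dotp (x - y) z = dotp x z - dotp y z.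
Proof. by rewrite dotpDl -scaleN1r dotpZl mulN1r. Qed.

Lemma dotp_scaleV (r : R) (x y : 'rV[R]_d) : r != 0 -> dotp (r *: x) (r^-1 *: y) = dotp x y.
Proof. by move=> r0; rewrite dotpZl dotpC dotpZl dotpC mulrA mulfV// mul1r. Qed.

(** For the random packets the translations b j are the negatives of lattice
    points, and the coefficients c j are 0, 1 or -1. *)
Definition packet (I : Type) (s : seq I) (c : I -> R) (b : I -> 'rV[R]_d) (r : R) : 'rV[R]_d -> R :=
  fun x => \sum_(j <- s) c j * kern (r *: x + b j).

Lemma rdecay_packet (I : Type) (s : seq I) c b (r : R) : r != 0 -> rdecay (@packet I s c b r).
Proof.
move=> r0; rewrite /packet; elim: s => [|j s IH].
  rewrite (_ : (fun x => _) = cst 0); first exact: rdecay_cst0.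
  by apply/funext => x; rewrite big_nil.
rewrite (_ : (fun x => _) = (fun x => c j * kern (r *: x + b j)) \+ (fun x => \sum_(j <- s) c j * kern (r *: x + b j))).
  apply: rdecayD => //; apply: rdecayZ; exact/rdecay_affine/rdecay_kern.
by apply/funext => x; rewrite big_cons.
Qed.

(** The Fourier transform of kern (r x + b) is supported where bump (xi / r)
    is nonzero, that is in |xi| <= sqrt 2 r, which is inside the ball of
    radius 2 r. *)
Lemma E_packet (I : Type) (s : seq I) c b (r : R) : 0 < r ->
  E_space (2 * r) (fun x => (@packet I s c b r x)%:C%C).
Proof.
move=> r0; have rn0 : r != 0 by rewrite gt_eqF.
have dp := rdecay_packet s c b rn0.
apply: E_space_real; [by case: dp|exact: rdecay_integrable|] => n xi xir.
pose F j (x : 'rV[R]_d) := c j * (kern (r *: x + b j) * cosn n (dotp x xi)).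
pose G j (y : 'rV[R]_d) := kern y * cos (dotp y (r^-1 *: xi) + (- dotp (b j) (r^-1 *: xi) + n%:R * (pi / 2))).
have FG j : F j = fun x => c j * G j (r *: x + b j).
  apply/funext => x; rewrite /F /G; congr (_ * (_ * cos _)).
  by rewrite dotpDl dotp_scaleV//; ring.
have Gi j : mu.-integrable setT (EFin \o G j) by exact: integrable_kern_cos.
have Gi' j : mu.-integrable setT (EFin \o (fun x => G j (r *: x + b j))) by exact: integrable_affine_rV.
have Fi j : mu.-integrable setT (EFin \o F j).
  by rewrite FG; apply: (integrableZl measurableT (c j) (Gi' j)).
transitivity (\int[mu]_x (\sum_(j <- s) F j x)).
  apply: eq_Rintegral => x _; rewrite /packet mulr_suml; apply: eq_bigr => j _.
  by rewrite -mulrA.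
rewrite (Rintegral_sum s Fi).2 big1// => j _; rewrite FG RintegralZl//.
rewrite (Rintegral_affine_rV (b j) rn0 (Gi j)) /G integral_kern_phase bump0 ?mul0r ?mulr0//.
rewrite dotpZl dotpC dotpZl mulrA -invfM -expr2 mulrC ler_pdivlMr ?exprn_gt0//.
have : (2 * r) ^+ 2 < dotp xi xi.
  rewrite -[ltRHS]sqr_sqrtr ?dotpp_ge0// ltrXn2r ?nnegrE ?sqrtr_ge0//.
  by rewrite ltW// mulr_gt0.
by rewrite exprMn => h; have := exprn_gt0 2 r0; nra.
Qed.

End kernel.

(** * Bandlimited functions *)

Section reproducing.
Context {R : realType} {d : nat}.
Implicit Types (a k f g : 'rV[R]_d -> R) (i : 'I_d).
Local Notation mu := (@lebesgue_rV R d).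
Local Notation cosn n t := (cos (t + n%:R * (pi / 2))).
Local Notation Phi := (osc (@bump R d) 0).

(** What the reproducing formula needs to know about the real and imaginary
    part k of a member of E(1). The field [bl_tempered] is the continuity of
    the distribution in terms of the weight W, and [bl_scale] is the support
    condition, in the only instances that are used: the spectrum of k does not
    see whether a frequency cutoff is at scale 1 or at the larger scale 1 / e.
    *)
Record bandlimited k : Prop := Bandlimited {
  bl_smooth : rsmooth k;
  bl_integrable : forall g, rdecay g -> mu.-integrable setT (EFin \o (fun y => k y * g y));
  bl_tempered : exists N (C : R), forall g D, rdecay g ->
    (forall s x, (size s <= N)%N -> `|partials s g x| <= D * W x ^+ N) ->
    `|\int[mu]_y (k y * g y)| <= C * D;
  bl_scale : forall (x : 'rV[R]_d) e, 0 < e -> e <= 1 ->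
    \int[mu]_y (k y * Phi (x - y)) = \int[mu]_y (k y * (e ^- d * Phi (e^-1 *: (x - y)))) }.

(** Dilation of the cutoff in frequency is inverse dilation of its transform,
    normalized in L^1. *)
Lemma osc_dilate (e : R) (x : 'rV[R]_d) : 0 < e ->
  osc (fun xi : 'rV[R]_d => bump (e *: xi)) 0 x = e ^- d * Phi (e^-1 *: x).
Proof.
move=> e0; have en0 : e != 0 by rewrite gt_eqF.
rewrite /osc -[X in X ^- d](gtr0_norm e0).
rewrite -(Rintegral_affine_rV (f := fun t => bump t * cosn 0 (dotp (e^-1 *: x) t)) 0 en0); last exact/integrable_osc/cpt_bump.
apply: eq_Rintegral => t _; rewrite addr0; congr (_ * cos _).
by rewrite dotpZl [dotp x (_ *: _)]dotpC dotpZl dotpC mulKf.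
Qed.

Lemma cpt_dilate a (e : R) : 0 < e -> cpt a -> cpt (fun x => a (e *: x)).
Proof.
move=> e0 [sa [rho ar]]; split.
  rewrite (_ : (fun x => _) = fun x => a (e *: x + 0)); first exact: rsmooth_affine.
  by apply/funext => x; rewrite addr0.
exists (rho / e ^+ 2) => x; rewrite ler_pdivrMr ?exprn_gt0// => h; apply: ar.
by rewrite dotpZl dotpC dotpZl mulrA -expr2 mulrC.
Qed.

(** For the last field the distribution is applied to the transform of the
    test function exp(i x.xi) (bump xi - bump (e xi)), which vanishes near the
    closed unit ball because both bumps equal 1 there; its transform at y is
    Phi(x - y) - e^-d Phi((x - y) / e). *)
Lemma bandlimitedP K : E_space 1 K ->
  bandlimited (fun x => complex.Re (K x)) /\ bandlimited (fun x => complex.Im (K x)).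
Proof.
move=> [sK [T [[_ [N [C TC]]] sT rT]]].
have rz : rdecay (fun _ : 'rV[R]_d => 0) by exact: rdecay_cst0.
have rg g : rdecay g -> schwartz (fun x => (g x)%:C%C).
  by move=> dg; exact: rdecay_schwartz.
have re g : (fun x => complex.Re (K x * (g x)%:C%C)) = (fun x => complex.Re (K x) * g x).
  by apply/funext => x; case: (K x) => a b /=; ring.
have im g : (fun x => complex.Im (K x * (g x)%:C%C)) = (fun x => complex.Im (K x) * g x).
  by apply/funext => x; case: (K x) => a b /=; ring.
have ig g : rdecay g -> mu.-integrable setT (EFin \o (fun x => complex.Re (K x) * g x)) /\
    mu.-integrable setT (EFin \o (fun x => complex.Im (K x) * g x)).
  move=> /rg /rT[[h1 h2] _]; split.
    rewrite (_ : EFin \o _ = fun x => (complex.Re (K x * (g x)%:C%C))%:E)//.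
    by apply/funext => x /=; rewrite (congr1 (fun f => f x) (re g)).
  rewrite (_ : EFin \o _ = fun x => (complex.Im (K x * (g x)%:C%C))%:E)//.
  by apply/funext => x /=; rewrite (congr1 (fun f => f x) (im g)).
have Tg g : rdecay g -> T (fun x => (g x)%:C%C) =
    (\int[mu]_x (complex.Re (K x) * g x) +i* \int[mu]_x (complex.Im (K x) * g x))%C.
  by move=> /rg /rT[_ ->]; rewrite /cintegral re im.
have bd : exists N (C : R), forall g D, rdecay g ->
    (forall s x, (size s <= N)%N -> `|partials s g x| <= D * W x ^+ N) ->
    normc (T (fun x => (g x)%:C%C)) <= C * D.
  exists N, (`|C| * 2 ^+ N) => g D dg gD.
  have := TC _ (rg _ dg); have : (schwartz_norm N (fun x => (g x)%:C%C) <= (2 ^+ N * D)%:E)%E.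
    apply: schwartz_norm_le => s x sN /=.
    by rewrite -[fun=> 0]/(cst 0) partials_cst /= mul0rn normr0 addr0 gD.
  move=> h1 h2; rewrite -lee_fin; apply: (le_trans h2).
  apply: (@le_trans _ _ (`|C|%:E * schwartz_norm N (fun x => (g x)%:C%C))%E).
    apply: lee_wpmul2r; last by rewrite lee_fin ler_norm.
    apply: le_trans (_ : ((1 + enorm (0 : 'rV[R]_d)) ^+ N * normc (cpartials [::] (fun x => (g x)%:C%C) 0))%:E <= _)%E.
      rewrite lee_fin mulr_ge0 ?exprn_ge0 ?addr_ge0 ?sqrtr_ge0//.
    by apply: ereal_sup_ubound; exists [::], 0.
  by rewrite -mulrA EFinM lee_wpmul2l// lee_fin.
have dP (x : 'rV[R]_d) (e : R) : e != 0 -> rdecay (fun y => Phi (e^-1 *: (x - y))).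
  move=> e0; rewrite (_ : (fun y => _) = fun y => Phi ((- e^-1) *: y + e^-1 *: x)).
    by apply: rdecay_affine; [rewrite oppr_eq0 invr_eq0|exact/rdecay_osc/cpt_bump].
  by apply/funext => y; rewrite scalerBr scaleNr addrC.
have dP1 (x : 'rV[R]_d) : rdecay (fun y => Phi (x - y)).
  rewrite (_ : (fun y => _) = fun y => Phi (1^-1 *: (x - y))); first by apply: dP; rewrite oner_eq0.
  by apply/funext => y; rewrite invr1 scale1r.
have sc (x : 'rV[R]_d) e : 0 < e -> e <= 1 ->
    T (fun y => (Phi (x - y))%:C%C) = T (fun y => (e ^- d * Phi (e^-1 *: (x - y)))%:C%C).
  move=> e0 e1; apply/eqP; rewrite -subr_eq0; apply/eqP.
  pose b (xi : 'rV[R]_d) := bump xi + - bump (e *: xi) : R.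
  have cb1 := @cpt_bump R d; have cb2 := cptN (cpt_dilate e0 cb1).
  have cb : cpt b := cptD cb1 cb2.
  pose u (xi : 'rV[R]_d) := cosn 0 (dotp x xi) * b xi.
  pose v (xi : 'rV[R]_d) := - cosn 1 (dotp x xi) * b xi.
  have cu : cpt u by exact: (cptM (rsmooth_phase x 0) cb).
  have cv : cpt v.
    rewrite (_ : v = fun xi => - (cosn 1 (dotp x xi) * b xi)).
      exact/cptN/(cptM (rsmooth_phase x 1) cb).
    by apply/funext => xi; rewrite /v mulNr.
  have tf := cpt_test cu cv.
  have F y : fourier (fun xi => (u xi +i* v xi)%C) y =
      (Phi (x - y) - e ^- d * Phi (e^-1 *: (x - y)))%:C%C.
    rewrite fourierE /=; congr (_ +i* _)%C.
      rewrite -osc_dilate// /osc -RintegralB//; try exact: integrable_osc.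
        apply: eq_Rintegral => t _; rewrite /u /v /b !mul0r !addr0 mul1r cosDpihalf.
        by rewrite dotpBl cosB [dotp y t]dotpC; ring.
      exact/integrable_osc/cpt_dilate.
    apply: Rintegral_odd => [|t].
      rewrite (_ : (fun t => _) = fun t => b t * sin (dotp t (x - y))).
        apply: (integrable_mulb (cpt_integrable cb) (C := 1)).
          apply: (measurableT_comp (f := (@sin R : measurableTypeR R -> measurableTypeR R))); last exact: measurable_dotpl.
          by apply: continuous_measurable_fun; exact: continuous_sin.
        by move=> t; rewrite ler_norml sin_le1 sin_geN1.
      apply/funext => t; rewrite /u /v mul0r addr0 mul1r cosDpihalf.
      by rewrite [dotp t (x - y)]dotpC dotpBl sinB [dotp y t]dotpC; ring.
    have bN : b (- t) = b t by rewrite /b scalerN !bumpN.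
    have h2 : dotp (- t) y = - dotp t y by rewrite -scaleN1r dotpZl mulN1r.
    have h1 : dotp x (- t) = - dotp x t by rewrite dotpC -scaleN1r dotpZl mulN1r dotpC.
    rewrite /u /v bN h1 h2 !mul0r !addr0 !mul1r !cosDpihalf !sinN !cosN.
    move: (b t) (cos (dotp x t)) (sin (dotp x t)) (cos (dotp t y)) (sin (dotp t y)) => z1 z2 z3 z4 z5.
    by rewrite !mulNr !mulrN !opprK opprD opprK.
  have := sT _ tf; rewrite /fourier_distribution (funext F) => h.
  have {h} : T (fun y => (Phi (x - y) - e ^- d * Phi (e^-1 *: (x - y)))%:C%C) = 0.
    apply: h; apply/seteqP; split => // xi [cxi /= xi1].
    have cl : closed [set x : 'rV[R]_d | 3 / 2 <= dotp x x].
      apply: (@closed_comp _ _ (fun x : 'rV[R]_d => dotp x x) [set t | 3 / 2 <= t]).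
        by move=> z _; exact: (rsmooth_cont rsmooth_dotpp).
      exact: closed_ge.
    have : [set x : 'rV[R]_d | 3 / 2 <= dotp x x] xi.
      move/closure_id: cl => ->; move: xi cxi {xi1}; apply: closureS => z /=; apply: contraNT.
      rewrite -ltNge => z1; have b0 : b z = 0.
        have z2 : dotp (e *: z) (e *: z) <= 3 / 2.
          rewrite (le_trans _ (ltW z1))// dotpZl dotpC dotpZl mulrA -expr2.
          by rewrite ler_piMl ?dotpp_ge0// expr_le1 ?(ltW e0).
        by rewrite /b (bump1 z2) (bump1 (ltW z1)) subrr.
      by rewrite /u /v b0 !mulr0 eq_complex /= eqxx.
    move=> /=; have : dotp xi xi <= 1.
      rewrite -[leLHS]sqr_sqrtr ?dotpp_ge0// expr_le1 ?sqrtr_ge0//.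
    by move: (dotp xi xi) => t; lra.
  have d1 := dP1 x; have d2 : rdecay (fun y => e ^- d * Phi (e^-1 *: (x - y))).
    by apply: rdecayZ; apply: dP; rewrite gt_eqF.
  have d3 := rdecayD d1 (rdecayZ (-1) d2).
  have E0 : (fun y => (Phi (x - y) - e ^- d * Phi (e^-1 *: (x - y)))%:C%C) =
    (fun y => (((fun y => Phi (x - y)) \+ (fun y => -1 * (e ^- d * Phi (e^-1 *: (x - y))))) y)%:C%C).
    by apply/funext => y /=; rewrite mulN1r.
  rewrite E0 (Tg _ d1) (Tg _ d2) (Tg _ d3) => -[I1 I2].
  have [i11 i12] := ig _ d1; have [i21 i22] := ig _ d2.
  apply/eqP; rewrite eq_complex /=; apply/andP; split; apply/eqP.
    rewrite -[RHS]I1 -RintegralB//; apply: eq_Rintegral => y _; ring.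
  by rewrite -[RHS]I2 -RintegralB//; apply: eq_Rintegral => y _; ring.
split; split.
- by move=> s x; have [] := sK s x.
- by move=> g /ig[].
- have [N' [C' P]] := bd; exists N', C' => g D dg gD; apply: le_trans (P g D dg gD).
  by rewrite Tg//; exact: (normc_ge_Re (_ +i* _)%C).
- move=> x e e0 e1; have := sc x e e0 e1; rewrite Tg; last exact: dP1.
  by rewrite Tg; [case|apply: rdecayZ; apply: dP; rewrite gt_eqF].
- by move=> s x; have [] := sK s x.
- by move=> g /ig[].
- have [N' [C' P]] := bd; exists N', C' => g D dg gD; apply: le_trans (P g D dg gD).
  by rewrite Tg//; exact: (normc_ge_Im (_ +i* _)%C).
- move=> x e e0 e1; have := sc x e e0 e1; rewrite Tg; last exact: dP1.
  by rewrite Tg; [case|apply: rdecayZ; apply: dP; rewrite gt_eqF].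
Qed.
End reproducing.

(** * The reproducing formula *)

Section approximation.
Context {R : realType} {d : nat}.
Implicit Types (a k f g : 'rV[R]_d -> R) (i : 'I_d) (x y z : 'rV[R]_d).
Local Notation mu := (@lebesgue_rV R d).
Local Notation Phi := (osc (@bump R d) 0).

(** Functions that are constant outside a compact set and vanish near x. This
    class is closed under partial derivatives, which is what the induction in
    [far_decay] uses. *)
Definition flat_near x a := (exists c u, cpt u /\ a = cst c \+ u) /\
  forall y, dotp (y - x) (y - x) < 3 / 2 -> a y = 0.

Lemma flat_near_smooth x a : flat_near x a -> rsmooth a.
Proof. by move=> [[c [u [[su _] ->]]] _]; exact/(rsmoothD (rsmooth_cst c)). Qed.

Lemma flat_near_bounded x a : flat_near x a -> exists2 C : R, 0 <= C & forall y, `|a y| <= C.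
Proof.
move=> [[c [u [cu ->]]] _]; have [C C0 uC] := cpt_bounded cu.
exists (`|c| + C); first by rewrite addr_ge0.
by move=> y /=; rewrite (le_trans (ler_normD _ _))// lerD2l.
Qed.

Lemma pd_flat_near i x a : flat_near x a -> flat_near x (pd i a).
Proof.
move=> [[c [u [cu aE]]] a0]; split.
  exists 0, (pd i u); split; first exact: cpt_pd.
  rewrite aE pdD; last 2 first.
  - by move=> y; exact: differentiable_cst.
  - by move=> y; apply: rsmooth_diff; case: cu.
  by rewrite pd_cst.
move=> y yx; rewrite /pd (near_eq_derive (g := cst 0)) ?derive_cst//.
have cx : dotp (z - x) (z - x) @[z --> y] --> dotp (y - x) (y - x).
  have h0 : (z - x) @[z --> y] --> y - x by exact: (cvgB cvg_id (cvg_cst x)).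
  apply: (@cvg_comp _ _ _ (fun z => z - x) (fun w : 'rV[R]_d => dotp w w) _ _ _ h0).
  exact: (rsmooth_cont rsmooth_dotpp).
have : \near y, dotp (y - x) (y - x) < 3 / 2 by apply: (cvgr_lt _ cx).
by apply: filterS => z; exact: a0.
Qed.

(** The function y |-> g((x - y) / e), with its argument in the form to which
    the lemmas on affine changes of variable apply. *)
Definition rescale x (e : R) g y := g ((- e^-1) *: y + e^-1 *: x).

Lemma rescaleE x (e : R) g y : rescale x e g y = g (e^-1 *: (x - y)).
Proof. by rewrite /rescale scalerBr scaleNr addrC. Qed.

Lemma rdecay_rescale x (e : R) g : 0 < e -> rdecay g -> rdecay (rescale x e g).
Proof. by move=> e0; apply: rdecay_affine; rewrite oppr_eq0 invr_eq0 gt_eqF. Qed.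

Lemma W_scale_le (c : R) x : 1 <= c -> W (c *: x) <= W x.
Proof.
move=> c1; apply: ler_prod => i _; rewrite invr_ge0 ltW ?oneDsq_gt0//=.
rewrite lef_pV2 ?posrE ?oneDsq_gt0// lerD2l mxE exprMn ler_peMl ?sqr_ge0//.
by rewrite exprn_ege1.
Qed.

(** Away from x the point (x - y) / e is far out, where W is at most e^2,
    hence at most e. *)
Lemma W_rescale x (e : R) y : 0 < e -> e <= 1 -> 1 <= dotp (y - x) (y - x) ->
  W (e^-1 *: (x - y)) <= e.
Proof.
move=> e0 e1 yx; have h := weight_ge (e^-1 *: (x - y)).
have : e ^- 2 <= (W (e^-1 *: (x - y)))^-1.
  apply: le_trans h; rewrite dotpZl dotpC dotpZl mulrA -invfM -expr2.
  rewrite -(opprB y x) -scaleN1r dotpZl [dotp _ (-1 *: _)]dotpC dotpZl !mulN1r opprK.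
  by rewrite (@le_trans _ _ (e ^- 2 * dotp (y - x) (y - x)))// ?lerDr// ler_peMr// invr_ge0 exprn_ge0// ltW.
rewrite lef_pV2 ?posrE ?exprn_gt0// ?W_gt0// => /le_trans; apply.
by rewrite expr2 ler_piMr// ltW.
Qed.

(** A factor vanishing near x makes g((x - y) / e) small with any power of e,
    in every weighted derivative norm: (x - y) / e is then at distance at
    least 1 / e from the origin and g decays rapidly. Each derivative costs a
    factor 1 / e, which is why the exponent p is generalized in the induction.
    *)
Lemma far_decay x s p M a g : flat_near x a -> rdecay g ->
  exists2 C : R, 0 <= C & forall e y, 0 < e -> e <= 1 ->
    `|partials s (a \* rescale x e g) y| <= C * e ^+ p * W y ^+ M.
Proof.
elim/last_ind: s p a g => [|s i IH] p a g fa dg.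
  have [A A0 aA] := flat_near_bounded fa.
  have [C C0 gC] := rdecay_bound (p + M) dg.
  set P := \prod_(i < d) (2 * (1 + (-1 : R) ^- 2) * (1 + x ord0 i ^+ 2)).
  have P0 : 0 <= P.
    apply: prodr_ge0 => i _; rewrite !mulr_ge0// addr_ge0// ?sqr_ge0//.
    by rewrite invr_ge0 sqr_ge0.
  exists (A * C * P ^+ M) => [|e y e0 e1]; first by rewrite !mulr_ge0 ?exprn_ge0.
  rewrite /= normrM rescaleE; have [yx|yx] := ltP (dotp (y - x) (y - x)) (3 / 2).
    rewrite fa.2// normr0 mul0r !mulr_ge0 ?exprn_ge0 ?W_ge0//; exact: ltW.
  rewrite -!mulrA; apply: ler_pM => //; apply: (le_trans (gC _)).
  rewrite ler_wpM2l// exprD mulrCA -exprMn; apply: ler_pM; rewrite ?exprn_ge0 ?W_ge0//.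
    rewrite lerXn2r ?nnegrE ?W_ge0 ?(ltW e0)//; apply: W_rescale => //.
    by rewrite (le_trans _ yx)//; lra.
  rewrite lerXn2r ?nnegrE ?W_ge0 ?mulr_ge0 ?W_ge0//.
  apply: (@le_trans _ _ (W (x - y))); first by apply: W_scale_le; rewrite invf_ge1.
  have := @W_translate R d (-1) x y; rewrite scaleN1r addrC; apply.
  by rewrite oppr_eq0 oner_eq0.
have dg' : rdecay (pd i g).
  case: dg => sg dg; split; first exact: rsmooth_pd.
  by move=> t m; have := dg (rcons t i) m; rewrite partials_rcons.
have [C1 C10 P1] := IH p _ _ (pd_flat_near i fa) dg.
have [C2 C20 P2] := IH p.+1 _ _ fa dg'.
exists (C1 + C2) => [|e y e0 e1]; first exact: addr_ge0.
have sg := (rdecay_rescale x e0 dg).1; have sg' := (rdecay_rescale x e0 dg').1.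
have sa := flat_near_smooth fa.
rewrite partials_rcons pdM; last 2 first.
- by move=> z; exact: rsmooth_diff.
- by move=> z; exact: rsmooth_diff.
have -> : a \* pd i (rescale x e g) = (fun y => - e^-1 * (a \* rescale x e (pd i g)) y).
  rewrite pd_affine; last by move=> z; apply: rsmooth_diff; case: dg.
  by apply/funext => z /=; rewrite mulrCA.
rewrite partialsD; last 2 first.
- by apply: rsmoothM => //; exact: rsmooth_pd.
- by apply: rsmoothZ; exact: rsmoothM.
rewrite partialsZ; last exact: rsmoothM.
rewrite /= (le_trans (ler_normD _ _))// !mulrDl lerD ?P1//.
rewrite normrM normrN (gtr0_norm (x := e^-1)) ?invr_gt0//.
rewrite ler_pdivrMl// (le_trans (P2 _ _ e0 e1))// exprS; lra.
Qed.

Lemma cpt_partials s a : cpt a -> cpt (partials s a).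
Proof. by elim/last_ind: s a => // s i IH a ca; rewrite partials_rcons; apply/IH/cpt_pd. Qed.

Lemma cpt_rdecay a : cpt a -> rdecay a.
Proof.
move=> ca; split; first by case: ca.
move=> s m; have [C C0 aC] := cpt_bounded (cpt_partials s ca).
have [_ [rho a0]] := cpt_partials s ca.
have r0 : 0 < 1 + `|rho| by rewrite ltr_pwDl.
exists (C * (1 + `|rho|) ^+ (d * m)) => [|x]; first by rewrite mulr_ge0// exprn_ge0// ltW.
have [h|h] := leP rho (dotp x x).
  by rewrite a0// normr0 !mulr_ge0 ?exprn_ge0 ?W_ge0// ltW.
rewrite (le_trans (aC x))// -mulrA ler_peMr// exprM -exprMn exprn_ege1//.
have := @W_ge_ball R d x `|rho| (le_trans (ltW h) (ler_norm _)).
by rewrite -ler_pdivrMl ?exprn_gt0// mulr1.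
Qed.

Lemma cpt_near x : cpt (fun y => bump (y - x)).
Proof.
split.
  rewrite (_ : (fun y => _) = fun y => bump (1 *: y + - x)); first exact: (rsmooth_affine 1 (- x) (@rsmooth_bump R d)).
  by apply/funext => y; rewrite scale1r.
(* |y - x|^2 >= |y|^2 / 2 - |x|^2, because |y - 2 x|^2 >= 0 *)
exists (8 + 2 * dotp x x) => y h; apply: bump0.
have := dotpp_ge0 (y - 2 *: x); rewrite !dotpBl !(dotpC _ (_ - _)) !dotpBl.
rewrite !dotpZl ![dotp _ (2 *: x)]dotpC !dotpZl [dotp y x]dotpC; move: h.
by move: (dotp x x) (dotp y y) (dotp x y) => xx yy xy; lra.
Qed.

Lemma flat_near_cutoff x : flat_near x (fun y => 1 - bump (y - x)).
Proof.
split; last by move=> y yx; rewrite bump1 ?subrr ?ltW.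
by exists 1, (fun y => - bump (y - x)); split; [exact/cptN/cpt_near|].
Qed.

(** The cutoff 1 - bump is not rapidly decreasing, but its difference from 1
    has compact support. *)
Lemma rdecay_far x (e : R) g : 0 < e -> rdecay g ->
  rdecay ((fun y => 1 - bump (y - x)) \* rescale x e g).
Proof.
move=> e0 dg; have dge := rdecay_rescale x e0 dg.
rewrite (_ : _ \* _ = rescale x e g \+ (fun y => -1 * (rescale x e g \* (fun y => bump (y - x))) y)).
  apply: rdecayD => //; apply/rdecayZ/cpt_rdecay/cptM; first by case: dge.
  exact: cpt_near.
by apply/funext => y /=; ring.
Qed.

(** The L^1-normalized dilates of Phi, of integral (2 pi)^d, form an
    approximate identity. *)
Lemma near_cvg x b : cpt b ->
  \int[mu]_y (b y * (epsn n ^- d * rescale x (epsn n) Phi y)) @[n --> \oo] --> (2 * pi) ^+ d * b x.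
Proof.
move=> cb; have [C C0 bC] := cpt_bounded cb.
have dP : rdecay Phi by exact/rdecay_osc/cpt_bump.
have Pi := rdecay_integrable dP.
have E n : \int[mu]_y (b y * (epsn n ^- d * rescale x (epsn n) Phi y)) =
    \int[mu]_w (b (epsn n *: (- w) + x) * Phi w).
  have e0 : 0 < epsn n :> R := epsn_gt0 n.
  have en0 : - epsn n != 0 :> R by rewrite oppr_eq0 gt_eqF.
  have bi : mu.-integrable setT (EFin \o (fun y => b y * rescale x (epsn n) Phi y)).
    have [D _ PD] := osc_bounded 0 (@cpt_bump R d).
    apply: (integrable_mulb (cpt_integrable cb) (C := D)) => [|y]; last exact: PD.
    exact: (rdecay_measurable (rdecay_rescale x e0 dP)).
  have := Rintegral_affine_rV x en0 bi; rewrite normrN (gtr0_norm e0) => h.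
  transitivity (epsn n ^- d * \int[mu]_y (b y * rescale x (epsn n) Phi y)).
    by rewrite -RintegralZl//; apply: eq_Rintegral => y _; ring.
  rewrite -h; apply: eq_Rintegral => w _; rewrite scaleNr scalerN rescaleE; congr (_ * Phi _).
  by rewrite opprD opprK addrCA subrr addr0 scalerA mulVf ?scale1r// gt_eqF.
under eq_fun do rewrite E.
have -> : (2 * pi) ^+ d * b x = \int[mu]_w (b x * Phi w).
  have h1 : (2 * pi) ^- d * \int[mu]_w Phi w = 1 by rewrite -RintegralZl// -[RHS](@integral_kern R d).
  rewrite RintegralZl//.
  have ps : (2 * pi) ^+ d != 0 :> R by rewrite expf_neq0// mulf_neq0// gt_eqF// pi_gt0.
  by rewrite mulrC -[X in _ = _ * X](mulVKf ps) h1 mulr1.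
apply: (Rintegral_dct (g := fun w => C * `|Phi w|)).
- move=> n; apply: measurable_funM; last exact: rdecay_measurable.
  rewrite (_ : (fun w => _) = fun w => b ((- epsn n) *: w + x)); first exact: measurable_affine_cpt.
  by apply/funext => w; rewrite scalerN scaleNr.
- exact: (integrableZl measurableT C (integrable_norm Pi)).
- by move=> n w; rewrite normrM ler_wpM2r.
- move=> w; apply: cvgMr_tmp; apply: cvg_cpt_affine.
  by case: cb => sb _; exact: rsmooth_cont.
Qed.

(** By [bl_scale] the kernel Phi(x - y) can be replaced by its dilates e^-d
    Phi((x - y) / e), for all e. As e tends to 0 the part near x tends to (2
    pi)^d k(x), because k is continuous. The part away from x tends to 0 by
    the continuity of the distribution, as the test function does by
    [far_decay]; here k itself may grow polynomially. *)
Lemma reproducing k x : bandlimited k -> \int[mu]_y (k y * kern (x - y)) = k x.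
Proof.
move=> [sk ik [N [C tk]] sc].
have dP : rdecay Phi by exact/rdecay_osc/cpt_bump.
have fb : exists2 B : R, 0 <= B & forall s e y, (size s <= N)%N -> 0 < e -> e <= 1 ->
    `|partials s ((fun y => 1 - bump (y - x)) \* rescale x e Phi) y| <= B * e ^+ d.+1 * W y ^+ N.
  have /choice[F FP] : forall s, exists B : R, 0 <= B /\ forall e y, 0 < e -> e <= 1 ->
      `|partials s ((fun y => 1 - bump (y - x)) \* rescale x e Phi) y| <= B * e ^+ d.+1 * W y ^+ N.
    by move=> s; have [B B0 BP] := far_decay s d.+1 N (flat_near_cutoff x) dP; exists B.
  have [B B0 BP] := @seq_bound R d F N (fun s => (FP s).1).
  exists B => // s e y sN e0 e1; apply: (le_trans ((FP s).2 e y e0 e1)).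
  by rewrite !ler_wpM2r ?exprn_ge0 ?W_ge0 ?BP// ltW.
have [B B0 BP] := fb.
pose near n := \int[mu]_y ((k \* (fun y => bump (y - x))) y * (epsn n ^- d * rescale x (epsn n) Phi y)).
pose far n := \int[mu]_y (k y * (epsn n ^- d * ((fun y => 1 - bump (y - x)) \* rescale x (epsn n) Phi) y)).
have e1 n : epsn n <= 1 :> R by rewrite invf_le1// ler1n.
have far0 : far n @[n --> \oo] --> (0 : R).
  have h : `|C * B| * epsn n @[n --> \oo] --> (`|C * B| * 0 : R).
    by apply: cvgMl_tmp; exact: epsn_cvg0.
  rewrite mulr0 in h; apply/norm_cvg0P.
  apply: (squeeze_cvgr _ (cvg_cst 0) h); near=> n; rewrite normr_ge0 /=.
  have e0 : 0 < epsn n :> R := epsn_gt0 n.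
  apply: (@le_trans _ _ (C * (B * epsn n))); last first.
    by rewrite mulrA ler_wpM2r ?ler_norm// ltW.
  apply: tk => [|s y sN]; first exact/rdecayZ/rdecay_far.
  rewrite partialsZ; last by case: (rdecay_far x e0 dP).
  rewrite normrM gtr0_norm ?invr_gt0 ?exprn_gt0// ler_pdivrMl ?exprn_gt0//.
  by rewrite (le_trans (BP s _ y sN e0 (e1 n)))// exprS; lra.
have near1 : near n @[n --> \oo] --> (2 * pi) ^+ d * (k \* (fun y => bump (y - x))) x.
  apply: near_cvg; apply: cptM => //; exact: cpt_near.
have I n : \int[mu]_y (k y * Phi (x - y)) = near n + far n.
  have e0 : 0 < epsn n :> R := epsn_gt0 n.
  rewrite (sc _ _ e0 (e1 n)) -RintegralD//.
  - by apply: eq_Rintegral => y _ /=; rewrite rescaleE; ring.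
  - rewrite (_ : EFin \o _ = EFin \o fun y => k y * ((fun y => epsn n ^- d * rescale x (epsn n) Phi y) \* (fun y => bump (y - x))) y).
      apply: ik; apply/cpt_rdecay/cptM; last exact: cpt_near.
      by apply: rsmoothZ; case: (rdecay_rescale x e0 dP).
    by apply/funext => y /=; congr EFin; ring.
  - by apply: ik; exact/rdecayZ/rdecay_far.
have ps : (2 * pi) ^+ d != 0 :> R by rewrite expf_neq0// mulf_neq0// gt_eqF// pi_gt0.
have lim : \int[mu]_y (k y * Phi (x - y)) = (2 * pi) ^+ d * k x.
  have h : near n + far n @[n --> \oo] --> (2 * pi) ^+ d * k x.
    rewrite -[X in _ --> X]addr0; apply: cvgD => //.
    have b0 : bump (x - x) = 1 :> R.
      rewrite subrr bump1// /dotp big1 => [|i _]; first by rewrite divr_ge0.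
      by rewrite mxE mul0r.
    by move: near1; rewrite /= b0 mulr1.
  have h' : (fun=> \int[mu]_y (k y * Phi (x - y))) @ \oo --> (2 * pi) ^+ d * k x.
    by rewrite (_ : (fun=> _) = fun n => near n + far n)//; apply/funext => n; exact: I.
  have c1 : (fun=> \int[mu]_y (k y * Phi (x - y))) @ \oo --> \int[mu]_y (k y * Phi (x - y)) by exact: cvg_cst.
  exact: (cvg_unique _ c1 h').
transitivity (\int[mu]_y ((2 * pi) ^- d * (k y * Phi (x - y)))).
  by apply: eq_Rintegral => y _; rewrite /kern mulrCA.
rewrite RintegralZl// ?lim ?mulKf//; apply: ik.
rewrite (_ : (fun y => _) = rescale x 1 Phi); first exact: rdecay_rescale.
by apply/funext => y; rewrite rescaleE invr1 scale1r.
Unshelve. all: by end_near.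
Qed.

Lemma rdecay_kern_refl z : rdecay (fun v => kern (z - v)).
Proof.
rewrite (_ : (fun v => _) = rescale z 1 kern); first exact/rdecay_rescale/rdecay_kern.
by apply/funext => y; rewrite rescaleE invr1 scale1r.
Qed.

(** The substitution v = r (x - y) turns every term into k convolved with kern
    at the point r x + b j. *)
Lemma conv_packet (I : Type) (s : seq I) (c : I -> R) (b : I -> 'rV[R]_d) (r : R) k x :
  0 < r -> bandlimited k ->
  mu.-integrable setT (EFin \o (fun y => r ^+ d * k (r *: (x - y)) * packet s c b r y)) /\
  \int[mu]_y (r ^+ d * k (r *: (x - y)) * packet s c b r y) =
  \sum_(j <- s) c j * k (r *: x + b j).
Proof.
move=> r0 bk; have ik := bl_integrable bk.
pose F j v := c j * (k v * kern (r *: x + b j - v)).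
have ki j : mu.-integrable setT (EFin \o (fun v => k v * kern (r *: x + b j - v))).
  exact/ik/rdecay_kern_refl.
have Fi j : mu.-integrable setT (EFin \o F j) by exact: (integrableZl measurableT (c j) (ki j)).
have [Si SE] := Rintegral_sum s Fi.
have rn0 : - r != 0 by rewrite oppr_eq0 gt_eqF.
have E : (fun y => r ^+ d * k (r *: (x - y)) * packet s c b r y) =
    (fun y => r ^+ d * (\sum_(j <- s) F j ((- r) *: y + r *: x))).
  apply/funext => y; rewrite -mulrA; congr (_ * _); rewrite /packet mulr_sumr.
  apply: eq_bigr => j _; rewrite /F mulrCA scalerBr scaleNr [- _ + _]addrC; congr (_ * (_ * kern _)).
  by rewrite opprB [r *: x + b j]addrC -addrA [r *: x + _]addrC subrK addrC.
have Si' := integrable_affine_rV (r *: x) rn0 Si.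
rewrite E; split; first exact: (integrableZl measurableT _ Si').
rewrite RintegralZl// (Rintegral_affine_rV (r *: x) rn0 Si) normrN (gtr0_norm r0).
rewrite mulVKf ?expf_neq0 ?gt_eqF// SE; apply: eq_bigr => j _.
by rewrite /F RintegralZl// reproducing.
Qed.

Lemma convolution_packet (I : Type) (s : seq I) (c : I -> R) (b : I -> 'rV[R]_d) (r : R) K x :
  0 < r -> E_space 1 K ->
  convolution (dilate r K) (fun y => (packet s c b r y)%:C%C) x =
  \sum_(j <- s) (c j)%:C%C * K (r *: x + b j).
Proof.
move=> r0 /bandlimitedP[b1 b2].
have [_ e1] := conv_packet s c b x r0 b1; have [_ e2] := conv_packet s c b x r0 b2.
transitivity ((\sum_(j <- s) c j * complex.Re (K (r *: x + b j))) +i*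
   (\sum_(j <- s) c j * complex.Im (K (r *: x + b j))))%C.
  rewrite -e1 -e2 /convolution /cintegral /dilate; congr (_ +i* _)%C.
    by apply: eq_Rintegral => y _; case: (K _) => u v /=; ring.
  by apply: eq_Rintegral => y _; case: (K _) => u v /=; ring.
elim: s {e1 e2} => [|j s IH]; first by rewrite !big_nil.
by rewrite !big_cons -IH; case: (K _) => u v /=; congr (_ +i* _)%C; rewrite !mul0r ?subr0 ?addr0.
Qed.

End approximation.

(** * Elementary inequalities *)

Section inequalities.
Context {R : realType}.

(** From t / s <= exp(t / s), raised to the power s. *)
Lemma powR_le_exp (t s : R) : 0 <= t -> 1 <= s -> t `^ s <= s `^ s * expR t.
Proof.
move=> t0 s1; have s0 : 0 < s by exact: lt_le_trans s1.
have -> : expR t = expR (t / s) `^ s by rewrite -expRM divfK ?gt_eqF.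
rewrite -powRM ?expR_ge0 ?(ltW s0)//; apply: ge0_ler_powR; rewrite ?nnegrE ?mulr_ge0 ?expR_ge0 ?(ltW s0)//.
rewrite -ler_pdivrMl// mulrC; apply: le_trans (expR_ge1Dx _); by rewrite lerDr.
Qed.

(** From (1 - X) exp X <= 1. *)
Lemma expR_le_affine (X D : R) : 0 <= X -> X <= D -> expR X <= 1 + expR D * X.
Proof.
move=> X0 XD; have h := expR_ge1Dx (- X); have e0 := expR_gt0 X.
have : expR X * (1 - X) <= 1 by rewrite -ler_pdivlMl// mulr1 -expRN.
have : expR X * X <= expR D * X by rewrite ler_wpM2r// ler_expR.
lra.
Qed.

(** The graph of u^s lies above its tangent line at l; for s > 1 this is
    Young's inequality with exponents s and s / (s - 1). *)
Lemma powR_tangent (u l s : R) : 0 <= u -> 0 < l -> 1 <= s ->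
  s * l `^ (s - 1) * u <= u `^ s + (s - 1) * l `^ s.
Proof.
move=> u0 l0; rewrite le_eqVlt => /orP[/eqP <-|s1].
  by rewrite subrr powRr0 powRr1// !mul1r mul0r addr0.
have s0 : 0 < s by exact: lt_trans s1.
have s10 : 0 < s - 1 by rewrite subr_gt0.
have := @conjugate_powR R u (l `^ (s - 1)) s (s / (s - 1)) u0 (powR_ge0 _ _) s0 (divr_gt0 s0 s10).
have -> : s^-1 + (s / (s - 1))^-1 = 1 by field; rewrite !gt_eqF.
move=> /(_ erefl).
rewrite -powRrM mulrCA mulfV ?mulr1 ?gt_eqF//.
rewrite -(ler_pM2l s0) => h; rewrite mulrAC -mulrA; apply: (le_trans h).
rewrite le_eqVlt; apply/orP; left; apply/eqP; field.
by rewrite !gt_eqF.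
Qed.

(** Telescoping: h(u) = u / (1 + |u|) has values in [-1, 1], and 4 (h(u + 1) -
    h(u)) >= 1 / (1 + u^2). *)
Lemma sum_poisson_le M (t : R) : \sum_(l < M) (1 + (t - l%:R) ^+ 2)^-1 <= 8.
Proof.
pose h (u : R) := u / (1 + `|u|).
have h1 u : `|h u| <= 1.
  by rewrite /h normrM normfV (ger0_norm (_ : 0 <= 1 + _)) ?addr_ge0// ler_pdivrMr ?ltr_pwDl// mul1r lerDr.
have hD u : (1 + u ^+ 2)^-1 <= 4 * (h (u + 1) - h u).
  have a0 : 0 < 1 + `|u| by rewrite ltr_pwDl.
  have b0 : 0 < 1 + `|u + 1| by rewrite ltr_pwDl.
  rewrite -[leLHS]mul1r ler_pdivrMr ?oneDsq_gt0//.
  rewrite /h (_ : _ - _ = ((u + 1) * (1 + `|u|) - u * (1 + `|u + 1|)) / ((1 + `|u|) * (1 + `|u + 1|))); last first.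
    by field; rewrite !gt_eqF.
  rewrite mulrA mulrAC ler_pdivlMr ?mulr_gt0// mul1r.
  have [u0|u0] := leP 0 u; first by rewrite !ger0_norm ?addr_ge0//; nra.
  have [u1|u1] := leP u (-1); first by rewrite !ler0_norm; [nra|lra|lra].
  rewrite (ltr0_norm u0) ger0_norm; last by lra.
  have w0 : 0 <= - u * (1 + u) by rewrite mulr_ge0; lra.
  have := mulr_ge0 w0 (sqr_ge0 u); have := sqr_ge0 u; nra.
have : forall m, \sum_(l < m) (1 + (t - l%:R) ^+ 2)^-1 <= 4 * (h (t + 1) - h (t + 1 - m%:R)).
  elim=> [|m IH]; first by rewrite big_ord0 subr0 subrr mulr0.
  rewrite big_ord_recr /=; apply: (le_trans (lerD IH (hD _))).
  rewrite -mulrDr addrA (_ : t - m%:R + 1 = t + 1 - m%:R) ?subrK; last by rewrite addrAC.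
  by rewrite (_ : t + 1 - m.+1%:R = t - m%:R)// -natr1; ring.
move=> /(_ M) /le_trans; apply.
have := h1 (t + 1); have := h1 (t + 1 - M%:R); rewrite !ler_norml => /andP[x1 x2] /andP[y1 y2]; lra.
Qed.

End inequalities.

(** * Lattice points and colours *)

Section lattice.
Context {R : realType} {d : nat}.
Implicit Types (x y : 'rV[R]_d).

Definition latpt M (j : {ffun 'I_d -> 'I_M}) : 'rV[R]_d := \row_i (j i : nat)%:R.

(** The sum of products over all lattice points of a cube is the product of
    one-dimensional sums. *)
Lemma sum_W_le M x : \sum_(j : {ffun 'I_d -> 'I_M}) W (x - latpt j) <= 8 ^+ d.
Proof.
rewrite (_ : \sum__ _ = \sum_(j : {ffun 'I_d -> 'I_M}) \prod_i (1 + (x ord0 i - (j i)%:R) ^+ 2)^-1); last first.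
  by apply: eq_bigr => j _; apply: eq_bigr => i _; rewrite !mxE.
rewrite -(bigA_distr_bigA (fun (i : 'I_d) (l : 'I_M) => (1 + (x ord0 i - l%:R) ^+ 2)^-1)).
rewrite -[X in _ <= _ ^+ X]card_ord -prodr_const; apply: ler_prod => i _.
by rewrite sum_poisson_le andbT sumr_ge0// => l _; rewrite invr_ge0 ltW ?oneDsq_gt0.
Qed.

(** The lattice point j lies in the cube of side r L. If |x_i| <= 2 L the
    right-hand weight is bounded below; if not, r x_i is at distance at least
    r |x_i| / 2 from the cube. *)
Lemma W_dilate_le (r L : R) x M (j : {ffun 'I_d -> 'I_M}) : 0 < L -> 1 <= r * L ->
  (forall i, (j i)%:R <= r * L) -> W (r *: x - latpt j) <= 9 ^+ d * W (L^-1 *: x).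
Proof.
move=> L0 rL jrL; rewrite -[X in _ ^+ X]card_ord -prodr_const /W -big_split/=.
apply: ler_prod => i _; rewrite invr_ge0 ltW ?oneDsq_gt0//=.
rewrite ler_pdivlMr ?oneDsq_gt0// ler_pdivrMl ?oneDsq_gt0// !mxE.
have := jrL i; have l0 : 0 <= (j i)%:R :> R by [].
move: (j i)%:R l0 => l l0 lr.
have -> : r * x ord0 i = r * L * (L^-1 * x ord0 i) by rewrite mulrA mulfK// gt_eqF.
move: (r * L) (L^-1 * _) rL lr => T y T1 lT.
have [h|h] := leP (`|y|) 2.
  have : y ^+ 2 <= 4.
    by rewrite -real_normK ?num_real// (_ : 4 = 2 ^+ 2); [rewrite lerXn2r ?nnegrE|ring].
  by have := sqr_ge0 (T * y - l); nra.
have h1 : `|y| / 2 <= `|T * y - l|.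
  rewrite (le_trans _ (lerB_dist _ _))// normrM (ger0_norm (_ : 0 <= T)) ?(ger0_norm l0); nra.
have : (y / 2) ^+ 2 <= (T * y - l) ^+ 2.
  rewrite -[leLHS]real_normK ?num_real// -[leRHS]real_normK ?num_real//.
  by rewrite lerXn2r ?nnegrE// normrM [`|2^-1|]ger0_norm.
by rewrite exprMn; nra.
Qed.

Definition box (n : nat) : set 'rV[R]_d := [set v | forall i, `[- n%:R, n%:R[%classic (v ord0 i)].

Definition colour n (n0 : (0 < n)%N) M (j : {ffun 'I_d -> 'I_M}) : {ffun 'I_d -> 'I_n} :=
  [ffun i => Ordinal (ltn_pmod (j i) n0)].

(** Both j and j' lie within n of y in every coordinate, so that they differ
    by less than 2 n, and they are congruent modulo 2 n. *)
Lemma colour_inj n (n0 : (0 < n.*2)%N) M (j j' : {ffun 'I_d -> 'I_M}) y :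
  colour n0 j = colour n0 j' -> box n (y - latpt j) -> box n (y - latpt j') -> j = j'.
Proof.
move=> /ffunP cj bj bj'; apply/ffunP => i; apply: val_inj.
have := cj i; rewrite !ffunE => /(congr1 val) /= jj'.
have := bj i; have := bj' i; rewrite /= !in_itv/= !mxE => /andP[a1 a2] /andP[b1 b2].
have aux (a b : nat) : (a = b %[mod n.*2])%N -> (a <= b)%N -> (b < a + n.*2)%N -> a = b.
  move=> ab ab1 ab2; apply/eqP; rewrite eqn_leq ab1 -subn_eq0 -leqn0 leqNgt; apply/negP => ba.
  have : (n.*2 %| b - a)%N by rewrite -eqn_mod_dvd//; exact/eqP.
  by rewrite gtnNdvd// ltn_subLR.
have lt1 : (j' i < j i + n.*2)%N.
  by rewrite -(ltr_nat R) natrD -addnn natrD; lra.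
have lt2 : (j i < j' i + n.*2)%N.
  by rewrite -(ltr_nat R) natrD -addnn natrD; lra.
by case: (leqP (j i) (j' i)) => [|/ltnW] h; [|symmetry]; apply: aux.
Qed.

End lattice.

(** * Averages over colours and signs *)

Section averaging.
Context {R : realType}.

(** By independence the exponential moment is a product over k. Each factor is
    at most 1 + exp(D) D / N <= exp(exp(D) D / N), with N the number of
    colours, and there are N factors. *)
Lemma sum_exp_le (C E : finType) (U : 'I_#|C| -> C -> R) (D : R) : (0 < #|C|)%N ->
  (forall k a, 0 <= U k a <= D) -> (forall k, \sum_a U k a <= D) ->
  \sum_(w : {ffun 'I_#|C| -> C * E}) expR (\sum_k U k (w k).1) <=
  #|{ffun 'I_#|C| -> C * E}|%:R * expR (expR D * D).
Proof.
move=> C0 UD SD; under eq_bigr do rewrite expR_sum.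
rewrite -(bigA_distr_bigA (fun k (t : C * E) => expR (U k t.1))) /=.
have c0 : 0 < #|C|%:R :> R by rewrite ltr0n.
apply: (@le_trans _ _ (\prod_(k < #|C|) (#|{: C * E}|%:R * expR (expR D * (D / #|C|%:R))))).
  apply: ler_prod => k _; apply/andP; split; first by apply: sumr_ge0 => t _; exact: expR_ge0.
  rewrite -(pair_big xpredT xpredT (fun a (e : E) => expR (U k a))) /=.
  under eq_bigr do rewrite sumr_const -mulr_natl.
  rewrite -mulr_sumr card_prod natrM [X in _ <= X * _]mulrC -!mulrA.
  rewrite ler_wpM2l//; apply: (@le_trans _ _ (\sum_a (1 + expR D * U k a))).
    by apply: ler_sum => a _; have /andP[? ?] := UD k a; exact: expR_le_affine.
  rewrite big_split/= sumr_const -mulr_sumr.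
  apply: (@le_trans _ _ (#|C|%:R * (1 + expR D * (D / #|C|%:R)))); last by rewrite ler_wpM2l// expR_ge1Dx.
  by rewrite mulrDr mulr1 [_%:R * (_ * _)]mulrCA [_%:R * (_ / _)]mulrCA mulfV ?mulr1 ?gt_eqF// lerD2l ler_wpM2l ?expR_ge0.
rewrite big_split/= !prodr_const card_ord card_ffun card_ord natrX ler_wpM2l ?exprn_ge0//.
by rewrite -expRM_natl (_ : _ * _ = expR D * D)//; field; rewrite gt_eqF.
Qed.

(** The expectation of a sum of functions of the single coordinates depends on
    the marginals only. *)
Lemma sum_marginal (I T : finType) (X : I -> T -> R) :
  #|T|%:R * \sum_(w : {ffun I -> T}) \sum_k X k (w k) =
  #|{ffun I -> T}|%:R * \sum_k \sum_t X k t.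
Proof.
rewrite exchange_big/= !mulr_sumr; apply: eq_bigr => k _.
pose F i t := if i == k then X k t else 1.
have := bigA_distr_bigA F : \prod_i \sum_t F i t = \sum_(f : {ffun I -> T}) \prod_i F i (f i).
rewrite (bigD1 k)//= {1}/F eqxx.
have -> : \prod_(i | i != k) \sum_t F i t = #|T|%:R ^+ #|predC1 k|.
  by rewrite -prodr_const; apply: eq_bigr => i /negbTE ik; rewrite /F ik sumr_const.
move=> h.
have -> : \sum_(w : {ffun I -> T}) X k (w k) = (\sum_t X k t) * #|T|%:R ^+ #|predC1 k|.
  rewrite h; apply: eq_bigr => w _; rewrite (bigD1 k)//= /F eqxx big1 ?mulr1// => i /negbTE ->//.
rewrite mulrCA -exprS mulrC card_ffun natrX; congr (_ ^+ _ * _).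
by rewrite cardC1 prednK//; apply/card_gt0P; exists k.
Qed.

Lemma powR_le_add (a b c q : R) : 0 < q -> 0 <= a -> 0 <= b -> 0 <= c -> 2 * a <= b + c ->
  a `^ q <= b `^ q + c `^ q.
Proof.
move=> q0 a0 b0 c0 abc; have [ab|/ltW ba] := leP a b.
  apply: (@le_trans _ _ (b `^ q)); last by rewrite lerDl powR_ge0.
  by apply: ge0_ler_powR; rewrite ?nnegrE// ltW.
apply: (@le_trans _ _ (c `^ q)); last by rewrite lerDr powR_ge0.
by apply: ge0_ler_powR; rewrite ?nnegrE ?(ltW q0)//; lra.
Qed.

Lemma normc_nneg (z : R[i]) : 0 <= normc z.
Proof. by case: z => a b; exact: sqrtr_ge0. Qed.

Lemma normc_double (z : R[i]) : normc (z + z) = 2 * normc z.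
Proof.
case: z => a b /=; rewrite (_ : _ + _ = 2 ^+ 2 * (a ^+ 2 + b ^+ 2)); last by ring.
by rewrite sqrtrM ?sqr_ge0// sqrtr_sqr ger0_norm.
Qed.

(** Flipping the sign at j0 pairs the sums V + u and V - u, where u is the
    term of j0; one of the two has modulus at least |u|. This holds for all
    exponents q > 0, without Khinchin's inequality. *)
Lemma sum_signs_ge (J : finType) (chi : J -> bool) (u : J -> R[i]) (q : R) (j0 : J) : 0 < q -> chi j0 ->
  2^-1 * #|{ffun J -> bool}|%:R * normc (u j0) `^ q <=
  \sum_(e : {ffun J -> bool}) normc (\sum_j ((chi j)%:R * (-1) ^+ (e j))%:C%C * u j) `^ q.
Proof.
move=> q0 c0; pose X (e : {ffun J -> bool}) := normc (\sum_j ((chi j)%:R * (-1) ^+ (e j))%:C%C * u j) `^ q.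
pose flip (e : {ffun J -> bool}) : {ffun J -> bool} := [ffun j => if j == j0 then ~~ e j else e j].
have flipK : involutive flip.
  by move=> e; apply/ffunP => j; rewrite !ffunE; case: eqP => // _; rewrite negbK.
have E2 : 2 * \sum_e X e = \sum_e (X e + X (flip e)).
  rewrite big_split/= [X in _ + X](_ : _ = \sum_e X e); first by ring.
  by rewrite [RHS](reindex_inj (inv_inj flipK)).
rewrite -mulrA mulrC ler_pdivrMr// [leRHS]mulrC E2 -[#|_|]cardsT -sum1_card natr_sum mulr_suml.
rewrite big_mkcond /=; apply: ler_sum => e _; rewrite inE mul1r /X.
have spl (f : {ffun J -> bool}) : \sum_j ((chi j)%:R * (-1) ^+ (f j))%:C%C * u j =
    ((-1) ^+ (f j0))%:C%C * u j0 + \sum_(j | j != j0) ((chi j)%:R * (-1) ^+ (f j))%:C%C * u j.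
  by rewrite (bigD1 j0)//= c0 mul1r.
rewrite !spl [flip e j0]ffunE eqxx.
rewrite [X in _ <= _ + normc (_ + X) `^ q](eq_bigr (fun j => ((chi j)%:R * (-1) ^+ (e j))%:C%C * u j)); last first.
  by move=> j /negbTE jj; rewrite ffunE jj.
set V := \sum_(_ | _) _; set w := (_)%:C%C * u j0.
have -> : ((-1) ^+ (~~ e j0))%:C%C * u j0 = - w by rewrite /w; case: (e j0); rewrite /= ?expr0 ?expr1; case: (u j0) => a b; congr (_ +i* _)%C; ring.
have <- : normc w = normc (u j0).
  rewrite /w; case: (e j0); case: (u j0) => a b; congr Num.sqrt => /=; ring.
apply: powR_le_add; rewrite ?normc_nneg//.
have <- : normc ((w + V) - (- w + V)) = 2 * normc w.
  by rewrite opprD opprK addrACA subrr addr0 normc_double.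
by rewrite (le_trans (le_normcD _ _))// normcN.
Qed.

End averaging.

(** * Pointwise bounds for random packets *)

Section pointwise.
Context {R : realType} {d : nat}.
Implicit Types (x y : 'rV[R]_d).

Section choices.
Variables (n M : nat) (n0 : (0 < n)%N).
Local Notation J := {ffun 'I_d -> 'I_M}.
Local Notation Col := {ffun 'I_d -> 'I_n}.
Local Notation T := (Col * {ffun J -> bool})%type.

(** The lattice points of the cube {0, ..., m-1}^d inside a fixed larger cube:
    the side m depends on k while the probability space must not. *)
Definition active (m : nat) (j : J) := [forall i, j i < m]%N.

(** A random choice t consists of a colour and a sign for each lattice point;
    points of other colours get the coefficient 0. *)
Definition coef (m : nat) (t : T) (j : J) : R :=
  (active m j && (colour n0 j == t.1))%:R * (-1) ^+ (t.2 j).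

Definition tpacket (m : nat) (t : T) (r : R) : 'rV[R]_d -> R :=
  packet (index_enum J) (coef m t) (fun j => - latpt j) r.

End choices.

Local Notation J M := {ffun 'I_d -> 'I_M}.
Local Notation Col n := {ffun 'I_d -> 'I_n}.
Local Notation Sgn M := {ffun J M -> bool}.
Local Notation Omega n M := {ffun 'I_#|{: Col n}| -> Col n * Sgn M}.

(** With |kern| <= C W^(1 + b + c) every term of the packet is at most W(r x -
    j) U^b (9^d W(x / L))^c, where U is the sum of W(r x - j) over the chosen
    class. The exponent b is such that (1 + b) q >= 1, so that U^((1 + b) q)
    is bounded by a multiple of U, and c such that c q >= q / p, so that the
    power p / q of the bound is integrable in x. *)
Lemma tpacket_le (p q : R) : 0 < q -> q <= p -> exists2 C : R, 0 <= C &
  forall n M (n0 : (0 < n)%N) (m : nat) (t : Col n * Sgn M) (r L : R) x,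
  0 < L -> 1 <= r * L -> m%:R <= r * L ->
  `|tpacket n0 m t r x| `^ q <= C * W (L^-1 *: x) `^ (q / p) *
    \sum_(j : J M | active m j && (colour n0 j == t.1)) W (r *: x - latpt j).
Proof.
move=> q0 qp; have p0 : 0 < p by exact: lt_le_trans qp.
have [b bq] : exists b : nat, 1 <= (1 + b)%:R * q.
  exists (Num.bound q^-1); rewrite -ler_pdivrMr// mul1r (le_trans (ltW (archi_boundP _)))//.
    by rewrite invr_ge0 ltW.
  by rewrite ler_nat.
have [c cp] : exists c : nat, 1 <= c%:R * p.
  exists (Num.bound p^-1); rewrite -ler_pdivrMr// mul1r (le_trans (ltW (archi_boundP _)))//.
  by rewrite invr_ge0 ltW.
have [C0 C00 kC] := rdecay_bound (1 + b + c) (@rdecay_kern R d).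
exists ((C0 * (9 ^+ d) ^+ c) `^ q * (8 ^+ d) `^ ((1 + b)%:R * q - 1)) => [|n M n0 m t r L x L0 rL mrL].
  by rewrite mulr_ge0 ?powR_ge0.
set U := \sum_(_ | _) _; set w := W (L^-1 *: x).
have w0 : 0 < w := W_gt0 _.
have U0 : 0 <= U by apply: sumr_ge0 => j _; exact: W_ge0.
have U8 : U <= 8 ^+ d.
  apply: le_trans (sum_W_le M (r *: x)); rewrite /U big_mkcond; apply: ler_sum => j _.
  by case: ifP => // _; exact: W_ge0.
have h : `|tpacket n0 m t r x| <= C0 * (9 ^+ d) ^+ c * (U ^+ (1 + b) * w ^+ c).
  have -> : C0 * (9 ^+ d) ^+ c * (U ^+ (1 + b) * w ^+ c) =
      \sum_(j : J M | active m j && (colour n0 j == t.1))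
        C0 * (W (r *: x - latpt j) * (U ^+ b * (9 ^+ d * w) ^+ c)).
    by rewrite -mulr_sumr -mulr_suml -/U exprMn exprD expr1; ring.
  rewrite /tpacket /packet (le_trans (ler_norm_sum _ _ _))// [leRHS]big_mkcond /=.
  apply: ler_sum => j _; rewrite /coef; case: ifP => [aj|]; last by rewrite !mul0r normr0.
  rewrite mul1r normrM normrX normrN1 expr1n mul1r (le_trans (kC _))//.
  rewrite ler_wpM2l// !exprD expr1 -mulrA ler_wpM2l ?W_ge0//.
  apply: ler_pM; rewrite ?exprn_ge0 ?W_ge0// lerXn2r ?nnegrE ?W_ge0 ?mulr_ge0 ?(ltW w0)//.
    by rewrite /U (bigD1 j) ?aj//= lerDl sumr_ge0// => i _; exact: W_ge0.
  apply: W_dilate_le => // i; apply: le_trans mrL; rewrite ler_nat ltnW//.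
  by move: aj => /andP[/forallP].
have q0' := ltW q0.
apply: (@le_trans _ _ ((C0 * (9 ^+ d) ^+ c * (U ^+ (1 + b) * w ^+ c)) `^ q)).
  by apply: ge0_ler_powR => //; rewrite nnegrE// !mulr_ge0 ?exprn_ge0 ?(ltW w0).
rewrite powRM ?mulr_ge0 ?exprn_ge0 ?(ltW w0)// powRM ?exprn_ge0 ?(ltW w0)//.
rewrite -!mulrA ler_wpM2l ?powR_ge0//.
have wl : (w ^+ c) `^ q <= w `^ (q / p).
  rewrite -powR_mulrn ?(ltW w0)// -powRrM; apply: ger_powR; first by rewrite w0 W_le1.
  by rewrite ler_pdivrMr// mulrAC -ler_pdivrMr ?divff ?gt_eqF.
have Ul : (U ^+ (1 + b)) `^ q <= (8 ^+ d) `^ ((1 + b)%:R * q - 1) * U.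
  rewrite -powR_mulrn// -powRrM -[X in U `^ X](subrK 1).
  have [->|Un0] := eqVneq U 0; first by rewrite powR0 ?mulr0// subrK gt_eqF// (lt_le_trans _ bq).
  rewrite powRD ?Un0 ?implybT// powRr1// ler_wpM2r//.
  by apply: ge0_ler_powR; rewrite ?nnegrE ?subr_ge0 ?exprn_ge0.
rewrite mulrCA [leRHS]mulrC -[leRHS]mulrA [leLHS]mulrC [leRHS]mulrC ler_wpM2r ?powR_ge0//.
rewrite powRM ?exprn_ge0 ?(ltW w0)// [leLHS]mulrC -[leRHS]mulrA; apply: ler_pM; rewrite ?powR_ge0//.
by rewrite mulrC.
Qed.

(** At fixed x, the mean over colours and signs of the p-th power of the
    square function. [tpacket_le] reduces it to the mean of the power p / q of
    \sum_k U_k(a_k), which is at most a multiple of the mean of its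
    exponential. *)
Lemma upper_point (p q : R) : 0 < q -> q <= p -> exists2 C : R, 0 <= C &
  forall n M (n0 : (0 < n)%N) (m : nat -> nat) (r : nat -> R) (L : R) x, 0 < L ->
  (forall k : 'I_#|{: Col n}|, 1 <= r k * L) ->
  (forall k : 'I_#|{: Col n}|, (m k)%:R <= r k * L) ->
  \sum_(w : Omega n M)
     (\sum_(k < #|{: Col n}|) `|tpacket n0 (m k) (w k) (r k) x| `^ q) `^ (p / q) <=
  C * #|{: Omega n M}|%:R *
    W (L^-1 *: x).
Proof.
move=> q0 qp; have p0 : 0 < p by exact: lt_le_trans qp.
have [C C0 CP] := tpacket_le q0 qp.
pose s := p / q; have s1 : 1 <= s by rewrite ler_pdivlMr// mul1r.
have s0 : 0 < s by exact: lt_le_trans s1.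
pose D : R := 8 ^+ d.
exists (C `^ s * s `^ s * expR (expR D * D)) => [|n M n0 m r L x L0 rL mrL].
  by rewrite !mulr_ge0 ?powR_ge0 ?expR_ge0.
set w := W (L^-1 *: x); have w0 : 0 < w := W_gt0 _.
pose U (k : 'I_#|{: Col n}|) (a : Col n) : R :=
  \sum_(j : J M | active (m k) j && (colour n0 j == a)) W (r k *: x - latpt j).
have U0 k a : 0 <= U k a by apply: sumr_ge0 => j _; exact: W_ge0.
have SU k : \sum_a U k a <= D.
  apply: le_trans (sum_W_le M (r k *: x)); rewrite /U.
  rewrite -(partition_big (@colour d n n0 M) xpredT) //= big_mkcond; apply: ler_sum => j _.
  by case: ifP => // _; exact: W_ge0.
have UD k a : 0 <= U k a <= D.
  rewrite U0/=; apply: le_trans (SU k); rewrite (bigD1 a)//= lerDl.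
  by apply: sumr_ge0 => b _; exact: U0.
have C0' : (0 < #|{: Col n}|)%N by rewrite card_ffun !card_ord expn_gt0 n0.
have h := sum_exp_le (Sgn M) C0' UD SU.
have A0 : 0 <= C `^ s * s `^ s * w by rewrite !mulr_ge0 ?powR_ge0 ?(ltW w0).
rewrite [leRHS](_ : _ = C `^ s * s `^ s * w * (#|{: Omega n M}|%:R * expR (expR D * D))); last by ring.
apply: le_trans (ler_wpM2l A0 h); rewrite mulr_sumr; apply: ler_sum => t _.
have S0 : 0 <= \sum_k U k (t k).1 by apply: sumr_ge0.
apply: (@le_trans _ _ ((C * w `^ (q / p) * \sum_k U k (t k).1) `^ s)).
  apply: ge0_ler_powR; rewrite ?nnegrE ?(ltW s0)//.
  - by apply: sumr_ge0 => k _; exact: powR_ge0.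
  - by rewrite !mulr_ge0 ?powR_ge0.
  by rewrite mulr_sumr; apply: ler_sum => k _; exact: CP.
have e1 : (C * w `^ (q / p) * \sum_k U k (t k).1) `^ s =
    C `^ s * (w `^ (q / p)) `^ s * (\sum_k U k (t k).1) `^ s.
  by rewrite powRM ?mulr_ge0 ?powR_ge0// powRM ?powR_ge0.
rewrite {}e1 -powRrM.
rewrite (_ : q / p * s = 1); last by rewrite /s; field; rewrite !gt_eqF.
rewrite powRr1 ?(ltW w0)// -!mulrA ler_wpM2l ?powR_ge0// mulrCA ler_wpM2l ?(ltW w0)//.
exact: powR_le_exp.
Qed.

Definition kbox (K : 'rV[R]_d -> R[i]) (q : R) (n : nat) y : R := normc (K y) `^ q * \1_(box n) y.

(** For a given colour at most one lattice point j has r_k x - j in the box,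
    by [colour_inj]; the average over the signs is at least half the q-th
    power of the corresponding term. Averaging over the colours then collects
    all j, with the factor 1 / N. *)
Lemma lower_point (q : R) (K : 'rV[R]_d -> R[i]) n M (n0 : (0 < n.*2)%N) (m : nat -> nat) (r : nat -> R) x :
  0 < q ->
  #|{: Omega n.*2 M}|%:R *
   (2^-1 * #|{: Col n.*2}|%:R^-1 *
   \sum_(k < #|{: Col n.*2}|) \sum_(j : J M | active (m k) j) kbox K q n (r k *: x - latpt j)) <=
  \sum_(w : Omega n.*2 M)
    \sum_(k < #|{: Col n.*2}|) normc (\sum_j (coef n0 (m k) (w k) j)%:C%C * K (r k *: x - latpt j)) `^ q.
Proof.
move=> q0.
have C0' : (0 < #|{: Col n.*2}|)%N by rewrite card_ffun !card_ord expn_gt0 n0.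
pose X (k : 'I_#|{: Col n.*2}|) (t : Col n.*2 * Sgn M) : R :=
  normc (\sum_j (coef n0 (m k) t j)%:C%C * K (r k *: x - latpt j)) `^ q.
have T0 : 0 < #|{: Col n.*2 * Sgn M}|%:R :> R.
  by rewrite ltr0n card_prod muln_gt0 C0' card_ffun card_bool expn_gt0.
rewrite -(ler_pM2l T0) (sum_marginal X) mulrCA ler_wpM2l//.
rewrite card_prod natrM mulr_sumr mulr_sumr; apply: ler_sum => k _.
have c0 : #|{: Col n.*2}|%:R != 0 :> R by rewrite pnatr_eq0 -lt0n.
set g := \sum_(_ | _) _.
have E (a b h : R) : a != 0 -> a * b * (2^-1 / a * h) = 2^-1 * b * h by move=> a0; field.
rewrite E//.
rewrite -(pair_big xpredT xpredT (fun a e => X k (a, e))) /=.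
rewrite /g (partition_big (@colour d n.*2 n0 M) xpredT) //= mulr_sumr; apply: ler_sum => a _.
have [[j0 /andP[aj0 bj0]]|nj] := pselect (exists j : J M, (active (m k) j && (colour n0 j == a)) && (r k *: x - latpt j \in box n)).
  rewrite (bigD1 j0)//= big1 ?addr0 => [|j /andP[/andP[aj cj] jj0]].
    apply: le_trans (sum_signs_ge (fun j => K (r k *: x - latpt j)) q0 (chi := fun j => active (m k) j && (colour n0 j == a)) aj0).
    by rewrite /kbox indicE bj0 mulr1.
  rewrite /kbox indicE; case: (boolP (_ \in _)) => [bj|_]; last by rewrite mulr0.
  move/negP: jj0; case; apply/eqP; apply: (@colour_inj R d n n0 M _ _ (r k *: x)).
  - by move: aj0 => /andP[_ /eqP ->]; exact/eqP.
  - by rewrite inE in bj.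
  - by rewrite inE in bj0.
rewrite big1 ?mulr0 => [|j ajc]; first by apply: sumr_ge0 => e _; exact: powR_ge0.
rewrite /kbox indicE; case: (boolP (_ \in _)) => [bj|_]; last by rewrite mulr0.
by case: nj; exists j; rewrite ajc bj.
Qed.

End pointwise.

(** * Square functions of packets *)

Section square_function.
Context {R : realType} {d : nat}.
Implicit Types (x y : 'rV[R]_d) (fs : nat -> 'rV[R]_d -> R[i]).
Local Notation mu := (@lebesgue_rV R d).

Definition sqfun (p q : R) N fs x : R := (\sum_(k < N) normc (fs k x) `^ q) `^ (p / q).

Lemma sqfun_ge0 p q N fs x : 0 <= sqfun p q N fs x.
Proof. exact: powR_ge0. Qed.

Lemma measurable_normc (f : 'rV[R]_d -> R[i]) : cmeasurable f ->
  measurable_fun setT (fun x => normc (f x) : measurableTypeR R).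
Proof.
move=> [m1 m2].
rewrite (_ : (fun x => _) = fun x => Num.sqrt (complex.Re (f x) ^+ 2 + complex.Im (f x) ^+ 2)); last first.
  by apply/funext => x; case: (f x).
apply: (measurableT_comp (f := (@Num.sqrt R : measurableTypeR R -> measurableTypeR R))).
  by apply: continuous_measurable_fun; exact: sqrt_continuous.
by apply: measurable_funD; exact: measurable_funX.
Qed.

Lemma measurable_sqfun p q N fs : (forall k, cmeasurable (fs k)) ->
  measurable_fun setT (sqfun p q N fs).
Proof.
move=> mf; apply: (measurableT_comp (measurable_powR (p / q))).
apply: measurable_sum => k; apply: (measurableT_comp (measurable_powR q)).
exact: measurable_normc.
Qed.

(** Only finitely many of the functions are nonzero, so that the series is a
    finite sum. *)
Lemma LpLq_norm_pow (p q : R) N fs : 0 < q -> q <= p -> (forall k x, (N <= k)%N -> fs k x = 0) ->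
  (LpLq_norm p q fs `^ p)%E = (\int[mu]_x (sqfun p q N fs x)%:E)%E.
Proof.
move=> q0 qp f0; have p0 : 0 < p by exact: lt_le_trans qp.
rewrite /LpLq_norm poweR_Lnorm ?gt_eqF//; apply: eq_integral => x _.
have -> : (\sum_(k <oo) (normc (fs k x) `^ q)%:E)%E = (\sum_(k < N) normc (fs k x) `^ q)%:E.
  rewrite (nneseries_split 0 N); last by move=> k _; rewrite lee_fin powR_ge0.
  rewrite add0n big_mkord eseries0 ?adde0 ?sumEFin// => k Nk _.
  by rewrite f0// normc0 powR0// gt_eqF.
set S := \sum_(k < N) _; transitivity ((`|S `^ q^-1| `^ p)%:E) => //.
by rewrite ger0_norm ?powR_ge0// /sqfun -powRrM mulrC.
Qed.

Lemma integral_le_W (g : 'rV[R]_d -> R) (D L : R) : 0 < L -> measurable_fun setT g -> (forall x, 0 <= g x) ->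
  (forall x, g x <= D * W (L^-1 *: x)) ->
  (\int[mu]_x (g x)%:E <= (D * (L ^+ d * pi ^+ d))%:E)%E.
Proof.
move=> L0 mg g0 gD.
have Ln0 : L^-1 != 0 by rewrite invr_eq0 gt_eqF.
have D0 : 0 <= D by have := le_trans (g0 0) (gD 0); rewrite pmulr_lge0 ?W_gt0.
have iW := integrable_affine_rV 0 Ln0 (@integrable_W R d).
rewrite -[leRHS](_ : (\int[mu]_x ((D * W (L^-1 *: x + 0))%:E) = _)%E).
  apply: ge0_le_integral => //.
  - by move=> x _; rewrite lee_fin.
  - exact/measurable_EFinP.
  - exact: (measurable_int _ (integrableZl measurableT D iW)).
  - by move=> x _; rewrite lee_fin addr0.
rewrite EFin_Rintegral; last exact: (integrableZl measurableT D iW).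
congr EFin; rewrite RintegralZl// (Rintegral_affine_rV 0 Ln0 (@integrable_W R d)) Rintegral_W.
by rewrite gtr0_norm ?invr_gt0// exprVn invrK.
Qed.

Lemma pow_norm_le (p A : R) (x y X Y : \bar R) : 0 < p -> (0 <= x)%E -> (0 <= y)%E ->
  (x `^ p = X)%E -> (y `^ p = Y)%E -> (y <= A%:E * x)%E ->
  (0 <= A -> (Y <= (A `^ p)%:E * X)%E) /\ (A < 0 -> X = 0%E).
Proof.
move=> p0 x0 y0 <- <- h; split => A0.
  have AE0 : (0 <= A%:E)%E by rewrite lee_fin.
  rewrite -[(A `^ p)%:E]/(A%:E `^ p)%E -(poweRM p AE0 x0).
  apply: (gt0_ler_poweR (ltW p0) _ _ h); rewrite in_itv/= leey andbT//.
  exact: mule_ge0.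
suff -> : x = 0%E by rewrite poweR_EFin powR0// gt_eqF.
apply/eqP; rewrite eq_le x0 andbT leNgt; apply/negP => Fpos.
have : (A%:E * x < 0)%E by rewrite mule_lt0_gt0.
by rewrite ltNge (le_trans y0 h).
Qed.

Definition bounded_by (p q A : R) (r : nat -> R) (K : 'rV[R]_d -> R[i]) :=
  forall f : nat -> 'rV[R]_d -> R[i], (forall k, E_space (2 * r k) (f k)) -> in_LpLq p q f ->
    (LpLq_norm p q (fun k => convolution (dilate (r k) K) (f k)) <= A%:E * LpLq_norm p q f)%E.

(** The case A < 0 is kept in order to be excluded by [norm_const_ge0]. *)
Lemma test_packets (p q A : R) (r : nat -> R) (K : 'rV[R]_d -> R[i]) :
  0 < q -> q <= p -> (forall k, 0 < r k) -> E_space 1 K ->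
  bounded_by p q A r K -> forall (I : Type) N (s : nat -> seq I) (c : nat -> I -> R) (b : nat -> I -> 'rV[R]_d) (D L : R) F G,
  (forall k, (N <= k)%N -> s k = [::]) -> 0 < L ->
  (forall k, F k = fun x => (packet (s k) (c k) (b k) (r k) x)%:C%C) ->
  (forall k, G k = fun x => \sum_(j <- s k) (c k j)%:C%C * K (r k *: x + b k j)) ->
  (forall x, sqfun p q N F x <= D * W (L^-1 *: x)) ->
  (0 <= A -> (\int[mu]_x (sqfun p q N G x)%:E <= (A `^ p)%:E * \int[mu]_x (sqfun p q N F x)%:E)%E) /\
  (A < 0 -> (\int[mu]_x (sqfun p q N F x)%:E = 0)%E).
Proof.
move=> q0 qp r0 EK hyp I N s c b D L F G sN L0 FE GE FD.
have p0 : 0 < p by exact: lt_le_trans qp.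
have mF k : cmeasurable (F k).
  rewrite FE; split; last exact: measurable_cst.
  by apply: (@rdecay_measurable R d); apply: rdecay_packet; rewrite gt_eqF.
have F0 k x : (N <= k)%N -> F k x = 0 by move=> Nk; rewrite FE /packet sN// big_nil.
have G0 k x : (N <= k)%N -> G k x = 0 by move=> Nk; rewrite GE sN// big_nil.
have Fp := LpLq_norm_pow q0 qp F0; have Gp := LpLq_norm_pow q0 qp G0.
have Flt : (LpLq_norm p q F `^ p < +oo)%E.
  rewrite Fp; apply: le_lt_trans (integral_le_W L0 (measurable_sqfun p q N mF) (sqfun_ge0 p q N F) FD) _.
  exact: ltry.
have Ffin : in_LpLq p q F.
  by split => //; apply: lty_poweRy Flt; rewrite gt_eqF.
have cG : (fun k => convolution (dilate (r k) K) (F k)) = G.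
  by apply/funext => k; rewrite FE GE; apply/funext => x; exact: convolution_packet.
have EF k : E_space (2 * r k) (F k) by rewrite FE; exact: E_packet.
have := hyp F EF Ffin; rewrite cG => h.
have F1 : (0 <= LpLq_norm p q F)%E by exact: Lnorm_ge0.
have G1 : (0 <= LpLq_norm p q G)%E by exact: Lnorm_ge0.
exact: (pow_norm_le p0 F1 G1 Fp Gp h).
Qed.

End square_function.

(** * The bound on a box *)

Section box_bound.
Context {R : realType} {d : nat}.
Implicit Types (x y : 'rV[R]_d).
Local Notation mu := (@lebesgue_rV R d).

(** A single packet has a nonzero and finite norm, since the integral of kern
    is 1. *)
Lemma norm_const_ge0 (p q A : R) (r : nat -> R) (K : 'rV[R]_d -> R[i]) :
  0 < q -> q <= p -> (forall k, 0 < r k) -> E_space 1 K -> bounded_by p q A r K -> 0 <= A.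
Proof.
move=> q0 qp r0 EK hyp; rewrite leNgt; apply/negP => A0.
have p0 : 0 < p by exact: lt_le_trans qp.
have [m mp] : exists m : nat, 1 <= m%:R * p.
  exists (Num.bound p^-1); rewrite -ler_pdivrMr// mul1r (le_trans (ltW (archi_boundP _)))//.
  by rewrite invr_ge0 ltW.
have [C C0 kC] := rdecay_bound m (@rdecay_kern R d).
pose s (k : nat) := if k is 0%N then [:: tt] else [::].
have sN k : (1 <= k)%N -> s k = [::] by case: k.
have L0 : 0 < (r 0%N)^-1 by rewrite invr_gt0.
pose F k x := (packet (s k) (fun=> 1) (fun=> 0) (r k) x)%:C%C.
have FE x : sqfun p q 1 F x = `|kern (r 0%N *: x)| `^ p.
  rewrite /sqfun big_ord1 /F /packet /= big_seq1 addr0 mul1r expr0n /= addr0 sqrtr_sqr -powRrM.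
  by rewrite mulrC divfK// gt_eqF.
have FD x : sqfun p q 1 F x <= C `^ p * W ((r 0%N)^-1^-1 *: x).
  rewrite invrK FE (@le_trans _ _ ((C * W (r 0%N *: x) ^+ m) `^ p))//.
    by apply: ge0_ler_powR; rewrite ?nnegrE ?mulr_ge0 ?exprn_ge0 ?W_ge0// ltW.
  rewrite powRM ?exprn_ge0 ?W_ge0// ler_wpM2l ?powR_ge0// -powR_mulrn ?W_ge0// -powRrM.
  by rewrite -[leRHS]powRr1 ?W_ge0//; apply: ger_powR => //; rewrite W_gt0 W_le1.
have [_ /(_ A0) I0] := test_packets q0 qp r0 EK hyp sN L0 (fun k => erefl (F k)) (fun k => erefl) FD.
have dk : rdecay (fun x => @kern R d (r 0%N *: x + 0)) by apply: rdecay_affine; [rewrite gt_eqF|exact: rdecay_kern].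
have mk := rdecay_measurable dk.
have mF : measurable_fun setT (fun x => (sqfun p q 1 F x)%:E).
  apply/measurable_EFinP; rewrite (_ : sqfun _ _ _ _ = fun x => `|kern (r 0%N *: x + 0)| `^ p).
    by apply: (measurableT_comp (measurable_powR p)); exact: measurableT_comp.
  by apply/funext => x; rewrite FE addr0.
have /(ae_eq_integral_abs mu measurableT mF).1 : (\int[mu]_x `|(sqfun p q 1 F x)%:E| = 0)%E.
  by rewrite -[RHS]I0; apply: eq_integral => x _; rewrite gee0_abs// lee_fin powR_ge0.
move=> ae0.
have : \int[mu]_x kern (r 0%N *: x + 0) = 0.
  rewrite /Rintegral (@ae_eq_integral _ _ _ mu setT (cst 0%E))//.
  - by rewrite integral0.
  - exact/measurable_EFinP.
  apply: filterS ae0 => x /(_ I) h _ /=; move: h; rewrite FE => -[/powR_eq0_eq0/eqP].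
  by rewrite normr_eq0 addr0 => /eqP ->.
rewrite Rintegral_affine_rV; last 2 first.
- by rewrite gt_eqF.
- exact/rdecay_integrable/rdecay_kern.
by rewrite integral_kern mulr1 => /eqP; rewrite invr_eq0 expf_eq0 normr_eq0 (gt_eqF (r0 0%N)) andbF.
Qed.

Local Notation J M := {ffun 'I_d -> 'I_M}.
Local Notation Col n := {ffun 'I_d -> 'I_n}.
Local Notation Sgn M := {ffun J M -> bool}.
Local Notation Omega n M := {ffun 'I_#|{: Col n}| -> Col n * Sgn M}.

Lemma card_active M m : (m <= M)%N -> #|[pred j : J M | active m j]| = (m ^ d)%N.
Proof.
move=> mM; have e : #|[pred i : 'I_M | (i < m)%N]| = m.
  by rewrite -sum1_card -(big_ord_widen M (fun=> 1%N) mM) sum1_card card_ord.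
transitivity (#|[pred i : 'I_M | (i < m)%N]| ^ d)%N; last by rewrite e.
by rewrite -[X in (_ ^ X)%N](card_ord d) -card_ffun_on; apply: eq_card => j; rewrite inE.
Qed.

Lemma measurable_kbox (K : 'rV[R]_d -> R[i]) (q : R) n : cmeasurable K ->
  measurable_fun setT (kbox K q n).
Proof.
move=> mK; apply: measurable_funM.
  by apply: (measurableT_comp (measurable_powR q)); exact: measurable_normc.
apply: measurable_indic.
by apply: (@measurable_box R d (fun=> `[- n%:R, n%:R[%classic)) => i; exact: measurable_itv.
Qed.

Lemma kbox_ge0 (K : 'rV[R]_d -> R[i]) (q : R) n x : 0 <= kbox K q n x.
Proof. by rewrite mulr_ge0// powR_ge0. Qed.

Lemma cmeasurable_packet_sum (I : Type) (s : seq I) (c : I -> R) (b : I -> 'rV[R]_d) (r : R)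
  (K : 'rV[R]_d -> R[i]) : cmeasurable K ->
  cmeasurable (fun x => \sum_(j <- s) (c j)%:C%C * K (r *: x + b j)).
Proof.
move=> [m1 m2]; split.
  rewrite (_ : (fun x => _) = fun x => \sum_(j <- s) c j * complex.Re (K (r *: x + b j))).
    apply: measurable_sum => j; apply: measurable_funM => //.
    by apply: (measurableT_comp m1); exact: measurable_affine_rV.
  apply/funext => x; elim: s => [|j s IH]; rewrite ?big_nil// !big_cons -IH.
  by case: (K _) (\sum_(_ <- _) _) => u v [u' v'] /=; ring.
rewrite (_ : (fun x => _) = fun x => \sum_(j <- s) c j * complex.Im (K (r *: x + b j))).
  apply: measurable_sum => j; apply: measurable_funM => //.
  by apply: (measurableT_comp m2); exact: measurable_affine_rV.
apply/funext => x; elim: s => [|j s IH]; rewrite ?big_nil// !big_cons -IH.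
by case: (K _) (\sum_(_ <- _) _) => u v [u' v'] /=; ring.
Qed.

(** The comparison of the two sides integrated over x and over a finite
    probability space Om, with a the constant of the hypothesis and D W(x / L)
    the bound for the right-hand side. Stating it for an abstract Om and
    abstract integrands keeps the concrete probability space out of the
    conversion checks. *)
Lemma average_bound (Om : finType) (SF SG : Om -> 'rV[R]_d -> R) (h b : 'rV[R]_d -> R)
    (a D c1 c2 V L : R) : 0 < L -> 0 <= a -> 0 <= c1 -> 0 <= c2 ->
  (forall w, measurable_fun setT (SF w)) -> (forall w, measurable_fun setT (SG w)) ->
  measurable_fun setT h -> measurable_fun setT b ->
  (forall w x, 0 <= SF w x) -> (forall w x, 0 <= SG w x) ->
  (forall x, 0 <= h x) -> (forall x, 0 <= b x) ->
  (forall w, \int[mu]_x (SG w x)%:E <= a%:E * \int[mu]_x (SF w x)%:E)%E ->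
  (forall x, \sum_w SF w x <= D * W (L^-1 *: x)) ->
  (forall x, c1 * h x <= \sum_w SG w x + c2 * b x) ->
  (\int[mu]_x (b x)%:E = V%:E)%E ->
  (c1%:E * \int[mu]_x (h x)%:E <= (a * (D * (L ^+ d * pi ^+ d)) + c2 * V)%:E)%E.
Proof.
move=> L0 a0 c10 c20 mSF mSG mh mb SF0 SG0 h0 b0 GF SFE hG bV.
have X1 : (\sum_w \int[mu]_x (SG w x)%:E <= (a * (D * (L ^+ d * pi ^+ d)))%:E)%E.
  apply: (@le_trans _ _ (\sum_w a%:E * \int[mu]_x (SF w x)%:E)%E).
    by apply: lee_sum => w _.
  rewrite -ge0_sume_distrr; last by move=> w _; apply: integral_ge0 => x _; rewrite lee_fin.
  rewrite EFinM lee_wpmul2l ?lee_fin// -ge0_integral_sum//; last 2 first.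
  - by move=> w; apply/measurable_EFinP.
  - by move=> w x _; rewrite lee_fin.
  under eq_integral do rewrite sumEFin.
  have mS : measurable_fun setT (fun x => \sum_w SF w x) by exact: measurable_sum.
  have S0 x : 0 <= \sum_w SF w x by exact: sumr_ge0.
  exact: (integral_le_W L0 mS S0 SFE).
rewrite EFinD; apply: le_trans (leeD2r _ X1); rewrite EFinM -bV.
have mh' : measurable_fun setT (fun x => (h x)%:E) by apply/measurable_EFinP.
have mb' : measurable_fun setT (fun x => (b x)%:E) by apply/measurable_EFinP.
rewrite -ge0_integralZl_EFin//; last by move=> x _; rewrite lee_fin.
rewrite -ge0_integralZl_EFin//; last by move=> x _; rewrite lee_fin.
rewrite -ge0_integral_sum//; last 2 first.
- by move=> w; apply/measurable_EFinP.
- by move=> w x _; rewrite lee_fin.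
rewrite -ge0_integralD//; last 4 first.
- by move=> x _; apply: sume_ge0 => w _; rewrite lee_fin.
- by apply: emeasurable_sum => w; apply/measurable_EFinP.
- by move=> x _; rewrite -EFinM lee_fin mulr_ge0.
- by apply: emeasurable_funM.
apply: ge0_le_integral => //.
- by move=> x _; rewrite -EFinM lee_fin mulr_ge0.
- by apply: emeasurable_funM.
- apply: emeasurable_funD; first by apply: emeasurable_sum => w; apply/measurable_EFinP.
  by apply: emeasurable_funM.
by move=> x _; rewrite sumEFin -!EFinM -EFinD lee_fin.
Qed.

Section construction.
Variables (p q : R) (K : 'rV[R]_d -> R[i]) (r : nat -> R) (n M : nat) (m : nat -> nat) (L : R).
Hypotheses (q0 : 0 < q) (qp : q <= p) (mK : cmeasurable K) (r0 : forall k, 0 < r k)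
  (n0 : (0 < n.*2)%N) (L0 : 0 < L).
Hypothesis mM : forall k : 'I_#|{: Col n.*2}|, (m k <= M)%N.
Hypothesis nL : forall k : 'I_#|{: Col n.*2}|, n%:R <= r k * L.
Hypothesis mL : forall k : 'I_#|{: Col n.*2}|, (m k)%:R <= r k * L.
Hypothesis Lm : forall k : 'I_#|{: Col n.*2}|, r k * L / 2 <= (m k)%:R.

Let bigbox : set 'rV[R]_d := [set v | forall i, `[- L, 2 * L]%classic (v ord0 i)].

Let meas_bigbox : measurable bigbox.
Proof. by apply: (@measurable_box R d (fun=> `[- L, 2 * L]%classic)) => i; exact: measurable_itv. Qed.

Let hbox x : R := 2^-1 * #|{: Col n.*2}|%:R^-1 *
  \sum_(k < #|{: Col n.*2}|) \sum_(j : J M | active (m k) j) kbox K q n (r k *: x - latpt j).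

Let hbox_ge0 x : 0 <= hbox x.
Proof.
by rewrite !mulr_ge0// ?invr_ge0//; do 2 apply: sumr_ge0 => ? _; exact: kbox_ge0.
Qed.

Let hbox_out x : ~ bigbox x -> hbox x = 0.
Proof.
move=> xQ; rewrite /hbox big1 ?mulr0// => k _; rewrite big1// => j aj.
rewrite /kbox indicE; case: (boolP (_ \in _)) => [|_]; last by rewrite mulr0.
rewrite inE => xb; case: xQ => i; have := xb i.
rewrite /= !in_itv/= !mxE => /andP[b1 b2].
have jm : (j i)%:R <= r k * L.
  by apply: le_trans (mL k); rewrite ler_nat ltnW//; move/forallP: aj.
have j0 : 0 <= (j i)%:R :> R by [].
have nk := nL k; have rk := r0 k; apply/andP; split.
  by rewrite -(ler_pM2l rk); lra.
by rewrite -(ler_pM2l rk); lra.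
Qed.

Definition rcoef (w : Omega n.*2 M) (k : nat) (j : J M) : R :=
  oapp (fun k' => coef n0 (m k) (w k') j) 0 (insub k).

Definition rseq (k : nat) : seq (J M) :=
  if (k < #|{: Col n.*2}|)%N then index_enum _ else [::].

Definition rtest w k x : R[i] :=
  (packet (rseq k) (rcoef w k) (fun j => - latpt j) (r k) x)%:C%C.

Definition rconv w k x : R[i] :=
  \sum_(j <- rseq k) (rcoef w k j)%:C%C * K (r k *: x + - latpt j).

Let rtestE w (k : 'I_#|{: Col n.*2}|) x : normc (rtest w k x) = `|tpacket n0 (m k) (w k) (r k) x|.
Proof.
rewrite /rtest /rseq ltn_ord /tpacket /packet /rcoef /= expr0n /= addr0 sqrtr_sqr; congr `|_|.
by apply: eq_bigr => j _; rewrite valK.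
Qed.

Let rconvE w (k : 'I_#|{: Col n.*2}|) x : rconv w k x =
  \sum_j (coef n0 (m k) (w k) j)%:C%C * K (r k *: x - latpt j).
Proof. by rewrite /rconv /rseq ltn_ord /rcoef; apply: eq_bigr => j _; rewrite valK. Qed.

Let weighted x (l : R) : 0 < l ->
  #|{: Omega n.*2 M}|%:R * (p / q * l `^ (p / q - 1)) * hbox x <=
  \sum_(w : Omega n.*2 M) sqfun p q #|{: Col n.*2}| (rconv w) x
  + #|{: Omega n.*2 M}|%:R * ((p / q - 1) * l `^ (p / q)) * \1_bigbox x.
Proof.
move=> l0; have s1 : 1 <= p / q by rewrite ler_pdivlMr// mul1r.
have [xQ|xQ] := pselect (bigbox x); last first.
  rewrite hbox_out// mulr0 addr_ge0// ?sumr_ge0//; first by move=> w _; exact: powR_ge0.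
  by rewrite !mulr_ge0 ?powR_ge0// subr_ge0.
rewrite indicE mem_set// mulr1.
have h := @lower_point R d q K n M n0 m r x q0.
apply: (@le_trans _ _ (p / q * l `^ (p / q - 1) * \sum_(w : Omega n.*2 M)
  \sum_(k < #|{: Col n.*2}|) normc (\sum_j (coef n0 (m k) (w k) j)%:C%C * K (r k *: x - latpt j)) `^ q)).
  rewrite -mulrA mulrCA ler_wpM2l// mulr_ge0 ?powR_ge0//.
  exact: le_trans s1.
rewrite mulr_sumr [X in _ <= _ + X]mulr_natl -sumr_const -big_split /=; apply: ler_sum => w _.
rewrite /sqfun; under [X in _ <= X `^ _ + _]eq_bigr do rewrite rconvE.
by apply: powR_tangent => //; apply: sumr_ge0 => k _; exact: powR_ge0.
Qed.

Let mhbox : measurable_fun setT hbox.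
Proof.
apply: measurable_funM => //; apply: measurable_sum => k.
rewrite (_ : (fun _ => _) = fun x => \sum_(j : J M) if active (m k) j then kbox K q n (r k *: x - latpt j) else 0); last first.
  by apply/funext => x; rewrite big_mkcond.
apply: measurable_sum => j; case: (active (m k) j) => //.
apply: (measurableT_comp (measurable_kbox q n mK)); exact: measurable_affine_rV.
Qed.

Let integral_hbox :
  ((2^-1 * (L / 2) ^+ d)%:E * \int[mu]_x (kbox K q n x)%:E <= \int[mu]_x (hbox x)%:E)%E.
Proof.
set I := (\int[mu]_x _)%E; have I0 : (0 <= I)%E by apply: integral_ge0 => x _; rewrite lee_fin kbox_ge0.
have mkb : measurable_fun setT (fun x => (kbox K q n x)%:E) by apply/measurable_EFinP; exact: measurable_kbox.
pose f (k : 'I_#|{: Col n.*2}|) (j : J M) x : \bar R := (kbox K q n (r k *: x + - latpt j))%:E.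
have mf k j : measurable_fun setT (f k j).
  by apply: (measurableT_comp mkb); exact: measurable_affine_rV.
have f0 k j x : (0 <= f k j x)%E by rewrite lee_fin kbox_ge0.
have If k j : (\int[mu]_x f k j x = (r k ^- d)%:E * I)%E.
  rewrite (ge0_integral_affine_rV _ _ mkb); first by rewrite gtr0_norm.
    by rewrite gt_eqF.
  by move=> x; rewrite lee_fin kbox_ge0.
have c0 : 0 < #|{: Col n.*2}|%:R :> R.
  by rewrite ltr0n card_ffun !card_ord expn_gt0 n0.
have -> : (\int[mu]_x (hbox x)%:E = (2^-1 * #|{: Col n.*2}|%:R^-1)%:E *
    \sum_(k < #|{: Col n.*2}|) \sum_(j : J M | active (m k) j) (r k ^- d)%:E * I)%E.
  transitivity (\int[mu]_x ((2^-1 * #|{: Col n.*2}|%:R^-1)%:E * \sum_(k < #|{: Col n.*2}|) \sum_(j <- enum (active (m k))) f k j x))%E.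
    apply: eq_integral => x _; rewrite /hbox EFinM -sumEFin; congr (_ * _)%E.
    by apply: eq_bigr => k _; rewrite -sumEFin big_enum.
  have S0 x : [set: 'rV[R]_d] x -> (0 <= \sum_(k < #|{: Col n.*2}|) \sum_(j <- enum (active (m k))) f k j x)%E.
    by move=> _; do 2 apply: sume_ge0 => ? _.
  have mS (k : 'I_#|{: Col n.*2}|) : measurable_fun setT (fun x => \sum_(j <- enum (active (m k))) f k j x)%E.
    exact: emeasurable_sum.
  rewrite (ge0_integralZl_EFin mu measurableT S0); last 2 first.
  - exact: emeasurable_sum.
  - by rewrite mulr_ge0// invr_ge0.
  rewrite (ge0_integral_sum mu measurableT mS); last by move=> k x _; apply: sume_ge0 => j _.
  congr (_ * _)%E; apply: eq_bigr => k _; rewrite ge0_integral_sum// big_enum.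
  by apply: eq_bigr => j _; rewrite If.
have rd0 k : 0 <= r k ^- d by rewrite invr_ge0 exprn_ge0// ltW.
have -> : (\sum_(k < #|{: Col n.*2}|) \sum_(j : J M | active (m k) j) (r k ^- d)%:E * I =
    (\sum_(k < #|{: Col n.*2}|) \sum_(j : J M | active (m k) j) r k ^- d)%:E * I)%E.
  rewrite -sumEFin ge0_sume_distrl; last by move=> k _; rewrite lee_fin sumr_ge0.
  apply: eq_bigr => k _; rewrite -sumEFin ge0_sume_distrl// => j _.
  by rewrite lee_fin.
rewrite muleA -EFinM lee_wpmul2r// lee_fin -mulrA ler_wpM2l// ler_pdivlMl//.
rewrite -[X in X%:R * _]card_ord mulr_natl -sumr_const; apply: ler_sum => k _.
have -> : \sum_(j : J M | active (m k) j) r k ^- d = \sum_(j in [pred j : J M | active (m k) j]) r k ^- d by [].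
rewrite sumr_const card_active ?mM// -[leRHS]mulr_natl natrX ler_pdivlMr ?exprn_gt0//.
rewrite -exprMn lerXn2r ?nnegrE ?mulr_ge0 ?(ltW (r0 k)) ?(ltW L0)//.
by rewrite mulrC mulrA; exact: Lm.
Qed.

Let volume_bigbox : (\int[mu]_x (\1_bigbox x)%:E = ((3 * L) ^+ d)%:E)%E.
Proof.
rewrite integral_indic// setIT.
transitivity (\prod_(i < d) lebesgue_measure (`[- L, (2 * L)%R]%classic%R : set (measurableTypeR R)))%E.
  by apply: (@lebesgue_rV_box R d (fun=> `[- L, 2 * L]%classic)) => i; exact: measurable_itv.
rewrite (eq_bigr (fun=> (3 * L)%:E)); last first.
  have LL : - L < 2 * L by apply: (@lt_trans _ _ 0); rewrite ?oppr_lt0 ?mulr_gt0.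
  move=> i _; rewrite lebesgue_measure_itv /= lte_fin LL.
  by rewrite -EFinD; congr EFin; ring.
by rewrite prodEFin prodr_const card_ord.
Qed.

(** The tangent line inequality at the level l. The level is a real number
    below a multiple of the integral of |K|^q over the box: this integral is
    not known to be finite at this stage. *)
Lemma box_bound_level (A C l : R) : 0 <= C -> E_space 1 K -> bounded_by p q A r K ->
  (forall x, \sum_(w : Omega n.*2 M)
     (\sum_(k < #|{: Col n.*2}|) `|tpacket n0 (m k) (w k) (r k) x| `^ q) `^ (p / q) <=
     C * #|{: Omega n.*2 M}|%:R * W (L^-1 *: x)) ->
  0 < l -> (l%:E <= (2^-1 * 6 ^- d)%:E * \int[mu]_x (kbox K q n x)%:E)%E ->
  3 ^+ d * l `^ (p / q) <= A `^ p * C * pi ^+ d.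
Proof.
move=> C0 EK hyp upper l0 lI.
have p0 : 0 < p by exact: lt_le_trans qp.
have A0 := norm_const_ge0 q0 qp r0 EK hyp.
set s := p / q; have s1 : 1 <= s by rewrite ler_pdivlMr// mul1r.
have s0 : 0 < s by exact: lt_le_trans s1.
set Om : R := #|{: Omega n.*2 M}|%:R.
have Om0 : 0 < Om.
  rewrite ltr0n card_ffun expn_gt0 card_prod muln_gt0 !card_ffun !card_ord expn_gt0 n0.
  by rewrite expn_gt0 card_bool.
pose SF w x := sqfun p q #|{: Col n.*2}| (rtest w) x.
pose SG w x := sqfun p q #|{: Col n.*2}| (rconv w) x.
have SFE x : \sum_(w : Omega n.*2 M) SF w x <= C * Om * W (L^-1 *: x).
  apply: le_trans (upper x); apply: ler_sum => w _; rewrite /SF /sqfun.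
  by under eq_bigr do rewrite rtestE.
have rN k : (#|{: Col n.*2}| <= k)%N -> rseq k = [::] by rewrite /rseq ltnNge => ->.
have SFw w x : SF w x <= C * Om * W (L^-1 *: x).
  apply: le_trans (SFE x); rewrite (bigD1 w)//= lerDl sumr_ge0// => ? _; exact: sqfun_ge0.
have GF w : (\int[mu]_x (SG w x)%:E <= (A `^ p)%:E * \int[mu]_x (SF w x)%:E)%E.
  have FE k : rtest w k = fun x => (packet (rseq k) (rcoef w k) (fun j => - latpt j) (r k) x)%:C%C by [].
  have GE k : rconv w k = fun x => \sum_(j <- rseq k) (rcoef w k j)%:C%C * K (r k *: x + - latpt j) by [].
  have [h _] := test_packets q0 qp r0 EK hyp rN L0 FE GE (SFw w).
  exact: h.
have mSF w : measurable_fun setT (SF w).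
  apply: measurable_sqfun => k; split; last exact: measurable_cst.
  by apply: (@rdecay_measurable R d); apply: rdecay_packet; rewrite gt_eqF.
have mSG w : measurable_fun setT (SG w).
  by apply: measurable_sqfun => k; exact: (cmeasurable_packet_sum (rseq k) (rcoef w k) _ (r k) mK).
pose c1 := Om * (s * l `^ (s - 1)); pose c2 := Om * ((s - 1) * l `^ s).
have c10 : 0 <= c1 by apply: mulr_ge0; [exact: ltW|apply: mulr_ge0; [exact: ltW|exact: powR_ge0]].
have c20 : 0 <= c2.
  by apply: mulr_ge0; [exact: ltW|apply: mulr_ge0; [rewrite subr_ge0|exact: powR_ge0]].
have X2 : (c1%:E * \int[mu]_x (hbox x)%:E <=
    (A `^ p * (C * Om * (L ^+ d * pi ^+ d)) + c2 * (3 * L) ^+ d)%:E)%E.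
  have mb : measurable_fun setT (\1_bigbox : 'rV[R]_d -> R) by exact: measurable_indic.
  have b0 x : 0 <= (\1_bigbox x : R) by [].
  have hG x : c1 * hbox x <= \sum_(w : Omega n.*2 M) SG w x + c2 * \1_bigbox x by exact: weighted.
  have SF0 w x : 0 <= SF w x by exact: sqfun_ge0.
  have SG0 w x : 0 <= SG w x by exact: sqfun_ge0.
  have a0 := powR_ge0 A p.
  exact: (average_bound L0 a0 c10 c20 mSF mSG mhbox mb SF0 SG0 hbox_ge0 b0 GF SFE hG volume_bigbox).
have X3 : ((c1 * (2^-1 * (L / 2) ^+ d) * (l / (2^-1 * 6 ^- d)))%:E <= c1%:E * \int[mu]_x (hbox x)%:E)%E.
  rewrite -mulrA EFinM lee_wpmul2l ?lee_fin//; apply: le_trans integral_hbox.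
  rewrite EFinM lee_wpmul2l ?lee_fin//; first by rewrite mulr_ge0// exprn_ge0// divr_ge0// ltW.
  by rewrite mulrC EFinM lee_pdivrMl// mulr_gt0// ?invr_gt0 ?exprn_gt0.
have := le_trans X3 X2; rewrite lee_fin /c1 /c2.
have ls : l `^ (s - 1) * l = l `^ s.
  by rewrite -[X in _ * X](powRr1 (ltW l0)) -powRD ?subrK// gt_eqF ?implybT.
have h6 : (L / 2) ^+ d * 6 ^+ d = 3 ^+ d * L ^+ d by rewrite -!exprMn; congr (_ ^+ _); field.
have OL : 0 < Om * L ^+ d by rewrite mulr_gt0// exprn_gt0.
have d6 : 6 ^+ d != 0 :> R by rewrite expf_neq0.
rewrite (_ : _ * (l / _) = Om * s * (l `^ (s - 1) * l) * ((L / 2) ^+ d * 6 ^+ d)); last by field.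
rewrite ls h6 exprMn => h; rewrite -(ler_pM2l OL); move: h.
move: (l `^ s) (3 ^+ d) (L ^+ d) (pi ^+ d) (A `^ p) => a b c e f h.
by rewrite -subr_ge0 in h; rewrite -subr_ge0; move: h; congr (_ <= _); ring.
Qed.

End construction.

End box_bound.

(** * The whole space *)

Section conclusion.
Context {R : realType} {d : nat}.
Local Notation mu := (@lebesgue_rV R d).

Lemma E_space_measurable (K : 'rV[R]_d -> R[i]) (rho : R) : E_space rho K -> cmeasurable K.
Proof.
move=> [sK _]; split; apply: continuous_measurable_rV; apply: rsmooth_cont => s x;
  by have [] := sK s x.
Qed.

(** If the integral exceeded the bound, a level l contradicting
    [box_bound_level] would exist. *)
Lemma box_bound (p q : R) : 0 < q -> q <= p -> exists2 C : R, 0 <= C &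
  forall (r : nat -> R) (K : 'rV[R]_d -> R[i]) (A : R), (forall k, 0 < r k) ->
  E_space 1 K -> bounded_by p q A r K -> forall n,
  (\int[mu]_x (kbox K q n.+1 x)%:E <= (C * A `^ q)%:E)%E.
Proof.
move=> q0 qp; have p0 : 0 < p by exact: lt_le_trans qp.
have [C C0 CP] := @upper_point R d p q q0 qp.
have d6 : 0 < 6 ^+ d :> R by rewrite exprn_gt0.
exists (2 * 6 ^+ d * (C * pi ^+ d) `^ (q / p)) => [|r K A r0 EK hyp n].
  by rewrite mulr_ge0 ?powR_ge0// mulr_ge0// ltW.
have A0 := norm_const_ge0 q0 qp r0 EK hyp.
pose N := #|{: {ffun 'I_d -> 'I_n.+1.*2}}|.
(* any L with r_k L >= 2 n for all k < N would do *)
pose L : R := 1 + \sum_(k < N) n.+1.*2%:R / r k.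
have s0 : 0 <= \sum_(k < N) n.+1.*2%:R / r k by apply: sumr_ge0 => k _; rewrite divr_ge0// ltW.
have L0 : 0 < L by rewrite ltr_pwDl.
have rL (k : 'I_N) : n.+1.*2%:R <= r k * L.
  rewrite mulrC -ler_pdivrMr// /L (bigD1 k)//= addrCA lerDl addr_ge0//.
  by apply: sumr_ge0 => j _; rewrite divr_ge0// ltW.
have n2 : 2 <= n.+1.*2%:R :> R by rewrite ler_nat.
pose m k := Num.truncn (r k * L).
have rL0 k : 0 <= r k * L by rewrite mulr_ge0// ltW.
pose M := \max_(k < N) m k.
have mM (k : 'I_N) : (m k <= M)%N by exact: (leq_bigmax k).
have mL k : (m k)%:R <= r k * L by have /andP[] := truncn_itv (rL0 k).
have Lm (k : 'I_N) : r k * L / 2 <= (m k)%:R.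
  have /andP[_] := truncn_itv (rL0 k); rewrite -/(m k) -natr1.
  by have := le_trans n2 (rL k); lra.
have nL (k : 'I_N) : n.+1%:R <= r k * L.
  by apply: le_trans (rL k); rewrite ler_nat -addnn leq_addr.
have L1 (k : 'I_N) : 1 <= r k * L by have := le_trans n2 (rL k); lra.
have upper x := CP n.+1.*2 M isT m r L x L0 L1 (fun k => mL k).
have I0 : (0 <= \int[mu]_x (kbox K q n.+1 x)%:E)%E.
  by apply: integral_ge0 => x _; rewrite lee_fin kbox_ge0.
rewrite leNgt; apply/negP => lt.
have [t t1 t2] : exists2 t : R, 2 * 6 ^+ d * (C * pi ^+ d) `^ (q / p) * A `^ q < t &
    (t%:E <= \int[mu]_x (kbox K q n.+1 x)%:E)%E.
  move: lt I0; case: (\int[mu]_x _)%E => [t| |]//; first by rewrite lte_fin => lt _; exists t.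
  by move=> _ _; exists (2 * 6 ^+ d * (C * pi ^+ d) `^ (q / p) * A `^ q + 1); rewrite ?ltrDl// leey.
pose l := 2^-1 * 6 ^- d * t.
have ll : (C * pi ^+ d) `^ (q / p) * A `^ q < l.
  rewrite (_ : l = t / (2 * 6 ^+ d)); last by rewrite /l; field; rewrite gt_eqF.
  rewrite ltr_pdivlMr ?mulr_gt0//.
  by rewrite mulrC mulrA.
have l0 : 0 < l by apply: le_lt_trans ll; rewrite mulr_ge0 ?powR_ge0.
have lI : (l%:E <= (2^-1 * 6 ^- d)%:E * \int[mu]_x (kbox K q n.+1 x)%:E)%E.
  by rewrite /l EFinM lee_wpmul2l// lee_fin mulr_ge0// invr_ge0 ltW.
have := box_bound_level q0 qp (E_space_measurable EK) r0 L0 mM nL (fun k => mL k) Lm C0 EK hyp upper l0 lI.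
apply/negP; rewrite -ltNge.
have h1 : A `^ p * C * pi ^+ d < l `^ (p / q).
  have -> : A `^ p * C * pi ^+ d = ((C * pi ^+ d) `^ (q / p) * A `^ q) `^ (p / q).
    rewrite powRM ?powR_ge0// -!powRrM.
    have -> : q / p * (p / q) = 1 by field; rewrite !gt_eqF.
    have -> : q * (p / q) = p by field; rewrite gt_eqF.
    by rewrite powRr1 ?mulr_ge0 ?exprn_ge0 ?pi_ge0//; ring.
  apply: gt0_ltr_powR => //; first exact: divr_gt0.
    by rewrite nnegrE mulr_ge0 ?powR_ge0.
  by rewrite nnegrE ltW.
by apply: (lt_le_trans h1); rewrite ler_peMl ?powR_ge0// exprn_ege1//; lra.
Qed.

Lemma bounded_in_Lp (p q : R) : 0 < q -> q <= p -> exists C : R,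
  forall (r : nat -> R) (K : 'rV[R]_d -> R[i]) (A : R), (forall k, 0 < r k) ->
  E_space 1 K -> bounded_by p q A r K ->
  in_Lp q K /\ (Lp_norm q K <= (C * A)%:E)%E.
Proof.
move=> q0 qp; have [C C0 CP] := box_bound q0 qp.
exists (C `^ q^-1) => r K A r0 EK hyp.
have A0 := norm_const_ge0 q0 qp r0 EK hyp.
have mK := E_space_measurable EK.
have h : (\int[mu]_x (normc (K x) `^ q)%:E <= (C * A `^ q)%:E)%E.
  have cv : (\int[mu]_x (kbox K q n.+1 x)%:E)%E @[n --> \oo] --> (\int[mu]_x (normc (K x) `^ q)%:E)%E.
    rewrite (_ : (fun x => (normc (K x) `^ q)%:E) = fun x => limn (fun n => (kbox K q n.+1 x)%:E)).
      apply: cvg_monotone_convergence => //.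
      - by move=> n; apply/measurable_EFinP; exact: measurable_kbox.
      - by move=> n x _; rewrite lee_fin kbox_ge0.
      - move=> x _ a b ab; rewrite lee_fin /kbox ler_wpM2l ?powR_ge0// !indicE ler_nat.
        case: (boolP (x \in box a.+1)) => // xa; rewrite mem_set// => i.
        move: xa; rewrite inE => /(_ i); rewrite /= !in_itv/= => /andP[x1 x2].
        have ab' : a.+1%:R <= b.+1%:R :> R by rewrite ler_nat.
        by apply/andP; split; lra.
    apply/funext => x; apply/esym/cvg_lim => //.
    apply: cvg_near_cst; exists (Num.bound `|x|) => // n /= xn.
    rewrite /kbox indicE mem_set ?mulr1// => i.
    have : `|x ord0 i| <= `|x|.
      by rewrite /Num.norm /= mx_normrE; exact: (le_bigmax _ (fun ij => `|x ij.1 ij.2|) (ord0, i)).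
    have : `|x| < (Num.bound `|x|)%:R by exact: archi_boundP.
    have xn' : (Num.bound `|x|)%:R <= n.+1%:R :> R by rewrite ler_nat ltnW.
    move=> h1 h2; have : `|x ord0 i| < n.+1%:R by rewrite (le_lt_trans h2)// (lt_le_trans h1).
    by rewrite ltr_norml /= in_itv/= => /andP[/ltW -> ->].
  apply: (cvge_le _ cv); apply: nearW => n; exact: CP.
have E : (Lp_norm q K `^ q = \int[mu]_x (normc (K x) `^ q)%:E)%E.
  have qn0 : q != 0 by rewrite gt_eqF.
  transitivity (\int[mu]_x (`|(normc (K x))%:E| `^ q))%E; first exact: poweR_Lnorm.
  apply: eq_integral => x _.
  by rewrite /= ger0_norm// normc_nneg.
have N0 : (0 <= Lp_norm q K)%E by exact: Lnorm_ge0.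
have le : (Lp_norm q K <= (C `^ q^-1 * A)%:E)%E.
  have -> : Lp_norm q K = ((Lp_norm q K `^ q) `^ q^-1)%E.
    by rewrite -poweRrM divff ?gt_eqF// poweRe1.
  have -> : (C `^ q^-1 * A)%:E = ((C * A `^ q)%:E `^ q^-1)%E.
    by rewrite poweR_EFin powRM ?powR_ge0// -powRrM divff ?gt_eqF// powRr1.
  apply: gt0_ler_poweR; rewrite ?in_itv/= ?leey ?andbT ?invr_ge0 ?(ltW q0)//.
  - exact: poweR_ge0.
  - by rewrite lee_fin mulr_ge0 ?powR_ge0.
  - by rewrite E.
split => //; split => //; apply: le_lt_trans le _; exact: ltry.
Qed.

End conclusion.

Theorem theorem1p1 (R : realType) (d : nat) (p q : R) :
  (0 < d)%N -> 0 < q -> q <= p ->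
  exists C : R,
    forall (r : nat -> R) (K : 'rV[R]_d -> R[i]) (A : R),
      (forall k, 0 < r k) ->
      E_space 1 K ->
      (forall f : nat -> 'rV[R]_d -> R[i],
         (forall k, E_space (2 * r k) (f k)) ->
         in_LpLq p q f ->
         (forall k, convolvable (dilate (r k) K) (f k)) /\
         (LpLq_norm p q (fun k => convolution (dilate (r k) K) (f k))
            <= A%:E * LpLq_norm p q f)%E) ->
      in_Lp q K /\ (Lp_norm q K <= (C * A)%:E)%E.
Proof.
move=> _ q0 qp; have [C CP] := @bounded_in_Lp R d p q q0 qp.
by exists C => r K A r0 EK hyp; apply: (CP r K A r0 EK) => f Ef lf; case: (hyp f Ef lf).
Qed.
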